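(* Let $\Omega$ be an open and connected subset of $\mathbb{C}$, let $N$ be a natural number, and let $A:\Omega\to\mathbb{C}^{N\times N}$ be a holomorphic matrix-valued function that is nonsingular somewhere on $\Omega$. Let $v$ and $w$ be nonnegative $N\times 1$ vectors. Let $\alpha$ be a real element of $\Omega$. Assume: (1) $A(s)$ is Metzler for all real $s\in\Omega$. (2) $\zeta(A(\alpha))=0$. (3) If $\gamma$ and $\delta$ are classes of $A(\alpha)$ with $\gamma\not\preceq\delta$, then $A_{\gamma,\delta}(z)=0$ for all $z\in\Omega$. (4) Either $\zeta(A_{\gamma,\gamma}(s))$ has a positive left- or right-derivative at $\alpha$ as a function of real $s\in\Omega$ for every basic class $\gamma$ of $A(\alpha)$, or $\zeta(A_{\gamma,\gamma}(s))$ has a negative left- or right-derivative at $\alpha$ as a function of real $s\in\Omega$ for every basic class $\gamma$ of $A(\alpha)$. Then: (a) $\alpha$ is a pole of $A(z)^{-1}$ with order equal to the length of the longest chain of classes of $A(\alpha)$. (b) If there exists a positive length chain of classes $(\gamma_1,\dots,\gamma_\ell)$ of $A(\alpha)$ such that $\max_{m\in\gamma_1}v_m>0$ and $\max_{n\in\gamma_\ell}w_n>0$, then $\alpha$ is a pole of $v^\top A(z)^{-1}w$ with order equal to the length of the longest such chain. (c) If no such chain exists, then $\alpha$ is a removable singularity of $v^\top A(z)^{-1}w$.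
   Context: A real matrix (or vector) is nonnegative if all its entries are nonnegative. A square matrix is Metzler if it is real and all of its off-diagonal entries are nonnegative. The spectral abscissa $\zeta(B)$ of a complex square matrix $B$ is the maximum of the real parts of the eigenvalues of $B$. A matrix-valued function is holomorphic (meromorphic) on an open set if each of its entries is. A point $z_0$ is a pole of order $d$ of a meromorphic matrix-valued function if $d$ is the highest order of any pole at $z_0$ among the entries, with at least one entry having a pole of order $d$. (When $A$ is holomorphic on $\Omega$ and somewhere nonsingular, $A(z)^{-1}$ is meromorphic on $\Omega$.) Directed graph and classes. An $N\times N$ matrix $B$ generates a directed graph with vertex set $\{1,\dots,N\}$ and with a directed edge from $m$ to $n$ for each ordered pair $(m,n)$, $m\neq n$, such that the $(m,n)$-entry of $B$ is nonzero. Vertex $m$ has access to vertex $n$ if $m=n$ or there is a path of directed edges from $m$ to $n$. Vertices communicate if each has access to the other; this is an equivalence relation, and the equivalence classes are called the classes of $B$. For classes $\gamma,\delta$ of $B$, write $\gamma\preceq\delta$ if some vertex in $\gamma$ has access to some vertex in $\delta$, and write $\gamma\prec\delta$ if $\gamma\preceq\delta$ and $\gamma\neq\delta$. For index sets $\gamma,\delta$, $B_{\gamma,\delta}$ denotes the submatrix of $B$ obtained by deleting the rows whose indices are not in $\gamma$ and the columns whose indices are not in $\delta$; $A_{\gamma,\delta}(z)$ is the corresponding submatrix of $A(z)$. If $B$ is Metzler, then a class $\gamma$ of $B$ is basic if $\zeta(B_{\gamma,\gamma})=\zeta(B)$, and otherwise nonbasic. An $\ell$-tuple of classes $(\gamma_1,\dots,\gamma_\ell)$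 is a chain of classes if $\ell=1$ or if $\gamma_k\prec\gamma_{k+1}$ for each $k\in\{1,\dots,\ell-1\}$. The length of a chain is the number of basic classes it contains (possibly zero). The length of the longest chain means the maximum length over all chains. *)

(* Defs.v *)
From HB Require Import structures.
From mathcomp Require Import all_boot all_order all_algebra.
From mathcomp Require Import complex.
From mathcomp Require Import all_classical all_reals all_analysis.

Set Implicit Arguments.
Unset Strict Implicit.
Unset Printing Implicit Defensive.

Import Order.TTheory GRing.Theory Num.Theory.
Import numFieldNormedType.Exports.

Local Open Scope classical_set_scope.
Local Open Scope ring_scope.

Section ComplexFunctions.
Variable R : realType.

(* [R[i]^o] is the complex field seen as a normed space over itself, so that
   [derivable f z 1] is complex differentiability of [f] at [z].  Functions are
   total; only their values on the relevant (punctured) open set matter. *)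
Implicit Types (f g : R[i]^o -> R[i]^o) (z : R[i]^o) (d : nat).

Definition holomorphic_on (U : set R[i]^o) f :=
  forall z, U z -> derivable f z 1.

Definition holomorphic_at f z := \forall u \near z, derivable f u 1.

Definition meromorphic_at f z := exists d g,
  holomorphic_at g z /\ \forall u \near z^', f u = g u / (u - z) ^+ d.

Definition removable_singularity f z := exists g,
  holomorphic_at g z /\ \forall u \near z^', f u = g u.

Definition pole_of_order f z d := (0 < d)%N /\ exists g,
  [/\ holomorphic_at g z, g z != 0 &
      \forall u \near z^', f u = g u / (u - z) ^+ d].

Definition mx_holomorphic_on m n (U : set R[i]^o) (F : R[i] -> 'M[R[i]]_(m, n)) :=
  forall i j, holomorphic_on U (fun z => F z i j).

Definition mx_pole_of_order m n (F : R[i] -> 'M[R[i]]_(m, n)) (z : R[i]) d :=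
  [/\ forall i j, meromorphic_at (fun u => F u i j) z,
      exists i j, pole_of_order (fun u => F u i j) z d &
      forall i j k, pole_of_order (fun u => F u i j) z k -> (k <= d)%N].

End ComplexFunctions.

Section OneSidedDerivatives.
Variable R : realType.

Definition has_right_derivative (f : R -> R) (a l : R) :=
  (fun h => (f (a + h) - f a) / h) @ 0^'+ --> l.

Definition has_left_derivative (f : R -> R) (a l : R) :=
  (fun h => (f (a + h) - f a) / h) @ 0^'- --> l.

End OneSidedDerivatives.

Section Matrices.
Variable R : realType.

(* In the partial order of [R[i]], [0 <= x] means that [x] is real and
   nonnegative. *)
Definition metzler n (B : 'M[R[i]]_n) :=
  (forall i j, B i j \is Num.real) /\ (forall i j, i != j -> 0 <= B i j).

Definition spectral_abscissa n (B : 'M[R[i]]_n) : R :=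
  sup [set complex.Re a | a in [set a | eigenvalue B a]].

Lemma spectral_abscissa_max n (B : 'M[R[i]]_n) : (0 < n)%N ->
  (exists2 a, eigenvalue B a & complex.Re a = spectral_abscissa B) /\
  (forall a, eigenvalue B a -> complex.Re a <= spectral_abscissa B).
Proof.
move=> n0.
have [rs rsE] := closed_field_poly_normal (char_poly B).
have lc : lead_coef (char_poly B) = 1 by apply/monicP/char_poly_monic.
have eP a : eigenvalue B a = (a \in rs).
  by rewrite eigenvalue_root_char rsE lc scale1r root_prod_XsubC.
have rs0 : (0 < size rs)%N.
  have := size_char_poly B; rewrite rsE lc scale1r size_prod_XsubC.
  by move=> [->].
pose x0 := head 0 rs.
have x0rs : x0 \in rs.
  by rewrite /x0; case: (rs) rs0 => // a l _; rewrite mem_head.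
pose m := \big[Num.max/complex.Re x0]_(a <- rs) complex.Re a.
have ub a : a \in rs -> complex.Re a <= m.
  by move=> ars; exact: (@le_bigmax_seq _ _ _ _ _ a xpredT _ ars).
have [b brs bE] : exists2 b, b \in rs & complex.Re b = m.
  rewrite /m big_seq.
  elim/big_ind: _ => [|x y [b ? <-] [c ? <-]|a ars]; [by exists x0| |by exists a].
  by have [_|_] := leP (complex.Re b) (complex.Re c); [exists c|exists b].
have -> : spectral_abscissa B = m.
  apply/eqP; rewrite eq_le; apply/andP; split.
    apply: ge_sup; first by exists m, b => //=; rewrite eP.
    by move=> _ [a /= + <-]; rewrite eP; exact: ub.
  apply: ub_le_sup; last by exists b => //=; rewrite eP.
  by exists m => _ [a /= + <-]; rewrite eP; exact: ub.
by split=> [|a]; [exists b; rewrite ?eP|rewrite eP; exact: ub].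
Qed.

Definition submatrix n (B : 'M[R[i]]_n) (gamma delta : {set 'I_n}) :
    'M[R[i]]_(#|gamma|, #|delta|) :=
  mxsub (@enum_val _ (mem gamma)) (@enum_val _ (mem delta)) B.

End Matrices.

Section Classes.
Variables (R : realType) (n : nat) (B : 'M[R[i]]_n).
Implicit Types (i j : 'I_n) (gamma delta : {set 'I_n}) (c : seq {set 'I_n}).

Definition edge : rel 'I_n := [rel i j | (i != j) && (B i j != 0)].

Definition access : rel 'I_n := connect edge.

Definition communicate : rel 'I_n := [rel i j | access i j && access j i].

Definition vertex_classes : {set {set 'I_n}} :=
  equivalence_partition communicate [set: 'I_n].

Definition class_le : rel {set 'I_n} :=
  [rel gamma delta : {set 'I_n} |
     [exists i in gamma, [exists j in delta, access i j]]].

Definition class_lt : rel {set 'I_n} :=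
  [rel gamma delta : {set 'I_n} | class_le gamma delta && (gamma != delta)].

Definition basic gamma : bool :=
  spectral_abscissa (submatrix B gamma gamma) == spectral_abscissa B.

Definition class_chain c : bool :=
  [&& c != [::], all (fun gamma => gamma \in vertex_classes) c & sorted class_lt c].

Definition chain_length c : nat := count basic c.

Definition longest_chain_length (P : seq {set 'I_n} -> Prop) (l : nat) : Prop :=
  (exists c, [/\ class_chain c, P c & chain_length c = l]) /\
  (forall c, class_chain c -> P c -> (chain_length c <= l)%N).

(* [head set0 c] and [last set0 c] are the first and last classes of the
   nonempty tuple [c]; the default value [0] of the maxima is immaterial for
   nonnegative [v] and [w]. *)
Definition positive_chain_between (v w : 'cV[R]_n) c : Prop :=
  [/\ class_chain c, (0 < chain_length c)%N,
      0 < \big[Num.max/0]_(i in head finset.set0 c) v i 0 &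
      0 < \big[Num.max/0]_(j in last finset.set0 c) w j 0].

End Classes.

Definition bilinear_inverse (R : realType) n (v w : 'cV[R]_n)
    (A : R[i] -> 'M[R[i]]_n) (z : R[i]) : R[i] :=
  ((map_mx (real_complex R) v)^T *m invmx (A z) *m map_mx (real_complex R) w)
    0 0.

(* Main.v *)
Require Import Defs.
From HB Require Import structures.
From mathcomp Require Import all_boot all_order all_algebra.
From mathcomp Require Import complex.
From mathcomp Require Import all_classical all_reals all_analysis.
From mathcomp Require Import ring lra perm polyrcf.

(** Write [s = alpha + sg * t] with [t] tending to [0] from the right, where
    [sg] is [1] or [-1] and is chosen so that the spectral abscissas of the basic
    diagonal blocks of [A s] become negative on that side of [alpha].  There
    [X t = - A(s)^-1] is an entrywise nonnegative matrix, and the point of the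
    proof is that each of its entries grows exactly like [t ^- d], where [d] is
    the length of the longest chain between the classes of its two indices.

    Let [P] be the inverse of the diagonal block of [- A s] at a class [gamma].
    It is the adjugate divided by the determinant.  The block is irreducible at
    [alpha], so by Perron-Frobenius theory the adjugate tends to a positive matrix
    ([irreducible_adj_gt0]).  For a nonbasic class the determinant tends to a
    positive number, for a basic class it vanishes to the first order, because its
    derivative is a positive multiple of minus the derivative of the abscissa
    ([det_derivative_spectral]).  So all entries of [P] grow exactly like [t ^- 1]
    if [gamma] is basic and like [1] otherwise ([block_inverse_basic],
    [block_inverse_nonbasic]).  The columns of [X] are obtained from these inverses
    by back-substitution along the order of the classes ([block_solve]).  Only
    nonnegative numbers are added and multiplied, so no cancellation occurs:
    exponents add along a chain and the largest one wins ([growth_ge_chain],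
    [growth_le_chain]).  For the same reason the growth of [v^T X w] is that of
    its fastest growing term.

    It remains to turn growth along one ray into orders of poles.  A zero of a
    holomorphic function can be divided out ([holomorphic_zero_factor]); hence a
    lower bound along the ray gives [\det A] a zero of finite order, which makes
    the inverse meromorphic ([ray_order], [inverse_meromorphic]), and a two-sided
    bound by multiples of [t ^- d] on a meromorphic function means a pole of order
    [d], or a removable singularity if [d = 0] ([ray_pole_of_order],
    [ray_removable]).  The divisibility statement rests on Goursat's theorem: an
    integral of [f] against the Cauchy kernel over a small square shows that near
    [0] the function [f] differs from a rational function by a term of the third
    order, so that its difference quotient is differentiable at [0]. *)

Set Implicit Arguments.
Unset Strict Implicit.
Unset Printing Implicit Defensive.

Import Order.TTheory GRing.Theory Num.Theory.
Import numFieldNormedType.Exports.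

Local Open Scope classical_set_scope.
Local Open Scope ring_scope.
Local Open Scope complex_scope.

(** * Modulus and complex derivatives *)

(** The norm of [R[i]] takes its values in [R[i]]; estimates are made with the
    modulus as a real number. *)
Notation cabs := ComplexField.Normc.normc.

Section Modulus.
Variable R : realType.
Local Notation C := R[i]^o.
Implicit Types (z w : R[i]) (e d : R).

Lemma cabsE z : `|z| = (cabs z)%:C.
Proof. by rewrite normc_def; case: z. Qed.

Lemma cabs_ge0 z : 0 <= cabs z.
Proof. by rewrite -ler0c -cabsE. Qed.

Lemma cabs_eq0 z : (cabs z == 0) = (z == 0).
Proof. by rewrite -[RHS]normr_eq0 cabsE; apply/eqP/eqP => [->|/complexI]. Qed.

Lemma cabs_gt0 z : (0 < cabs z) = (z != 0).
Proof. by rewrite lt_neqAle cabs_ge0 andbT eq_sym cabs_eq0. Qed.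

Lemma cabsN z : cabs (- z) = cabs z.
Proof. by apply: (@complexI R); rewrite -!cabsE normrN. Qed.

Lemma cabsD z w : cabs (z + w) <= cabs z + cabs w.
Proof. by rewrite -lecR rmorphD /= -!cabsE ler_normD. Qed.

Lemma cabsB z w : cabs (z - w) <= cabs z + cabs w.
Proof. by rewrite -(cabsN w) cabsD. Qed.

Lemma cabs_distC z w : cabs (z - w) = cabs (w - z).
Proof. by rewrite -cabsN opprB. Qed.

Lemma cabsR (x : R) : cabs x%:C = `|x|.
Proof. by apply: (@complexI R); rewrite -cabsE normc_def /= expr0n addr0 sqrtr_sqr. Qed.

Lemma cabsX z n : cabs (z ^+ n) = cabs z ^+ n.
Proof.
elim: n => [|n IH]; first by rewrite !expr0 ComplexField.Normc.normc1.
by rewrite !exprS ComplexField.Normc.normcM IH.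
Qed.

Lemma cabs_Re z : `|complex.Re z| <= cabs z.
Proof. by rewrite -lecR -cabsE normc_ge_Re. Qed.

Lemma cabs_Im z : `|complex.Im z| <= cabs z.
Proof.
rewrite -lecR -cabsE normc_def lecR; case: z => a b /=.
by rewrite -sqrtr_sqr ler_sqrt ?lerDr ?sqr_ge0 ?addr_ge0 ?sqr_ge0.
Qed.

Definition im1 : R[i] := 0 +i* 1.

Lemma cabs_i : cabs im1 = 1.
Proof. by rewrite /= expr0n expr1n add0r sqrtr1. Qed.

Lemma rectE z : z = (complex.Re z)%:C + im1 * (complex.Im z)%:C.
Proof.
case: z => a b; apply/eqP; rewrite eq_complex /=.
by apply/andP; split; apply/eqP; ring.
Qed.

Lemma cabs_le z : cabs z <= `|complex.Re z| + `|complex.Im z|.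
Proof.
rewrite {1}[z]rectE; apply: le_trans (cabsD _ _) _.
by rewrite ComplexField.Normc.normcM cabs_i mul1r !cabsR.
Qed.

Lemma ReD z w : complex.Re (z + w) = complex.Re z + complex.Re w.
Proof. by case: z w => [a b] [c d]. Qed.
Lemma ImD z w : complex.Im (z + w) = complex.Im z + complex.Im w.
Proof. by case: z w => [a b] [c d]. Qed.
Lemma ReB z w : complex.Re (z - w) = complex.Re z - complex.Re w.
Proof. by case: z w => [a b] [c d]. Qed.
Lemma ImB z w : complex.Im (z - w) = complex.Im z - complex.Im w.
Proof. by case: z w => [a b] [c d]. Qed.

Lemma near_cabsP (z : C) (P : C -> Prop) :
  (\forall w \near z, P w) <-> exists2 d, 0 < d & forall w, cabs (w - z) < d -> P w.
Proof.
split=> [/nbhs_ballP[e /= e0 eP]|[d d0 dP]].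
  exists (complex.Re e); first by move: e0; rewrite ltcE => /andP[].
  move=> w wz; apply: eP; rewrite -ball_normE /ball_ /= distrC cabsE.
  by move: e0; rewrite !ltcE /= => /andP[/eqP -> _]; rewrite eqxx.
apply/nbhs_ballP; exists d%:C; first by rewrite /= ltcR.
by move=> w; rewrite -ball_normE /ball_ /= distrC cabsE ltcR; exact: dP.
Qed.

Lemma near_cabs'P (z : C) (P : C -> Prop) :
  (\forall w \near z^', P w) <->
  exists2 d, 0 < d & forall w, w != z -> cabs (w - z) < d -> P w.
Proof.
split=> [H|[d d0 dP]].
  have /near_cabsP[d d0 dP] : \forall w \near z, w != z -> P w := H.
  by exists d => // w wz wd; apply: dP.
have : \forall w \near z, w != z -> P w.
  by apply/near_cabsP; exists d => // w wd wz; apply: dP.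
exact.
Qed.

Lemma continuous_cabsP (f : C -> C) (z : C) : {for z, continuous f} <->
  forall e, 0 < e -> exists2 d, 0 < d &
    forall w, cabs (w - z) < d -> cabs (f w - f z) < e.
Proof.
split=> [/cvgrPdist_lt cf e e0|H].
  have /near_cabsP[d d0 dP] := cf e%:C (ltac:(by rewrite ltcR)).
  by exists d => // w /dP; rewrite distrC cabsE ltcR.
apply/(@cvgrPdist_lt _ _ _ (nbhs z) (nbhs_filter z)) => e.
rewrite ltcE => /andP[/= /eqP e1 /H[d d0 dP]].
apply/near_cabsP; exists d => // w /dP lt.
by rewrite distrC cabsE ltcE /= e1 eqxx.
Qed.

(** Differentiability with remainder estimate, without a division, so that the
    point [z] itself needs no separate treatment in estimates under an integral. *)
Definition cdiff (f : C -> C) (z : C) (l : R[i]) := forall e, 0 < e ->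
  exists2 d, 0 < d & forall w, cabs (w - z) < d ->
    cabs (f w - f z - l * (w - z)) <= e * cabs (w - z).

Lemma derivable_cdiff (f : C -> C) z : derivable f z 1 -> exists l, cdiff f z l.
Proof.
move=> /cvg_ex[l /cvgrPdist_le fl]; exists l => e e0.
have /near_cabs'P[d d0 dP] := fl e%:C (ltac:(by rewrite ltcR)).
exists d => // w wd; have [->|wz] := eqVneq w z.
  by rewrite !subrr mulr0 subr0 ComplexField.Normc.normc0 mulr0.
have wz0 : w - z != 0 by rewrite subr_eq0.
have := dP (w - z) wz0; rewrite subr0 => /(_ wd).
rewrite /= [_%:A](_ : _ = w - z); last by rewrite /GRing.scale /= mulr1.
rewrite subrK cabsE lecR => h.
have -> : f w - f z - l * (w - z) = - ((l - (w - z)^-1 *: (f w - f z)) * (w - z)).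
  rewrite mulrBl opprB; congr (_ - _).
  by rewrite /GRing.scale /= mulrAC mulVf ?mul1r.
by rewrite cabsN ComplexField.Normc.normcM ler_wpM2r ?cabs_ge0.
Qed.

Lemma cdiff_derivable (f : C -> C) z l : cdiff f z l -> derivable f z 1.
Proof.
move=> fl; apply/cvg_ex; exists l; apply/cvgrPdist_le => e.
rewrite ltcE => /andP[/= /eqP e1 /fl[d d0 dP]].
apply/near_cabs'P; exists d => // h h0; rewrite subr0 => hd.
have := dP (h + z); rewrite addrK => /(_ hd) lt.
rewrite /= [h%:A](_ : _ = h); last by rewrite /GRing.scale /= mulr1.
rewrite cabsE lecE /= e1 eqxx /=.
rewrite -(ler_pM2r (_ : 0 < cabs h)) ?cabs_gt0 //; apply: le_trans lt.
rewrite -ComplexField.Normc.normcM -cabsN.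
rewrite [X in cabs X <= _](_ : _ = f (h + z) - f z - l * h) //.
rewrite mulrBl opprB; congr (_ - _).
by rewrite /GRing.scale /= mulrAC mulVf ?mul1r.
Qed.

Lemma derivable_continuous (f : C -> C) z : derivable f z 1 -> {for z, continuous f}.
Proof. by move=> /derivable1_diffP/differentiable_continuous. Qed.

End Modulus.

(** * Integrals along segments *)

Section SegmentIntegral.
Variable R : realType.
Local Notation mu := (@lebesgue_measure R).
Implicit Types (a b c : R) (phi psi : R -> R[i]).

Definition seg_continuous a b phi := forall x, a <= x <= b -> forall e, 0 < e ->
  exists2 d, 0 < d & forall y, a <= y <= b -> `|y - x| < d ->
    cabs (phi y - phi x) < e.

Lemma seg_continuous_real a b phi (g : R[i] -> R) :
  (forall z w, `|g z - g w| <= cabs (z - w)) -> seg_continuous a b phi ->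
  {within `[a, b], continuous (fun x => g (phi x))}.
Proof.
move=> gle cphi; apply/subspace_continuousP => x; rewrite /= in_itv /= => xab.
apply/cvgrPdist_lt => e e0; have [d d0 dP] := cphi x xab e e0.
rewrite near_withinE; apply/nbhs_ballP; exists d => //= y yd.
rewrite in_itv /= => yab; rewrite distrC; apply: le_lt_trans (gle _ _) _.
by apply: dP => //; rewrite distrC.
Qed.

Lemma Re_le (z w : R[i]) : `|complex.Re z - complex.Re w| <= cabs (z - w).
Proof. by rewrite -ReB cabs_Re. Qed.
Lemma Im_le (z w : R[i]) : `|complex.Im z - complex.Im w| <= cabs (z - w).
Proof. by rewrite -ImB cabs_Im. Qed.
Lemma cabs_dist_le (z w : R[i]) : `|cabs z - cabs w| <= cabs (z - w).
Proof.
rewrite ler_norml; apply/andP; split.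
  by have := cabsD (w - z) z; rewrite subrK cabs_distC; lra.
by have := cabsD (z - w) w; rewrite subrK; lra.
Qed.

Lemma seg_continuous_bounded a b phi : a <= b -> seg_continuous a b phi ->
  exists M, forall x, a <= x <= b -> cabs (phi x) <= M.
Proof.
move=> ab /(seg_continuous_real cabs_dist_le)/(EVT_max ab)[c _ cmax].
by exists (cabs (phi c)) => x xab; apply: cmax; rewrite in_itv.
Qed.

Definition cint a b phi : R[i] :=
  (\int[mu]_(x in `[a, b]) complex.Re (phi x)) +i*
  (\int[mu]_(x in `[a, b]) complex.Im (phi x)).

Lemma seg_integrable a b phi (g : R[i] -> R) :
  (forall z w, `|g z - g w| <= cabs (z - w)) -> seg_continuous a b phi ->
  mu.-integrable `[a, b] (EFin \o (fun x => g (phi x))).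
Proof.
move=> gle cphi; apply: continuous_compact_integrable; first exact: segment_compact.
exact: seg_continuous_real.
Qed.

Let iRe a b phi := @seg_integrable a b phi _ Re_le.
Let iIm a b phi := @seg_integrable a b phi _ Im_le.
#[local] Hint Resolve iRe iIm : core.

Lemma seg_continuousZ a b (k : R[i]) phi :
  seg_continuous a b phi -> seg_continuous a b (fun x => k * phi x).
Proof.
move=> cp x xab e e0.
have k1 : 0 < cabs k + 1 by rewrite ltr_wpDl ?cabs_ge0.
have [d d0 dP] := cp x xab (e / (cabs k + 1)) (divr_gt0 e0 k1).
exists d => // y yab /dP => /(_ yab); rewrite ltr_pdivlMr // => lt.
rewrite -mulrBr ComplexField.Normc.normcM mulrC; apply: le_lt_trans lt.
by rewrite ler_wpM2l ?cabs_ge0 // lerDl.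
Qed.

Lemma seg_continuousD a b phi psi : seg_continuous a b phi -> seg_continuous a b psi ->
  seg_continuous a b (fun x => phi x + psi x).
Proof.
move=> c1 c2 x xab e e0.
have [d d0 dP] := c1 x xab (e / 2) (ltac:(by rewrite divr_gt0)).
have [r r0 rP] := c2 x xab (e / 2) (ltac:(by rewrite divr_gt0)).
exists (Num.min d r); first by rewrite lt_min d0 r0.
move=> y yab; rewrite lt_min => /andP[/(dP _ yab) l1 /(rP _ yab) l2].
rewrite opprD addrACA; apply: le_lt_trans (cabsD _ _) _; lra.
Qed.

Lemma eq_cint a b phi psi : (forall x, a <= x <= b -> phi x = psi x) ->
  cint a b phi = cint a b psi.
Proof.
move=> e; rewrite /cint; congr (_ +i* _); apply: eq_Rintegral => x;
  by rewrite inE /= in_itv /= => /e ->.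
Qed.

Lemma cint_split a b c phi : a <= b -> b <= c -> seg_continuous a c phi ->
  cint a c phi = cint a b phi + cint b c phi.
Proof.
move=> ab bc cphi.
have split (g : R[i] -> R) : (forall z w, `|g z - g w| <= cabs (z - w)) ->
    \int[mu]_(x in `[a, c]) g (phi x) =
    \int[mu]_(x in `[a, b]) g (phi x) + \int[mu]_(x in `[b, c]) g (phi x).
  move=> gle; have ig := seg_integrable gle cphi.
  have := @Rintegral_itvB R _ _ _ b ig; rewrite !bnd_simp => /(_ ab bc) e.
  rewrite -(@Rintegral_itv_obnd_cbnd R b) -?e; first by rewrite addrC subrK.
  apply: integrableS ig => //; apply: subset_itvr.
  by rewrite bnd_simp.
by rewrite /cint (split _ Re_le) (split _ Im_le).
Qed.

Lemma cintD a b phi psi : seg_continuous a b phi -> seg_continuous a b psi ->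
  cint a b (fun x => phi x + psi x) = cint a b phi + cint a b psi.
Proof.
move=> c1 c2; rewrite /cint; apply/eqP; rewrite eq_complex /=.
under eq_Rintegral do rewrite ReD.
under [X in _ && (X == _)]eq_Rintegral do rewrite ImD.
by rewrite !RintegralD ?eqxx //; auto.
Qed.

Lemma cintZ a b (k : R[i]) phi : seg_continuous a b phi ->
  cint a b (fun x => k * phi x) = k * cint a b phi.
Proof.
move=> c1; case: k => r s; rewrite /cint; apply/eqP; rewrite eq_complex /=.
have eRe x : complex.Re ((r +i* s) * phi x) =
  r * complex.Re (phi x) - s * complex.Im (phi x) by case: (phi x).
have eIm x : complex.Im ((r +i* s) * phi x) =
  r * complex.Im (phi x) + s * complex.Re (phi x).
  by case: (phi x).
have iZ (g : R -> R) t : mu.-integrable `[a, b] (EFin \o g) ->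
    mu.-integrable `[a, b] (EFin \o (fun x => t * g x)).
  by move=> ig; apply: eq_integrable (integrableZl _ t ig) => //.
under eq_Rintegral do rewrite eRe.
under [X in _ && (X == _)]eq_Rintegral do rewrite eIm.
rewrite RintegralB ?RintegralD //; try by apply: iZ; auto.
by rewrite !RintegralZl ?eqxx //; auto.
Qed.

(** The factor [2] comes from bounding real and imaginary parts separately. *)
Lemma cint_bound a b phi M : a <= b -> seg_continuous a b phi ->
  (forall x, a <= x <= b -> cabs (phi x) <= M) ->
  cabs (cint a b phi) <= 2 * M * (b - a).
Proof.
move=> ab c1 le.
have bnd (g : R[i] -> R) : (forall z w, `|g z - g w| <= cabs (z - w)) ->
    (forall z, `|g z| <= cabs z) ->
    `|\int[mu]_(x in `[a, b]) g (phi x)| <= M * (b - a).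
  move=> gle gabs; have ig := seg_integrable gle c1.
  have iM : mu.-integrable `[a, b] (EFin \o cst M).
    apply: continuous_compact_integrable; first exact: segment_compact.
    by apply: continuous_subspaceT => x; exact: cvg_cst.
  have mab : measurable (`[a, b] : set (measurableTypeR R)) by [].
  have h1 := le_normr_Rintegral mab ig.
  have h2 : \int[mu]_(x in `[a, b]) `|g (phi x)| <= \int[mu]_(x in `[a, b]) (cst M x).
    apply: le_Rintegral => //; first exact: (integrable_norm ig).
    by move=> x /=; rewrite in_itv /= => /le; exact: le_trans.
  apply: le_trans h1 _; apply: le_trans h2 _.
  rewrite Rintegral_cst //= lebesgue_measure_itv /= lte_fin.
  by move: ab; rewrite le_eqVlt => /predU1P[->|lt]; rewrite ?ltxx ?lt ?subrr ?mulr0.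
apply: le_trans (cabs_le _) _.
rewrite -mulrA mulr_natl mulr2n /cint /=.
by apply: lerD; [exact: bnd _ Re_le (@cabs_Re R)|exact: bnd _ Im_le (@cabs_Im R)].
Qed.

Lemma cint_affine a b (k l : R[i]) : a <= b ->
  cint a b (fun x => k + l * x%:C) = k * (b - a)%:C + l * ((b ^+ 2 - a ^+ 2) / 2)%:C.
Proof.
move=> ab.
have cid : seg_continuous a b (fun x => x%:C).
  by move=> x _ e e0; exists e => // y _; rewrite -(rmorphB (real_complex R)) cabsR.
have c1 : seg_continuous a b (fun=> 1).
  by move=> x _ e e0; exists 1 => // y _ _; rewrite subrr ComplexField.Normc.normc0.
rewrite (@eq_cint _ _ _ (fun x => k * 1 + l * x%:C)); last by move=> x _; rewrite mulr1.
rewrite cintD ?cintZ //; try exact: seg_continuousZ.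
congr (_ * _ + _ * _); rewrite /cint /=.
  rewrite Rintegral_cst // Rintegral_cst //= mul0r mul1r.
  rewrite lebesgue_measure_itv /= lte_fin.
  by move: ab; rewrite le_eqVlt => /predU1P[->|lt]; rewrite ?ltxx ?lt ?subrr.
rewrite [X in _ +i* X]Rintegral_cst // mul0r; congr (_ +i* _).
move: ab; rewrite le_eqVlt => /predU1P[->|ab].
  by rewrite set_itv1 Rintegral_set1 subrr mul0r.
rewrite /Rintegral.
have F (x : R) : derivable (fun x : R => x ^+ 2 / 2) x 1.
  by apply: derivableM.
have Fc (x : R) : {for x, continuous (fun x : R => x ^+ 2 / 2)}.
  by apply: differentiable_continuous; apply/derivable1_diffP.
have := @continuous_FTC2 R id (fun x => x ^+ 2 / 2) a b ab.
move=> ->; first by rewrite -EFinB /= mulrBl.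
- by apply: continuous_subspaceT => x; exact: cvg_id.
- split => //.
  + apply: cvg_at_right_filter; exact: Fc.
  + apply: cvg_at_left_filter; exact: Fc.
- move=> x _; rewrite derive1E.
  have D : is_derive x (1 : R) (fun x : R => x ^+ 2 / 2) x.
    by apply: is_derive_eq; rewrite /GRing.scale /=; field.
  by rewrite derive_val.
Qed.

End SegmentIntegral.

(** * Bisection of rectangles *)

Section Bisection.
Variable R : realType.

Lemma nested_intervals (u v : nat -> R) : (forall n, u n <= u n.+1) ->
  (forall n, v n.+1 <= v n) -> (forall n, u n <= v n) ->
  exists p, forall n, u n <= p <= v n.
Proof.
move=> uS vS uv.
have um : {homo u : n m / (n <= m)%N >-> n <= m}.
  by apply: (@homo_leq _ u <=%R) => // y x z; exact: le_trans.
have vm : {homo v : n m / (n <= m)%N >-> m <= n}.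
  by apply: (@homo_leq _ v (fun x y => y <= x)) => // y x z h1 h2; exact: le_trans h1.
have ubv m : ubound (range u) (v m).
  move=> _ [n _ <-]; apply: le_trans (um _ _ (leq_maxl n m)) _.
  by apply: le_trans (uv _) (vm _ _ (leq_maxr n m)).
exists (sup (range u)) => n; apply/andP; split.
  by apply: ub_le_sup; [exists (v 0%N); exact: ubv|exists n].
by apply: ge_sup; [exists (u 0%N); exists 0%N|exact: ubv].
Qed.

Variables (J : R -> R -> R -> R -> R[i]) (a b c d : R).
Hypotheses (ab : a <= b) (cd : c <= d).
Hypothesis Jx : forall x1 x2 x3 y1 y2, a <= x1 -> x1 <= x2 -> x2 <= x3 -> x3 <= b ->
  c <= y1 -> y1 <= y2 -> y2 <= d -> J x1 x3 y1 y2 = J x1 x2 y1 y2 + J x2 x3 y1 y2.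
Hypothesis Jy : forall x1 x2 y1 y2 y3, a <= x1 -> x1 <= x2 -> x2 <= b ->
  c <= y1 -> y1 <= y2 -> y2 <= y3 -> y3 <= d ->
  J x1 x2 y1 y3 = J x1 x2 y1 y2 + J x1 x2 y2 y3.
Hypothesis Jloc : forall p q, a <= p <= b -> c <= q <= d -> forall e, 0 < e ->
  exists2 r, 0 < r & forall x1 x2 y1 y2,
    a <= x1 -> x1 <= p <= x2 -> x2 <= b -> c <= y1 -> y1 <= q <= y2 -> y2 <= d ->
    (x2 - x1) + (y2 - y1) < r ->
    cabs (J x1 x2 y1 y2) <= e * ((x2 - x1) + (y2 - y1)) ^+ 2.

Let JQ (Q : R * R * (R * R)) := cabs (J Q.1.1 Q.1.2 Q.2.1 Q.2.2).
Let in_rect (Q : R * R * (R * R)) :=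
  [&& a <= Q.1.1, Q.1.1 <= Q.1.2, Q.1.2 <= b, c <= Q.2.1, Q.2.1 <= Q.2.2 & Q.2.2 <= d].

Let lower (s : R * R) := (s.1, (s.1 + s.2) / 2).
Let upper (s : R * R) := ((s.1 + s.2) / 2, s.2).

(** The fourth quarter is the default: if the first three carry less than a quarter
    of the modulus each, the triangle inequality leaves more than that to it. *)
Let quarter (Q : R * R * (R * R)) :=
  if JQ Q <= 4 * JQ (lower Q.1, lower Q.2) then (lower Q.1, lower Q.2)
  else if JQ Q <= 4 * JQ (lower Q.1, upper Q.2) then (lower Q.1, upper Q.2)
  else if JQ Q <= 4 * JQ (upper Q.1, lower Q.2) then (upper Q.1, lower Q.2)
  else (upper Q.1, upper Q.2).

Let quarterP Q : in_rect Q ->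
  [/\ in_rect (quarter Q), JQ Q <= 4 * JQ (quarter Q) &
   [&& Q.1.1 <= (quarter Q).1.1, (quarter Q).1.2 <= Q.1.2,
       Q.2.1 <= (quarter Q).2.1, (quarter Q).2.2 <= Q.2.2,
       (quarter Q).1.2 - (quarter Q).1.1 == (Q.1.2 - Q.1.1) / 2 &
       (quarter Q).2.2 - (quarter Q).2.1 == (Q.2.2 - Q.2.1) / 2]].
Proof.
case: Q => [[x1 x2] [y1 y2]]; rewrite /in_rect /quarter /JQ /lower /upper /=.
case/and5P=> ax xx xb cy /andP[yy yd].
set xm := (x1 + x2) / 2; set ym := (y1 + y2) / 2.
have [xm1 xm2 ym1 ym2] : [/\ x1 <= xm, xm <= x2, y1 <= ym & ym <= y2].
  by rewrite /xm /ym; split; lra.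
have [h1 h2 h3 h4] : [/\ xm - x1 = (x2 - x1) / 2, x2 - xm = (x2 - x1) / 2,
    ym - y1 = (y2 - y1) / 2 & y2 - ym = (y2 - y1) / 2].
  by rewrite /xm /ym; split; lra.
have xmb := le_trans xm2 xb; have ymd := le_trans ym2 yd.
have axm := le_trans ax xm1; have cym := le_trans cy ym1.
have key : cabs (J x1 x2 y1 y2) <= cabs (J x1 xm y1 ym) + cabs (J x1 xm ym y2) +
    (cabs (J xm x2 y1 ym) + cabs (J xm x2 ym y2)).
  rewrite (@Jx x1 xm) // (@Jy x1 xm y1 ym) // (@Jy xm x2 y1 ym) //.
  apply: le_trans (cabsD _ _) _; apply: lerD; exact: cabsD.
case: ifPn => [->|]; last rewrite -ltNge => n1.
  by rewrite ax xm1 xmb cy ym1 ymd !lexx xm2 ym2 h1 h3 !eqxx.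
case: ifPn => [->|]; last rewrite -ltNge => n2.
  by rewrite ax xm1 xmb cym ym1 ym2 yd !lexx xm2 h1 h4 !eqxx.
case: ifPn => [->|]; last rewrite -ltNge => n3.
  by rewrite axm xm1 xm2 xb cy ym1 ymd !lexx ym2 h2 h3 !eqxx.
rewrite /= axm xm1 xm2 xb cym ym1 ym2 yd !lexx h2 h4 !eqxx; split => //.
lra.
Qed.

(** Goursat's bisection: some quarter of a rectangle carries at least a quarter of
    the modulus, and the nested quarters shrink to a point. *)
Lemma rectangle_bisection : J a b c d = 0.
Proof.
apply/eqP; rewrite -cabs_eq0; apply/negPn/negP => J0.
pose m := cabs (J a b c d).
have m0 : 0 < m by rewrite lt_neqAle eq_sym J0 cabs_ge0.
pose Q n := iter n quarter ((a, b), (c, d)).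
have Qin n : in_rect (Q n).
  by elim: n => [|n IH]; [rewrite /in_rect /= !lexx ab cd|have [] := quarterP IH].
have QS n := quarterP (Qin n).
have QJ n : m <= 4 ^+ n * JQ (Q n).
  elim: n => [|n IH]; first by rewrite mul1r.
  have [_ h _] := QS n; apply: le_trans IH _.
  by rewrite exprSr -mulrA ler_wpM2l // exprn_ge0.
pose s := (b - a) + (d - c).
have Qs n : 2 ^+ n * (((Q n).1.2 - (Q n).1.1) + ((Q n).2.2 - (Q n).2.1)) = s.
  elim: n => [|n IH]; first by rewrite mul1r.
  have [_ _ /and5P[_ _ _ _ /andP[/eqP h1 /eqP h2]]] := QS n.
  rewrite -/(Q n.+1) in h1 h2; rewrite h1 h2 -IH exprSr -mulrA; congr (_ * _); lra.
have [p pP] : exists p, forall n, (Q n).1.1 <= p <= (Q n).1.2.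
  apply: (@nested_intervals (fun n => (Q n).1.1) (fun n => (Q n).1.2)).
  - by move=> n; have [_ _ /and5P[]] := QS n.
  - by move=> n; have [_ _ /and5P[]] := QS n.
  - by move=> n; have /and5P[] := Qin n.
have [q qP] : exists q, forall n, (Q n).2.1 <= q <= (Q n).2.2.
  apply: (@nested_intervals (fun n => (Q n).2.1) (fun n => (Q n).2.2)).
  - by move=> n; have [_ _ /and5P[]] := QS n.
  - by move=> n; have [_ _ /and5P[? ? ? ? /andP[]]] := QS n.
  - by move=> n; have /and5P[_ _ _ _ /andP[]] := Qin n.
have s0 : 0 <= s by rewrite /s addr_ge0 // subr_ge0.
pose e := m / (s ^+ 2 + 1).
have s1 : 0 < s ^+ 2 + 1 by rewrite ltr_wpDl // sqr_ge0.
have [r r0 rP] := Jloc (pP 0%N) (qP 0%N) (divr_gt0 m0 s1).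
(* After [n] steps the quarter has size [s / 2 ^+ n], small enough for [Jloc]. *)
have [n lt] : exists n, s < r * 2 ^+ n.
  have [k kP] : exists k, s / r < k%:R.
    by exists (Num.bound (s / r)); rewrite archi_boundP // divr_ge0 // ltW.
  exists k; rewrite mulrC -ltr_pdivrMr //; apply: lt_trans kP _.
  by rewrite -natrX ltr_nat ltn_expl.
have /and5P[h1 h2 h3 h4 /andP[h5 h6]] := Qin n.
have p2 : 0 < 2 ^+ n :> R by rewrite exprn_gt0.
have sz := Qs n; set t := _ + _ in sz.
have tr : t < r by rewrite -(ltr_pM2l p2) sz mulrC.
have := rP _ _ _ _ h1 (pP n) h3 h4 (qP n) h6 tr; rewrite -/(JQ (Q n)) -/t => le.
have : m <= e * s ^+ 2.
  apply: le_trans (QJ n) _; rewrite -sz exprMn.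
  apply: le_trans (ler_wpM2l _ le) _; first by rewrite exprn_ge0.
  rewrite -/e mulrCA -exprM mulnC exprM.
  by have -> : (2 : R) ^+ 2 = 4 by ring.
rewrite leNgt => /negP; apply; rewrite /e mulrAC ltr_pdivrMr //.
by rewrite ltr_pM2l // ltrDl.
Qed.

End Bisection.

(** * Goursat's theorem for rectangles *)

Section Contour.
Variable R : realType.
Local Notation C := R[i]^o.
Implicit Types (F G : C -> C) (x y : R).

Definition contour F x1 x2 y1 y2 : R[i] :=
  cint x1 x2 (fun x => F (x +i* y1)) + im1 R * cint y1 y2 (fun y => F (x2 +i* y))
  - cint x1 x2 (fun x => F (x +i* y2)) - im1 R * cint y1 y2 (fun y => F (x1 +i* y)).

Definition on_boundary (P : R[i] -> Prop) x1 x2 y1 y2 :=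
  [/\ forall x, x1 <= x <= x2 -> P (x +i* y1), forall y, y1 <= y <= y2 -> P (x2 +i* y),
      forall x, x1 <= x <= x2 -> P (x +i* y2) & forall y, y1 <= y <= y2 -> P (x1 +i* y)].

Definition on_rect (P : R[i] -> Prop) x1 x2 y1 y2 :=
  forall x y, x1 <= x <= x2 -> y1 <= y <= y2 -> P (x +i* y).

Definition boundary_continuous F x1 x2 y1 y2 :=
  [/\ seg_continuous x1 x2 (fun x => F (x +i* y1)),
      seg_continuous y1 y2 (fun y => F (x2 +i* y)),
      seg_continuous x1 x2 (fun x => F (x +i* y2)) &
      seg_continuous y1 y2 (fun y => F (x1 +i* y))].

Lemma on_rect_boundary P x1 x2 y1 y2 : x1 <= x2 -> y1 <= y2 ->
  on_rect P x1 x2 y1 y2 -> on_boundary P x1 x2 y1 y2.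
Proof. by move=> xx yy H; split=> ? ?; apply: H; rewrite ?lexx ?xx ?yy. Qed.

Lemma on_rect_sub P x1 x2 y1 y2 x1' x2' y1' y2' :
  x1 <= x1' -> x2' <= x2 -> y1 <= y1' -> y2' <= y2 ->
  on_rect P x1 x2 y1 y2 -> on_rect P x1' x2' y1' y2'.
Proof.
move=> h1 h2 h3 h4 H x y /andP[a1 a2] /andP[b1 b2]; apply: H.
  by rewrite (le_trans h1 a1) (le_trans a2 h2).
by rewrite (le_trans h3 b1) (le_trans b2 h4).
Qed.

Lemma cabs_pair (x y : R) : cabs (x +i* y) <= `|x| + `|y|.
Proof. exact: cabs_le. Qed.

Lemma horizontal_continuous F x1 x2 y :
  (forall x, x1 <= x <= x2 -> {for x +i* y, continuous F}) ->
  seg_continuous x1 x2 (fun x => F (x +i* y)).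
Proof.
move=> cF x /cF/continuous_cabsP H e /H[d d0 dP]; exists d => // x' _ lt.
by apply: dP => /=; rewrite subrr expr0n addr0 sqrtr_sqr.
Qed.

Lemma vertical_continuous F x y1 y2 :
  (forall y, y1 <= y <= y2 -> {for x +i* y, continuous F}) ->
  seg_continuous y1 y2 (fun y => F (x +i* y)).
Proof.
move=> cF y /cF/continuous_cabsP H e /H[d d0 dP]; exists d => // y' _ lt.
by apply: dP => /=; rewrite subrr expr0n add0r sqrtr_sqr.
Qed.

Lemma on_boundary_continuous F x1 x2 y1 y2 :
  on_boundary (fun w => {for w, continuous F}) x1 x2 y1 y2 ->
  boundary_continuous F x1 x2 y1 y2.
Proof.
by case=> *; split; [exact: horizontal_continuous|exact: vertical_continuous
  |exact: horizontal_continuous|exact: vertical_continuous].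
Qed.

Lemma eq_contour F G x1 x2 y1 y2 : on_boundary (fun w => F w = G w) x1 x2 y1 y2 ->
  contour F x1 x2 y1 y2 = contour G x1 x2 y1 y2.
Proof.
by case=> h1 h2 h3 h4; rewrite /contour (eq_cint h1) (eq_cint h2) (eq_cint h3) (eq_cint h4).
Qed.

Lemma contourD F G x1 x2 y1 y2 :
  boundary_continuous F x1 x2 y1 y2 -> boundary_continuous G x1 x2 y1 y2 ->
  contour (fun w => F w + G w) x1 x2 y1 y2 = contour F x1 x2 y1 y2 + contour G x1 x2 y1 y2.
Proof.
by case=> f1 f2 f3 f4 [g1 g2 g3 g4]; rewrite /contour !cintD //; ring.
Qed.

Lemma contourZ F (k : R[i]) x1 x2 y1 y2 :
  boundary_continuous F x1 x2 y1 y2 ->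
  contour (fun w => k * F w) x1 x2 y1 y2 = k * contour F x1 x2 y1 y2.
Proof. by case=> f1 f2 f3 f4; rewrite /contour !cintZ //; ring. Qed.

Lemma boundary_continuousZ F (k : R[i]) x1 x2 y1 y2 :
  boundary_continuous F x1 x2 y1 y2 ->
  boundary_continuous (fun w => k * F w) x1 x2 y1 y2.
Proof. by case=> *; split; exact: seg_continuousZ. Qed.

Lemma boundary_continuousD F G x1 x2 y1 y2 :
  boundary_continuous F x1 x2 y1 y2 -> boundary_continuous G x1 x2 y1 y2 ->
  boundary_continuous (fun w => F w + G w) x1 x2 y1 y2.
Proof. by case=> ? ? ? ? [? ? ? ?]; split; exact: seg_continuousD. Qed.

Lemma boundary_continuous_axpy F G (k : R[i]) x1 x2 y1 y2 :
  boundary_continuous F x1 x2 y1 y2 -> boundary_continuous G x1 x2 y1 y2 ->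
  boundary_continuous (fun w => F w + k * G w) x1 x2 y1 y2.
Proof.
by move=> cF cG; apply: boundary_continuousD => //; exact: boundary_continuousZ.
Qed.

Lemma contour_axpy F G (k : R[i]) x1 x2 y1 y2 :
  boundary_continuous F x1 x2 y1 y2 -> boundary_continuous G x1 x2 y1 y2 ->
  contour (fun w => F w + k * G w) x1 x2 y1 y2 =
  contour F x1 x2 y1 y2 + k * contour G x1 x2 y1 y2.
Proof.
move=> cF cG; rewrite contourD ?contourZ //.
exact: boundary_continuousZ.
Qed.

Lemma contour_bound F x1 x2 y1 y2 M : x1 <= x2 -> y1 <= y2 ->
  boundary_continuous F x1 x2 y1 y2 ->
  on_boundary (fun w => cabs (F w) <= M) x1 x2 y1 y2 ->
  cabs (contour F x1 x2 y1 y2) <= 4 * M * ((x2 - x1) + (y2 - y1)).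
Proof.
move=> xx yy [c1 c2 c3 c4] [b1 b2 b3 b4]; rewrite /contour.
have := cint_bound xx c1 b1; have := cint_bound yy c2 b2.
have := cint_bound xx c3 b3; have := cint_bound yy c4 b4.
set I1 := cint _ _ _; set I2 := cint _ _ _; set I3 := cint _ _ _; set I4 := cint _ _ _.
move=> l1 l2 l3 l4.
have iM z : cabs (im1 R * z) = cabs z.
  by rewrite ComplexField.Normc.normcM cabs_i mul1r.
have := cabsB (I4 + im1 R * I3 - I2) (im1 R * I1); have := cabsB (I4 + im1 R * I3) I2.
have := cabsD I4 (im1 R * I3); rewrite !iM.
move: (cabs _) (cabs _) (cabs _) (cabs _) (cabs _) (cabs _) (cabs _) l1 l2 l3 l4.
move=> *; lra.
Qed.

Lemma contour_affine (k l p : R[i]) x1 x2 y1 y2 : x1 <= x2 -> y1 <= y2 ->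
  contour (fun w => k + l * (w - p)) x1 x2 y1 y2 = 0.
Proof.
move=> xx yy; rewrite /contour.
have eh x y : k + l * (x +i* y - p) = (k + l * (im1 R * y%:C - p)) + l * x%:C.
  by rewrite [x +i* y]rectE /=; ring.
have ev x y : k + l * (x +i* y - p) = (k + l * (x%:C - p)) + (l * im1 R) * y%:C.
  by rewrite [x +i* y]rectE /=; ring.
rewrite (@eq_cint _ x1 x2 _ _ (fun x _ => eh x y1)) (@eq_cint _ x1 x2 _ _ (fun x _ => eh x y2)).
rewrite (@eq_cint _ y1 y2 _ _ (fun y _ => ev x1 y)) (@eq_cint _ y1 y2 _ _ (fun y _ => ev x2 y)).
have eB (u v : R) : (u - v)%:C = u%:C - v%:C by exact: (rmorphB (real_complex R)).
rewrite !cint_affine // !(eB x2) !(eB y2).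
move: (((_ - _) / 2)%:C) (((_ - _) / 2)%:C) (x1%:C) (x2%:C) (y1%:C) (y2%:C) (im1 R).
by move=> *; ring.
Qed.

Lemma contour_splitx F x1 x2 x3 y1 y2 : x1 <= x2 -> x2 <= x3 -> y1 <= y2 ->
  on_rect (fun w => {for w, continuous F}) x1 x3 y1 y2 ->
  contour F x1 x3 y1 y2 = contour F x1 x2 y1 y2 + contour F x2 x3 y1 y2.
Proof.
move=> xx xx' yy cF; rewrite /contour.
have [c1 _ c3 _] := on_rect_boundary (le_trans xx xx') yy cF.
rewrite (@cint_split _ x1 x2 x3) //; last exact: horizontal_continuous.
rewrite (@cint_split _ x1 x2 x3) //; last exact: horizontal_continuous.
ring.
Qed.

Lemma contour_splity F x1 x2 y1 y2 y3 : x1 <= x2 -> y1 <= y2 -> y2 <= y3 ->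
  on_rect (fun w => {for w, continuous F}) x1 x2 y1 y3 ->
  contour F x1 x2 y1 y3 = contour F x1 x2 y1 y2 + contour F x1 x2 y2 y3.
Proof.
move=> xx yy yy' cF; rewrite /contour.
have [_ c2 _ c4] := on_rect_boundary xx (le_trans yy yy') cF.
rewrite (@cint_split _ y1 y2 y3) //; last exact: vertical_continuous.
rewrite (@cint_split _ y1 y2 y3) //; last exact: vertical_continuous.
ring.
Qed.

Lemma derivable_affine (k l p : R[i]) (z : C) :
  derivable (fun w : C => k + l * (w - p) : C) z 1.
Proof.
apply: (@cdiff_derivable _ _ _ l) => e e0; exists 1 => // w _.
have -> : k + l * (w - p) - (k + l * (z - p)) - l * (w - z) = 0 by ring.
by rewrite ComplexField.Normc.normc0 mulr_ge0 ?cabs_ge0 // ltW.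
Qed.

(** Goursat: subtracting the affine approximation at a point leaves an integrand
    that is [o(size)] on small rectangles around that point. *)
Lemma goursat F a b c d : a <= b -> c <= d ->
  on_rect (fun w => derivable F w 1) a b c d -> contour F a b c d = 0.
Proof.
move=> ab cd dF.
have cF : on_rect (fun w => {for w, continuous F}) a b c d.
  by move=> x y xab ycd; apply: derivable_continuous; exact: dF.
apply: (rectangle_bisection (J := contour F) ab cd).
- move=> x1 x2 x3 y1 y2 *; apply: contour_splitx => //.
  exact: on_rect_sub cF.
- move=> x1 x2 y1 y2 y3 *; apply: contour_splity => //.
  exact: on_rect_sub cF.
move=> p q pab qcd e e0.
have [l lP] := derivable_cdiff (dF _ _ pab qcd).
have [r r0 rP] := lP (e / 4) (ltac:(by rewrite divr_gt0)).
exists r => // x1 x2 y1 y2 ax1 /andP[x1p px2] x2b cy1 /andP[y1q qy2] y2d lt.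
have xx := le_trans x1p px2; have yy := le_trans y1q qy2.
set z := p +i* q in rP; set s := x2 - x1 + (y2 - y1) in lt *.
pose aff w := F z + l * (w - z).
have caff : boundary_continuous aff x1 x2 y1 y2.
  apply: on_boundary_continuous; apply: on_rect_boundary => // x y _ _.
  exact/derivable_continuous/derivable_affine.
have cFb : boundary_continuous F x1 x2 y1 y2.
  apply: on_boundary_continuous; apply: on_rect_boundary => //.
  exact: on_rect_sub cF.
have cG : boundary_continuous (fun w => F w + -1 * aff w) x1 x2 y1 y2.
  by apply: boundary_continuousD => //; exact: boundary_continuousZ.
have -> : contour F x1 x2 y1 y2 = contour (fun w => F w + -1 * aff w) x1 x2 y1 y2.
  rewrite contourD //; last exact: boundary_continuousZ.
  by rewrite contourZ // contour_affine // mulr0 addr0.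
have sM : on_boundary (fun w => cabs (F w + -1 * aff w) <= e / 4 * s) x1 x2 y1 y2.
  apply: on_rect_boundary => // x y /andP[h1 h2] /andP[h3 h4].
  have ws : cabs ((x +i* y) - z) <= s.
    apply: le_trans (cabs_pair _ _) _; rewrite /s.
    by apply: lerD; rewrite ler_norml; apply/andP; split; lra.
  have -> : F (x +i* y) + -1 * aff (x +i* y) = F (x +i* y) - F z - l * ((x +i* y) - z).
    by rewrite /aff; ring.
  apply: le_trans (rP _ (le_lt_trans ws lt)) _.
  by rewrite ler_wpM2l // divr_ge0 // ltW.
have := contour_bound xx yy cG sM; rewrite -/s.
by have -> : 4 * (e / 4 * s) * s = e * s ^+ 2 by field.
Qed.

(** A point where [F] is merely continuous contributes nothing: enclose it in a
    square of side [2 * h] and let [h] tend to [0]. *)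
Lemma goursat_punctured F a b c d p q : a < p < b -> c < q < d ->
  on_rect (fun w => {for w, continuous F}) a b c d ->
  on_rect (fun w => w != p +i* q -> derivable F w 1) a b c d ->
  contour F a b c d = 0.
Proof.
move=> /andP[ap pb] /andP[cq qd] cF dF.
have /continuous_cabsP cz := cF p q (ltac:(by rewrite !ltW)) (ltac:(by rewrite !ltW)).
have [r r0 rP] := cz 1 ltr01.
set z := p +i* q in rP.
pose M := cabs (F z) + 1.
have M0 : 0 <= M by rewrite addr_ge0 ?cabs_ge0.
pose h0 := Num.min (r / 4) (Num.min (Num.min (p - a) (b - p)) (Num.min (q - c) (d - q))).
have h00 : 0 < h0 by rewrite !lt_min !subr_gt0 ap pb cq qd !andbT divr_gt0.
have small h : 0 < h -> h <= h0 -> cabs (contour F a b c d) <= 16 * M * h.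
  move=> hh; rewrite !le_min => /and3P[hr /andP[hpa hbp] /andP[hqc hdq]].
  have [l1 l2 l3 l4] : [/\ a <= p - h, p - h <= p + h, p + h <= b & c <= q - h].
    by split; lra.
  have [l5 l6] : q - h <= q + h /\ q + h <= d by split; lra.
  have sub x1 x2 y1 y2 : a <= x1 -> x2 <= b -> c <= y1 -> y2 <= d ->
      on_rect (fun w => {for w, continuous F}) x1 x2 y1 y2.
    by move=> *; exact: on_rect_sub cF.
  rewrite (@contour_splitx F a (p - h) b) //; [|lra..].
  rewrite (@contour_splitx F (p - h) (p + h) b) //; [|lra|apply: sub => //; lra].
  rewrite (@contour_splity F (p - h) (p + h) c (q - h) d) //; [|lra|apply: sub => //; lra].
  rewrite (@contour_splity F (p - h) (p + h) (q - h) (q + h) d) //; [|apply: sub => //; lra].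
  (* Around the square lie four rectangles that avoid the exceptional point. *)
  have zero x1 x2 y1 y2 : a <= x1 -> x1 <= x2 -> x2 <= b -> c <= y1 -> y1 <= y2 -> y2 <= d ->
      (x2 < p) || (p < x1) || (y2 < q) || (q < y1) -> contour F x1 x2 y1 y2 = 0.
    move=> h1 h2 h3 h4 h5 h6 hz; apply: goursat => // x y xx yy.
    apply: dF.
    - by case/andP: xx => x1x xx2; rewrite (le_trans h1 x1x) (le_trans xx2 h3).
    - by case/andP: yy => y1y yy2; rewrite (le_trans h4 y1y) (le_trans yy2 h6).
    apply/eqP => -[xp yq]; move: hz xx yy; rewrite xp yq.
    by case/orP => [/orP[/orP[]|]|] lt /andP[u1 u2] /andP[u3 u4]; lra.
  rewrite (zero a (p - h) c d) //; [|lra..|];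
    last by apply/orP; left; apply/orP; left; apply/orP; left; lra.
  rewrite (zero (p + h) b c d) //; [|lra..|];
    last by apply/orP; left; apply/orP; left; apply/orP; right; lra.
  rewrite (zero (p - h) (p + h) c (q - h)) //; [|lra..|by apply/orP; left; apply/orP; right; lra].
  rewrite (zero (p - h) (p + h) (q + h) d) //; [|lra..|by apply/orP; right; lra].
  rewrite !add0r !addr0.
  have bF : on_boundary (fun w => cabs (F w) <= M) (p - h) (p + h) (q - h) (q + h).
    apply: on_rect_boundary => // x y /andP[u1 u2] /andP[u3 u4].
    have lt : cabs ((x +i* y) - z) < r.
      apply: le_lt_trans (cabs_pair _ _) _.
      have : `|x - p| <= h by rewrite ler_norml; apply/andP; split; lra.
      have : `|y - q| <= h by rewrite ler_norml; apply/andP; split; lra.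
      lra.
    have := rP _ lt; have := cabsD (F (x +i* y) - F z) (F z); rewrite subrK /M; lra.
  have bc : boundary_continuous F (p - h) (p + h) (q - h) (q + h).
    by apply: on_boundary_continuous; apply: on_rect_boundary => //; apply: sub => //; lra.
  have := contour_bound l2 l5 bc bF.
  by have -> : 4 * M * (p + h - (p - h) + (q + h - (q - h))) = 16 * M * h by ring.
apply/eqP; rewrite -cabs_eq0 eq_le cabs_ge0 andbT; apply/ler_addgt0Pr => e e0.
rewrite add0r.
pose h := Num.min h0 (e / (16 * M + 1)).
have den : 0 < 16 * M + 1 by rewrite ltr_wpDl // mulr_ge0.
have hp : 0 < h by rewrite lt_min h00 divr_gt0.
apply: le_trans (small h hp _) _; first by rewrite ge_min lexx.
have : h <= e / (16 * M + 1) by rewrite ge_min lexx orbT.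
rewrite ler_pdivlMr // => le; apply: le_trans le.
by rewrite mulrC ler_wpM2l ?(ltW hp) // lerDl.
Qed.

End Contour.

(** * Dividing out a zero of a holomorphic function *)

Section Holo.
Variable R : realType.
Local Notation C := R[i]^o.
Implicit Types (f g : C -> C) (z : C).

Lemma holoD f g z : derivable f z 1 -> derivable g z 1 -> derivable (fun w => f w + g w : C) z 1.
Proof. exact: derivableD. Qed.
Lemma holoN f z : derivable f z 1 -> derivable (fun w => - f w : C) z 1.
Proof. exact: derivableN. Qed.
Lemma holoB f g z : derivable f z 1 -> derivable g z 1 -> derivable (fun w => f w - g w : C) z 1.
Proof. exact: derivableB. Qed.
Lemma holoM f g z : derivable f z 1 -> derivable g z 1 -> derivable (fun w => f w * g w : C) z 1.
Proof. exact: derivableM. Qed.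
Lemma holoV f z : f z != 0 -> derivable f z 1 -> derivable (fun w => (f w)^-1 : C) z 1.
Proof. exact: derivableV. Qed.
Lemma holoX f z n : derivable f z 1 -> derivable (fun w => f w ^+ n : C) z 1.
Proof.
move=> df; elim: n => [|n IH]; first exact: (derivable_cst (1 : C)).
have -> : (fun w => f w ^+ n.+1 : C) = (fun w => f w * f w ^+ n).
  by apply/funext => w; rewrite exprS.
exact: holoM.
Qed.
Lemma holo_id z : derivable (fun w : C => w) z 1.
Proof. exact: derivable_id. Qed.
Lemma holo_cst (k : C) z : derivable (fun w : C => k) z 1.
Proof. exact: derivable_cst. Qed.

Arguments holo_id : clear implicits.
Arguments holo_cst : clear implicits.

Lemma holo_lin (c d : C) z : derivable (fun w : C => c + w * d : C) z 1.
Proof. by have h := holoD (holo_cst c z) (holoM (holo_id z) (holo_cst d z)); exact: h. Qed.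

Lemma holo_near f g z : (\forall w \near z, f w = g w) -> derivable f z 1 -> derivable g z 1.
Proof. by move=> fg; apply: near_eq_derivable. Qed.

End Holo.
Arguments holo_id {R} z.
Arguments holo_cst {R} k z.
Arguments holo_lin {R} c d z.
Arguments holoX {R f z} n.

Section Taylor.
Variable R : realType.
Local Notation C := R[i]^o.
Variables (f : C -> C) (r : R).
Hypothesis r0 : 0 < r.
Hypothesis df : forall w, cabs w < r -> derivable f w 1.

(* The square of half-side [r / 4] around [0] lies in the disc of radius [r]. *)
Let s := r / 4.
Let s0 : 0 < s. Proof. by rewrite /s divr_gt0. Qed.
Let ss : - s <= s. Proof. by have := s0; lra. Qed.

Local Notation L F := (contour F (- s) s (- s) s).
Local Notation bc F := (boundary_continuous F (- s) s (- s) s).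

Let sq x y : -s <= x <= s -> -s <= y <= s -> cabs (x +i* y) < r.
Proof.
move=> xs ys; apply: le_lt_trans (cabs_le _) _ => /=.
have : `|x| <= s by rewrite ler_norml.
have : `|y| <= s by rewrite ler_norml.
have := r0; rewrite /s; lra.
Qed.

Let on_bd (P : R[i] -> Prop) : (forall w, s <= cabs w -> cabs w < r -> P w) ->
  on_boundary P (- s) s (- s) s.
Proof.
move=> H; have s1 : `|s| = s by rewrite gtr0_norm.
by split=> x xs; apply: H; try (by apply: sq; rewrite // lexx ss);
  rewrite -{1}s1; first [rewrite -normrN; exact: (le_trans _ (cabs_Re _))
   | exact: (le_trans _ (cabs_Re _)) | exact: (le_trans _ (cabs_Im _))
   | rewrite -normrN; exact: (le_trans _ (cabs_Im _))].
Qed.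

Let holo_bc (F : C -> C) : (forall w : C, s <= cabs w -> cabs w < r -> derivable F w 1) -> bc F.
Proof.
by move=> dF; apply/on_boundary_continuous/on_bd => w w1 w2; exact/derivable_continuous/dF.
Qed.

(** The difference quotient at [z] has a removable singularity, so Goursat makes
    its contour integral vanish. *)
Let contour_quotient z : cabs z < s ->
  L (fun w => (f w - f z) * (w - z)^-1) = 0.
Proof.
move=> zs.
have zr : cabs z < r by apply: lt_trans zs _; have := r0; rewrite /s; lra.
have [l lP] := derivable_cdiff (df zr).
pose q (w : C) : C := if w == z then l else (f w - f z) * (w - z)^-1.
have dq w : cabs w < r -> w != z -> derivable q w 1.
  move=> wr wz; apply: (holo_near (f := fun w => (f w - f z) * (w - z)^-1)).
    apply/near_cabsP; exists (cabs (w - z)); first by rewrite cabs_gt0 subr_eq0.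
    move=> v vw; rewrite /q; case: eqP vw => // ->.
    by rewrite cabs_distC ltxx.
  apply: holoM; first by apply: holoB; [exact: df|exact: holo_cst].
  apply: holoV; first by rewrite subr_eq0.
  by apply: holoB; [exact: holo_id|exact: holo_cst].
have cq w : cabs w < r -> {for w, continuous q}.
  have [->|wz wr] := eqVneq w z; last exact/derivable_continuous/dq.
  move=> _; apply/continuous_cabsP => e e0.
  have [d d0 dP] := lP (e / 2) (ltac:(by rewrite divr_gt0)).
  exists d => // v /dP; rewrite /q eqxx; case: eqP => [->|/eqP vz] le.
    by rewrite subrr ComplexField.Normc.normc0.
  have vz0 : v - z != 0 by rewrite subr_eq0.
  apply: (@le_lt_trans _ _ (e / 2)); last by rewrite ltr_pdivrMr // ltr_pMr // ltr1n.
  rewrite -(ler_pM2r (_ : 0 < cabs (v - z))) ?cabs_gt0 //; apply: le_trans le.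
  rewrite -ComplexField.Normc.normcM mulrBl mulfVK //.
have Lq : L q = 0.
  case: z zs zr lP @q dq cq => p t zs zr lP q dq cq.
  have h1 := le_lt_trans (cabs_Re _) zs; have h2 := le_lt_trans (cabs_Im _) zs.
  rewrite /= in h1 h2.
  apply: (@goursat_punctured _ _ _ _ _ _ p t).
  - by rewrite -ltr_norml.
  - by rewrite -ltr_norml.
  - by move=> x y xs ys; apply: cq; exact: sq.
  - by move=> x y xs ys; apply: dq; exact: sq.
rewrite -Lq; apply: eq_contour; apply: on_bd => w sw _; rewrite /q.
by case: eqP => // wz; move: zs; rewrite -wz ltNge sw.
Qed.

Let k n : R[i] := L (fun w => (w ^+ n)^-1).
Let a n : R[i] := L (fun w => f w * (w ^+ n)^-1).
Let T z : R[i] := L (fun w => (f w - f z) * ((w ^+ 3)^-1 * (w - z)^-1)).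

Let neq0 w : s <= cabs w -> w != 0.
Proof. by move=> sw; rewrite -cabs_gt0 (lt_le_trans s0 sw). Qed.

Let hV n w : s <= cabs w -> derivable (fun w : C => (w ^+ n)^-1 : C) w 1.
Proof.
move=> sw; apply: holoV; first by rewrite expf_neq0 // neq0.
by apply: holoX; exact: holo_id.
Qed.

(** Integrate [f w - f z] against
    [1 / (w - z) = 1 / w + z / w ^ 2 + z ^ 2 / w ^ 3 + z ^ 3 / (w ^ 3 (w - z))].
    Here [k 2] and [k 3] are [0] by Cauchy's theorem for powers; carried along, they
    make the approximation of [f] a rational function instead of a polynomial,
    which serves the same purpose. *)
Let expansion z : cabs z < s ->
  a 1 + z * a 2 + z ^+ 2 * a 3 - f z * (k 1 + z * k 2 + z ^+ 2 * k 3) + z ^+ 3 * T z = 0.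
Proof.
move=> zs; rewrite -[RHS](contour_quotient zs).
have wz w : s <= cabs w -> w - z != 0.
  by move=> sw; rewrite subr_eq0; apply: contraTneq zs => <-; rewrite ltNge sw.
pose A n (w : C) : C := f w * (w ^+ n)^-1.
pose K n (w : C) : C := (w ^+ n)^-1.
pose Q (w : C) : C := (f w - f z) * ((w ^+ 3)^-1 * (w - z)^-1).
have cA n : bc (A n).
  by apply: holo_bc => w sw wr; apply: holoM; [exact: df|exact: hV].
have cK n : bc (K n) by apply: holo_bc => w sw _; exact: hV.
have cQ : bc Q.
  apply: holo_bc => w sw wr; apply: holoM.
    by apply: holoB; [exact: df|exact: holo_cst].
  apply: holoM; first exact: hV.
  by apply: holoV; [exact: wz|apply: holoB; [exact: holo_id|exact: holo_cst]].
pose F1 (w : C) : C := A 1 w + z * A 2 w.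
pose F2 (w : C) : C := F1 w + z ^+ 2 * A 3 w.
pose F3 (w : C) : C := F2 w + - f z * K 1 w.
pose F4 (w : C) : C := F3 w + - f z * z * K 2 w.
pose F5 (w : C) : C := F4 w + - f z * z ^+ 2 * K 3 w.
pose F6 (w : C) : C := F5 w + z ^+ 3 * Q w.
have c1 : bc F1 := boundary_continuous_axpy _ (cA 1) (cA 2).
have c2 : bc F2 := boundary_continuous_axpy _ c1 (cA 3).
have c3 : bc F3 := boundary_continuous_axpy _ c2 (cK 1).
have c4 : bc F4 := boundary_continuous_axpy _ c3 (cK 2).
have c5 : bc F5 := boundary_continuous_axpy _ c4 (cK 3).
have -> : L (fun w => (f w - f z) * (w - z)^-1) = L F6.
  apply: eq_contour; apply: on_bd => w sw _; have w0 := neq0 sw; have wz0 := wz w sw.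
  rewrite /F6 /F5 /F4 /F3 /F2 /F1 /A /K /Q; move: (f w) (f z) w0 wz0 => u v w0 wz0.
  by field; rewrite wz0 w0.
rewrite (contour_axpy _ c5 cQ) (contour_axpy _ c4 (cK 3)) (contour_axpy _ c3 (cK 2)).
rewrite (contour_axpy _ c2 (cK 1)) (contour_axpy _ c1 (cA 3)) (contour_axpy _ (cA 1) (cA 2)).
rewrite -/(k 1) -/(k 2) -/(k 3) -/(a 1) -/(a 2) -/(a 3) -/(T z).
move: (k 1) (k 2) (k 3) (a 1) (a 2) (a 3) (T z) (f z) => *.
ring.
Qed.

(** The integral of [1 / w] is [2 i pi]: its imaginary part is a sum of four
    positive terms, and each side of the square contributes at least [1]. *)
Let k1_neq0 : k 1 != 0.
Proof.
have c w : s <= cabs w -> derivable (fun w : C => (w ^+ 1)^-1 : C) w 1 by exact: hV.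
have [c1 c2 c3 c4] : bc (fun w => (w ^+ 1)^-1) by apply: holo_bc => w sw _; exact: c.
have low (g : R[i] -> R) (phi : R -> R[i]) :
    (forall z w, `|g z - g w| <= cabs (z - w)) ->
    (forall x, - s <= x <= s -> g (phi x) = s / (s ^+ 2 + x ^+ 2)) ->
    seg_continuous (- s) s phi ->
    1 <= \int[@lebesgue_measure R]_(x in `[- s, s]) g (phi x).
  move=> gle gE cphi.
  have mab : measurable (`[- s, s] : set (measurableTypeR R)) by [].
  have iM : (@lebesgue_measure R).-integrable `[- s, s] (EFin \o cst ((2 * s)^-1)).
    apply: continuous_compact_integrable; first exact: segment_compact.
    by apply: continuous_subspaceT => x; exact: cvg_cst.
  have h : \int[@lebesgue_measure R]_(x in `[- s, s]) cst ((2 * s)^-1) x <=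
      \int[@lebesgue_measure R]_(x in `[- s, s]) g (phi x).
    apply: le_Rintegral => //; first exact: seg_integrable.
    move=> x /=; rewrite in_itv /= => xs; rewrite gE //.
    have x2 : x ^+ 2 <= s ^+ 2.
      by case/andP: xs => l1 l2; rewrite -subr_ge0 subr_sqr mulr_ge0 //; lra.
    have sp : 0 < s ^+ 2 + x ^+ 2 by rewrite ltr_pwDl ?sqr_ge0 // exprn_gt0.
    rewrite ler_pdivlMr // ler_pdivrMl ?mulr_gt0 //.
    have -> : 2 * s * s = s ^+ 2 + s ^+ 2 by ring.
    by rewrite lerD2l.
  apply: le_trans h; rewrite Rintegral_cst //= lebesgue_measure_itv /= lte_fin.
  have -> : - s < s by have := s0; lra.
  by rewrite /= [leRHS](_ : _ = 1) //; field; rewrite gt_eqF.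
have upp (g : R[i] -> R) (phi : R -> R[i]) :
    (forall z w, `|g z - g w| <= cabs (z - w)) ->
    (forall x, - s <= x <= s -> g (phi x) = - (s / (s ^+ 2 + x ^+ 2))) ->
    seg_continuous (- s) s phi ->
    \int[@lebesgue_measure R]_(x in `[- s, s]) g (phi x) <= -1.
  move=> gle gE cphi.
  have gle' z w : `|- g z - - g w| <= cabs (z - w) by rewrite -opprD normrN.
  have gE' x : - s <= x <= s -> - g (phi x) = s / (s ^+ 2 + x ^+ 2).
    by move=> /gE ->; rewrite opprK.
  have := low (fun z => - g z) phi gle' gE' cphi.
  under eq_Rintegral do rewrite -mulN1r.
  rewrite RintegralZl //; last exact: seg_integrable.
  by rewrite mulN1r lerNr.
have reE x y : complex.Re ((x +i* y : R[i])^-1) = x / (x ^+ 2 + y ^+ 2).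
  by rewrite /GRing.inv.
have imE x y : complex.Im ((x +i* y : R[i])^-1) = - (y / (x ^+ 2 + y ^+ 2)).
  by rewrite /GRing.inv.
have g1 x : - s <= x <= s -> complex.Im (((x +i* - s : R[i]) ^+ 1)^-1) = s / (s ^+ 2 + x ^+ 2).
  by rewrite expr1 imE sqrrN addrC mulNr opprK.
have g2 x : - s <= x <= s -> complex.Re (((s +i* x : R[i]) ^+ 1)^-1) = s / (s ^+ 2 + x ^+ 2).
  by rewrite expr1 reE.
have g3 x : - s <= x <= s -> complex.Im (((x +i* s : R[i]) ^+ 1)^-1) = - (s / (s ^+ 2 + x ^+ 2)).
  by rewrite expr1 imE addrC.
have g4 x : - s <= x <= s -> complex.Re (((- s +i* x : R[i]) ^+ 1)^-1) = - (s / (s ^+ 2 + x ^+ 2)).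
  by rewrite expr1 reE sqrrN mulNr.
have i1 := low _ _ (@Im_le R) g1 c1; have i2 := low _ _ (@Re_le R) g2 c2.
have i3 := upp _ _ (@Im_le R) g3 c3; have i4 := upp _ _ (@Re_le R) g4 c4.
apply/eqP => /(congr1 (@complex.Im R)).
have ImE (I1 I2 I3 I4 : R[i]) : complex.Im (I1 + im1 R * I2 - I3 - im1 R * I4) =
    complex.Im I1 + complex.Re I2 - complex.Im I3 - complex.Re I4.
  by case: I1 I2 I3 I4 => [? ?] [? ?] [? ?] [? ?] /=; ring.
rewrite /k /contour ImE {ImE} /cint /=.
move: i1 i2 i3 i4; rewrite /cint /=.
set J1 := Rintegral _ _ _; set J2 := Rintegral _ _ _.
set J3 := Rintegral _ _ _; set J4 := Rintegral _ _ _.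
move: J1 J2 J3 J4 => J1 J2 J3 J4 *; lra.
Qed.

Let num (z : C) : C := a 1 + z * a 2 + z ^+ 2 * a 3.
Let den (z : C) : C := k 1 + z * k 2 + z ^+ 2 * k 3.

Let dden z : derivable den z 1.
Proof.
have h := holoD (holo_lin (k 1) (k 2) z) (holoM (holoX 2 (holo_id z)) (holo_cst (k 3) z)).
exact: h.
Qed.

(** By [expansion] the error is [z ^+ 3 * T z / den z].  The factor [T z] is bounded
    because [f] is bounded on the sides of the square, and [den] is bounded away from
    [0] because [den 0] is the nonzero [k 1]. *)
Let quotient_approx : exists2 d, 0 < d & exists2 B, 0 <= B & forall z, cabs z < d ->
  den z != 0 /\ cabs (f z - num z / den z) <= B * cabs z ^+ 3.
Proof.
have [M Mf] : exists M, on_boundary (fun w => cabs (f w) <= M) (- s) s (- s) s.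
  have [c1 c2 c3 c4] : bc f by apply: holo_bc => w _; exact: df.
  have [M1 b1] := seg_continuous_bounded ss c1.
  have [M2 b2] := seg_continuous_bounded ss c2.
  have [M3 b3] := seg_continuous_bounded ss c3.
  have [M4 b4] := seg_continuous_bounded ss c4.
  exists (Num.max (Num.max M1 M2) (Num.max M3 M4)).
  by split=> x xs; rewrite !le_max ?b1 ?b2 ?b3 ?b4 ?orbT.
have /continuous_cabsP/(_ 1 ltr01)[d1 d10 d1P] : {for 0, continuous f}.
  by apply/derivable_continuous/df; rewrite ComplexField.Normc.normc0.
have den0 : den 0 = k 1 by rewrite /den expr0n !mul0r !addr0.
pose K := cabs (k 1).
have K0 : 0 < K by rewrite cabs_gt0.
have /continuous_cabsP/(_ (K / 2) (ltac:(by rewrite divr_gt0)))[d2 d20 d2P] :=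
  derivable_continuous (@dden 0).
pose d := Num.min (s / 2) (Num.min d1 d2).
pose B1 := 4 * ((M + (cabs (f 0) + 1)) * ((s ^+ 3)^-1 * (s / 2)^-1)) * (4 * s).
exists d; first by rewrite !lt_min d10 d20 divr_gt0.
exists (`|B1| * (K / 2)^-1); first by rewrite mulr_ge0 // invr_ge0 divr_ge0 // ltW.
move=> z; rewrite !lt_min => /and3P[zs zd1 zd2].
have zs' : cabs z < s by apply: lt_trans zs _; rewrite ltr_pdivrMr // ltr_pMr // ltr1n.
have denz : K / 2 <= cabs (den z).
  have := d2P z; rewrite subr0 => /(_ zd2); rewrite den0.
  have := cabsD (den z) (k 1 - den z).
  by rewrite addrC subrK -/K [cabs (k 1 - den z)]cabs_distC; lra.
have denz0 : den z != 0 by rewrite -cabs_gt0; apply: lt_le_trans denz; rewrite divr_gt0.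
split=> //.
have fz : cabs (f z) <= cabs (f 0) + 1.
  have := d1P z; rewrite subr0 => /(_ zd1).
  by have := cabsD (f z - f 0) (f 0); rewrite subrK; lra.
have TB : cabs (T z) <= `|B1|.
  apply: le_trans (ler_norm _).
  have wz w : s <= cabs w -> s / 2 <= cabs (w - z).
    by move=> sw; have := cabsD (w - z) z; rewrite subrK; lra.
  have c3 : bc (fun w => (f w - f z) * ((w ^+ 3)^-1 * (w - z)^-1)).
    apply: holo_bc => w sw wr; apply: holoM.
      by apply: holoB; [exact: df|exact: holo_cst].
    apply: holoM; first exact: hV.
    apply: holoV; last by apply: holoB; [exact: holo_id|exact: holo_cst].
    by rewrite -cabs_gt0; apply: lt_le_trans (wz _ sw); rewrite divr_gt0.
  have -> : B1 = 4 * ((M + (cabs (f 0) + 1)) * ((s ^+ 3)^-1 * (s / 2)^-1)) *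
      ((s - - s) + (s - - s)) by rewrite /B1; ring.
  apply: contour_bound => //.
  have key w : s <= cabs w -> cabs (f w) <= M ->
      cabs ((f w - f z) * ((w ^+ 3)^-1 * (w - z)^-1)) <=
      (M + (cabs (f 0) + 1)) * ((s ^+ 3)^-1 * (s / 2)^-1).
    move=> sw fw; rewrite !ComplexField.Normc.normcM !ComplexField.Normc.normcV cabsX.
    have w3 : s ^+ 3 <= cabs w ^+ 3 by rewrite lerXn2r ?nnegrE ?cabs_ge0 ?(ltW s0).
    have wz2 := wz w sw.
    have s3 : 0 < s ^+ 3 by rewrite exprn_gt0.
    have s2 : 0 < s / 2 by rewrite divr_gt0.
    apply: ler_pM; rewrite ?cabs_ge0 ?mulr_ge0 ?invr_ge0 ?exprn_ge0 ?cabs_ge0 //.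
      by apply: le_trans (cabsB _ _) _; exact: lerD.
    apply: ler_pM; rewrite ?invr_ge0 ?exprn_ge0 ?cabs_ge0 //.
      by rewrite lef_pV2 // posrE (lt_le_trans s3).
    by rewrite lef_pV2 // posrE (lt_le_trans s2).
  have [p1 p2 p3 p4] : on_boundary (fun w => s <= cabs w) (- s) s (- s) s by exact: on_bd.
  case: Mf => m1 m2 m3 m4.
  by split=> x xs; apply: key; auto.
have -> : f z - num z / den z = z ^+ 3 * T z / den z.
  apply: (mulIf denz0); rewrite divfK // mulrBl divfK //.
  have := expansion zs'; rewrite -/(num z) -/(den z) => /eqP.
  by rewrite addrAC subr_eq0 => /eqP <-; rewrite [X in X - _]addrC addrK.
rewrite ComplexField.Normc.normcM ComplexField.Normc.normcV ComplexField.Normc.normcM cabsX.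
rewrite -mulrA mulrC ler_wpM2r ?exprn_ge0 ?cabs_ge0 //.
apply: ler_pM; rewrite ?cabs_ge0 ?invr_ge0 ?cabs_ge0 //.
by rewrite lef_pV2 // posrE ?divr_gt0 // cabs_gt0.
Qed.

(** The difference quotient [g] of [f] at [0] is within [O(z ^ 2)] of that of
    [num / den], called [rr] below; so [g], with the value [rr 0] at [0], inherits at
    [0] the derivative of [rr]. *)
Lemma holomorphic_divide : exists g : C -> C, exists2 e, 0 < e &
  forall w, cabs w < e -> derivable g w 1 /\ f w - f 0 = w * g w.
Proof.
have [d d0 [B B0 approx]] := quotient_approx.
have den0 : den 0 = k 1 by rewrite /den expr0n !mul0r !addr0.
have num0 : num 0 = a 1 by rewrite /num expr0n !mul0r !addr0.
pose rr (z : C) : C := ((a 2 + z * a 3) * k 1 - a 1 * (k 2 + z * k 3)) * (k 1 * den z)^-1.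
pose g (z : C) : C := if z == 0 then rr 0 else (f z - f 0) * z^-1.
have f0E : f 0 = a 1 / k 1.
  have [|_] := approx 0; first by rewrite ComplexField.Normc.normc0.
  rewrite ComplexField.Normc.normc0 expr0n mulr0 den0 num0 => h.
  by apply/eqP; rewrite -subr_eq0 -cabs_eq0 eq_le cabs_ge0 andbT.
have gr z : cabs z < d -> cabs (g z - rr z) <= B * cabs z ^+ 2.
  move=> zd; have [denz le] := approx z zd; rewrite /g; case: eqP => [->|/eqP z0].
    by rewrite subrr ComplexField.Normc.normc0 mulr_ge0 // exprn_ge0.
  have -> : (f z - f 0) / z - rr z = (f z - num z / den z) / z.
    rewrite f0E; apply: (mulIf z0); rewrite mulrBl !divfK //.
    rewrite /rr; move: denz k1_neq0; rewrite /num /den.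
    move: (k 1) (k 2) (k 3) (a 1) (a 2) (a 3) (f z) => *.
    by field; apply/andP.
  rewrite ComplexField.Normc.normcM ComplexField.Normc.normcV.
  rewrite ler_pdivrMr ?cabs_gt0 // -mulrA -exprSr //.
have drr : derivable rr 0 1.
  pose P1 (z : C) : C := (a 2 + z * a 3) * k 1.
  pose P2 (z : C) : C := a 1 * (k 2 + z * k 3).
  pose P3 (z : C) : C := k 1 * den z.
  pose P4 (z : C) : C := P1 z - P2 z.
  pose P5 (z : C) : C := (P3 z)^-1.
  have d1 : derivable P1 0 1 := holoM (holo_lin (a 2) (a 3) 0) (holo_cst (k 1) 0).
  have d2 : derivable P2 0 1 := holoM (holo_cst (a 1) 0) (holo_lin (k 2) (k 3) 0).
  have d3 : derivable P3 0 1 := holoM (holo_cst (k 1) 0) (@dden 0).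
  have P30 : P3 0 != 0 by rewrite /P3 den0 mulf_neq0 ?k1_neq0.
  have d4 : derivable P4 0 1 := holoB d1 d2.
  have d5 : derivable P5 0 1 := holoV P30 d3.
  exact: (holoM d4 d5).
exists g; exists r; first exact: r0.
move=> w wr; split; last first.
  by rewrite /g; case: eqP => [->|/eqP w0]; [rewrite subrr mul0r|rewrite mulrC divfK].
have [->|w0] := eqVneq w 0; last first.
  apply: (holo_near (f := fun w => (f w - f 0) * w^-1)).
    apply/near_cabsP; exists (cabs w); first by rewrite cabs_gt0.
    move=> v vw; rewrite /g; case: eqP vw => // ->.
    by rewrite cabs_distC subr0 ltxx.
  apply: holoM; first by apply: holoB; [exact: df|exact: holo_cst].
  by apply: holoV; [exact: w0|exact: holo_id].
have [l lP] := derivable_cdiff drr.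
apply: (@cdiff_derivable _ _ _ l) => e e0.
have [d1 d10 d1P] := lP (e / 2) (ltac:(by rewrite divr_gt0)).
pose d2 := e / 2 / (B + 1).
have B1 : 0 < B + 1 by rewrite ltr_wpDl.
exists (Num.min d (Num.min d1 d2)); first by rewrite !lt_min d0 d10 !divr_gt0.
move=> v; rewrite !subr0 !lt_min => /and3P[vd vd1 vd2].
have g0 : g 0 = rr 0 by rewrite /g eqxx.
have -> : g v - g 0 - l * v = (rr v - rr 0 - l * v) + (g v - rr v) by rewrite g0; ring.
apply: le_trans (cabsD _ _) _.
have := d1P v; rewrite !subr0 => /(_ vd1) h1.
have h2 : B * cabs v ^+ 2 <= e / 2 * cabs v.
  rewrite expr2 mulrA ler_wpM2r ?cabs_ge0 //.
  have : cabs v * (B + 1) <= e / 2 by rewrite -ler_pdivlMr // ltW.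
  by apply: le_trans; rewrite mulrC ler_wpM2l ?cabs_ge0 // lerDl.
have := gr v vd; lra.
Qed.

End Taylor.

(** Iterated, this replaces power series in what follows: the order of a zero or a
    pole is found by dividing out the factor [w - z] as often as estimates allow. *)
Lemma holomorphic_zero_factor (R : realType) (f : R[i]^o -> R[i]^o) (z : R[i]^o) :
  holomorphic_at f z -> f z = 0 ->
  exists2 g : R[i]^o -> R[i]^o, holomorphic_at g z &
    \forall w \near z, f w = (w - z) * g w.
Proof.
move=> /near_cabsP[r r0 df] fz.
pose f0 (w : R[i]^o) : R[i]^o := f (w + z).
have df0 w : cabs w < r -> derivable f0 w 1.
  move=> wr; have [|l lP] := @derivable_cdiff R f (w + z).
    by apply: df; rewrite addrK.
  apply: (@cdiff_derivable _ _ _ l) => e /lP[d d0 dP]; exists d => // v vd.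
  have := dP (v + z); have -> : v + z - (w + z) = v - w by ring.
  exact.
have [g [e e0 gP]] := holomorphic_divide r0 df0.
exists (fun w => g (w - z)); last first.
  apply/near_cabsP; exists e => // w we; have [_] := gP _ we.
  by rewrite /f0 add0r subrK fz subr0.
apply/near_cabsP; exists e => // w we.
have [/derivable_cdiff[l lP] _] := gP _ we.
apply: (@cdiff_derivable _ _ _ l) => e' /lP[d d0 dP]; exists d => // v vd.
have := dP (v - z); have -> : v - z - (w - z) = v - w by ring.
exact.
Qed.

(** * Holomorphy of determinants *)

Section HolomorphicDet.
Variable R : realType.
Local Notation C := R[i]^o.

Lemma holo_sum (I : Type) (r : seq I) (F : I -> C -> C) (z : C) :
  (forall i, derivable (F i) z 1) -> derivable (fun w => \sum_(i <- r) F i w : C) z 1.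
Proof.
move=> dF; elim: r => [|i r IH].
  have -> : (fun w => \sum_(i <- [::]) F i w : C) = (fun=> 0).
    by apply/funext => w; rewrite big_nil.
  exact: (holo_cst 0 z).
have -> : (fun w => \sum_(j <- i :: r) F j w : C) =
    (fun w => F i w + \sum_(j <- r) F j w).
  by apply/funext => w; rewrite big_cons.
exact: (holoD (dF i) IH).
Qed.

Lemma holo_prod (I : Type) (r : seq I) (F : I -> C -> C) (z : C) :
  (forall i, derivable (F i) z 1) -> derivable (fun w => \prod_(i <- r) F i w : C) z 1.
Proof.
move=> dF; elim: r => [|i r IH].
  have -> : (fun w => \prod_(i <- [::]) F i w : C) = (fun=> 1).
    by apply/funext => w; rewrite big_nil.
  exact: (holo_cst 1 z).
have -> : (fun w => \prod_(j <- i :: r) F j w : C) =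
    (fun w => F i w * \prod_(j <- r) F j w).
  by apply/funext => w; rewrite big_cons.
exact: (holoM (dF i) IH).
Qed.

Lemma holo_det n (F : C -> 'M[R[i]]_n) (z : C) :
  (forall i j, derivable (fun w => F w i j : C) z 1) ->
  derivable (fun w => \det (F w) : C) z 1.
Proof.
move=> dF; rewrite /determinant.
have h (s : 'S_n) : derivable (fun w => (-1) ^+ s * \prod_i F w i (s i) : C) z 1.
  have h := holo_prod (r := index_enum 'I_n) (fun i => dF i (s i)).
  exact: (holoM (holo_cst ((-1) ^+ s) z) h).
exact: (holo_sum (r := index_enum 'S_n) h).
Qed.

Lemma holo_adj n (F : C -> 'M[R[i]]_n) (z : C) i j :
  (forall i j, derivable (fun w => F w i j : C) z 1) ->
  derivable (fun w => (\adj (F w)) i j : C) z 1.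
Proof.
move=> dF; have -> : (fun w => (\adj (F w)) i j : C) =
    (fun w => (-1) ^+ (j + i) * \det (row' j (col' i (F w)))).
  by apply/funext => w; rewrite mxE.
have h : derivable (fun w => \det (row' j (col' i (F w))) : C) z 1.
  apply: holo_det => k l.
  have -> : (fun w => row' j (col' i (F w)) k l : C) = (fun w => F w (lift j k) (lift i l)).
    by apply/funext => w; rewrite !mxE.
  exact: dF.
exact: (holoM (holo_cst ((-1) ^+ (j + i)) z) h).
Qed.

End HolomorphicDet.

(** * Orders of zeros and poles read off along a ray *)

Section RayOrder.
Variables (R : realType) (alpha sg : R).
Hypothesis sg1 : `|sg| = 1.
Local Notation C := R[i]^o.
Implicit Types (f g : C -> C) (d n m D : nat).

Definition ray (t : R) : R[i] := (alpha + sg * t)%:C.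

Lemma ray_dist t : 0 < t -> cabs (ray t - alpha%:C) = t.
Proof.
move=> t0; have -> : ray t - alpha%:C = (sg * t)%:C.
  by rewrite /ray -(rmorphB (real_complex R)) addrC addKr.
by rewrite cabsR normrM sg1 mul1r gtr0_norm.
Qed.

Lemma ray_neq t : 0 < t -> ray t != alpha%:C.
Proof. by move=> t0; rewrite -subr_eq0 -cabs_gt0 ray_dist. Qed.

Lemma near_ray (P : C -> Prop) : (\forall w \near (alpha%:C : C), P w) ->
  \forall t \near (0 : R)^'+, P (ray t).
Proof.
move=> /near_cabsP[d d0 dP]; near=> t; apply: dP.
by rewrite ray_dist.
Unshelve. all: by end_near. Qed.

Lemma near_ray' (P : C -> Prop) : (\forall w \near (alpha%:C : C)^', P w) ->
  \forall t \near (0 : R)^'+, P (ray t).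
Proof.
move=> /near_cabs'P[d d0 dP]; near=> t; apply: dP; first by rewrite ray_neq.
by rewrite ray_dist.
Unshelve. all: by end_near. Qed.

Lemma holomorphic_at_continuous f (z : C) : holomorphic_at f z -> {for z, continuous f}.
Proof. by move=> hf; apply/derivable_continuous/(nbhs_singleton hf). Qed.

Lemma ray_cabs_cvg g : holomorphic_at g alpha%:C ->
  (fun t => cabs (g (ray t))) @ (0 : R)^'+ --> cabs (g alpha%:C).
Proof.
move=> /holomorphic_at_continuous/continuous_cabsP cg.
apply/cvgrPdist_lt => e /cg[d d0 dP]; near=> t.
rewrite distrC; apply: le_lt_trans (cabs_dist_le _ _) _.
by apply: dP; rewrite ray_dist.
Unshelve. all: by end_near. Qed.

Lemma ray_bound_zero g (K : R) : holomorphic_at g alpha%:C ->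
  (\forall t \near (0 : R)^'+, cabs (g (ray t)) <= K * t) -> g alpha%:C = 0.
Proof.
move=> hg le; apply/eqP; rewrite -cabs_eq0 eq_le cabs_ge0 andbT.
have c := ray_cabs_cvg hg.
have c0 : (fun t => K * t - cabs (g (ray t))) @ (0 : R)^'+ --> K * 0 - cabs (g alpha%:C).
  apply: cvgB => //; apply: cvgM; first exact: cvg_cst.
  exact: cvg_at_right_filter.
have le0 : \forall t \near (0 : R)^'+, 0 <= K * t - cabs (g (ray t)).
  by apply: filterS le => t; rewrite subr_ge0.
have := cvgr_to_ge c0 le0; rewrite mulr0 sub0r oppr_ge0 => h; exact: h.
Qed.

Lemma ray_cabs_mul g (h : C -> C) :
  (\forall w \near (alpha%:C : C), g w = (w - alpha%:C) * h w) ->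
  \forall t \near (0 : R)^'+, cabs (g (ray t)) = t * cabs (h (ray t)).
Proof.
move=> /near_ray e; near=> t.
have -> : g (ray t) = (ray t - alpha%:C) * h (ray t) by near: t.
by rewrite ComplexField.Normc.normcM ray_dist.
Unshelve. all: by end_near. Qed.

(** A bound by [K * t ^+ n.+1] along the ray forces a zero at [alpha%:C], and the
    quotient by [w - alpha%:C] obeys the bound with [n] in place of [n.+1]. *)
Lemma ray_factor n g (K : R) : holomorphic_at g alpha%:C ->
  (\forall t \near (0 : R)^'+, cabs (g (ray t)) <= K * t ^+ n) ->
  exists2 h, holomorphic_at h alpha%:C &
    \forall w \near (alpha%:C : C), g w = (w - alpha%:C) ^+ n * h w.
Proof.
elim: n g => [|n IH] g hg le.
  by exists g => //; near=> w; rewrite expr0 mul1r.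
have g0 : g alpha%:C = 0.
  apply: (@ray_bound_zero g `|K|) => //; near=> t.
  have le1 : cabs (g (ray t)) <= K * t ^+ n.+1 by near: t.
  have t0 : 0 < t by [].
  have t1 : t < 1 by [].
  apply: le_trans le1 _; apply: le_trans (_ : `|K| * t ^+ n.+1 <= _).
    by rewrite ler_wpM2r ?ler_norm ?exprn_ge0 // ltW.
  by rewrite ler_wpM2l // exprS ler_piMr ?exprn_ile1 // ltW.
have [g1 hg1 g1E] := holomorphic_zero_factor hg g0.
have [||h hh hE] := IH g1 => //.
  have := ray_cabs_mul g1E => e; near=> t.
  have t0 : 0 < t by [].
  rewrite -(ler_pM2l t0) mulrCA -exprS.
  have <- : cabs (g (ray t)) = t * cabs (g1 (ray t)) by near: t.
  by near: t.
exists h => //; near=> w.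
have -> : g w = (w - alpha%:C) * g1 w by near: w.
have -> : g1 w = (w - alpha%:C) ^+ n * h w by near: w.
by rewrite mulrA -exprS.
Unshelve. all: by end_near. Qed.

Lemma ray_lower_neq0 g (k : R) : 0 < k -> holomorphic_at g alpha%:C ->
  (\forall t \near (0 : R)^'+, k <= cabs (g (ray t))) -> g alpha%:C != 0.
Proof.
move=> k0 /ray_cabs_cvg c le; rewrite -cabs_gt0; apply: lt_le_trans k0 _.
exact: (cvgr_to_ge c).
Qed.

(** Each division by [w - alpha%:C] lowers the exponent in the lower bound by one, and
    a quotient that is bounded below along the ray does not vanish at [alpha%:C]; so
    at most [n] divisions are possible. *)
Lemma ray_order n g (k : R) : 0 < k -> holomorphic_at g alpha%:C ->
  (\forall t \near (0 : R)^'+, k * t ^+ n <= cabs (g (ray t))) ->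
  exists m h, [/\ holomorphic_at h alpha%:C, h alpha%:C != 0 &
    \forall w \near (alpha%:C : C), g w = (w - alpha%:C) ^+ m * h w].
Proof.
move=> k0; elim: n g => [|n IH] g hg le.
  exists 0%N, g; split => //; last by near=> w; rewrite expr0 mul1r.
  apply: (ray_lower_neq0 k0 hg); apply: filterS le => t.
  by rewrite expr0 mulr1.
have [g0|g0] := eqVneq (g alpha%:C) 0; last first.
  by exists 0%N, g; split => //; near=> w; rewrite expr0 mul1r.
have [g1 hg1 g1E] := holomorphic_zero_factor hg g0.
have [||m [h [hh h0 hE]]] := IH g1 => //.
  have := ray_cabs_mul g1E => e; near=> t.
  have t0 : 0 < t by [].
  rewrite -(ler_pM2l t0) mulrCA -exprS.
  have <- : cabs (g (ray t)) = t * cabs (g1 (ray t)) by near: t.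
  by near: t.
exists m.+1, h; split => //; near=> w.
have -> : g w = (w - alpha%:C) * g1 w by near: w.
have -> : g1 w = (w - alpha%:C) ^+ m * h w by near: w.
by rewrite mulrA -exprS.
Unshelve. all: by end_near. Qed.

(** A meromorphic function comes with some exponent [D] of its denominator.  If [D]
    is smaller than [d], a power of [w - alpha%:C] is moved to the numerator; if it is
    larger, the bound gives the numerator a zero of order [D - d], which cancels. *)
Lemma meromorphic_ray_bound f d (K : R) : meromorphic_at f alpha%:C ->
  (\forall t \near (0 : R)^'+, cabs (f (ray t)) <= K / t ^+ d) ->
  exists2 g, holomorphic_at g alpha%:C &
    \forall w \near (alpha%:C : C)^', f w = g w / (w - alpha%:C) ^+ d.
Proof.
move=> [D [g [hg gE]]] le.
have [Dd|/ltnW dD] := leqP D d.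
  exists (fun w => g w * (w - alpha%:C) ^+ (d - D)).
    apply: filterS hg => w dg.
    have h := holoX (d - D) (holoB (holo_id w) (holo_cst (alpha%:C : C) w)).
    exact: (holoM dg h).
  have wne : \forall w \near (alpha%:C : C)^', w != alpha%:C by exact: nbhs_dnbhs_neq.
  near=> w; have -> : f w = g w / (w - alpha%:C) ^+ D by near: w.
  have w0 : w - alpha%:C != 0 by rewrite subr_eq0; near: w.
  by rewrite -{2}(subnK Dd) exprD invfM mulrA mulfK // expf_neq0 //.
have [|h hh hE] := @ray_factor (D - d) g K hg.
  have e := near_ray' gE; near=> t.
  have t0 : 0 < t by [].
  have : cabs (f (ray t)) <= K / t ^+ d by near: t.
  have -> : f (ray t) = g (ray t) / (ray t - alpha%:C) ^+ D by near: t.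
  rewrite ComplexField.Normc.normcM ComplexField.Normc.normcV cabsX ray_dist //.
  rewrite ler_pdivrMr ?exprn_gt0 // => h; apply: le_trans h _.
  rewrite -{1}(subnK dD) exprD -mulrA [_^-1 * _]mulrC -mulrA divff ?mulr1 //.
  by rewrite expf_neq0 // gt_eqF.
exists h => //.
have wne : \forall w \near (alpha%:C : C)^', w != alpha%:C by exact: nbhs_dnbhs_neq.
near=> w; have -> : f w = g w / (w - alpha%:C) ^+ D by near: w.
have w0 : w - alpha%:C != 0 by rewrite subr_eq0; near: w.
have -> : g w = (w - alpha%:C) ^+ (D - d) * h w by near: w; exact: nbhs_dnbhs.
by rewrite -{2}(subnK dD) exprD invfM mulrACA divff ?mul1r // expf_neq0 //.
Unshelve. all: by end_near. Qed.

Lemma ray_pole_of_order f d (K k : R) : (0 < d)%N -> 0 < k ->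
  meromorphic_at f alpha%:C ->
  (\forall t \near (0 : R)^'+, cabs (f (ray t)) <= K / t ^+ d) ->
  (\forall t \near (0 : R)^'+, k / t ^+ d <= cabs (f (ray t))) ->
  pole_of_order f alpha%:C d.
Proof.
move=> d0 k0 mf up low; split => //.
have [g hg gE] := meromorphic_ray_bound mf up.
exists g; split => //; apply: (ray_lower_neq0 k0 hg).
have e := near_ray' gE; near=> t.
have t0 : 0 < t by [].
have : k / t ^+ d <= cabs (f (ray t)) by near: t.
have -> : f (ray t) = g (ray t) / (ray t - alpha%:C) ^+ d by near: t.
rewrite ComplexField.Normc.normcM ComplexField.Normc.normcV cabsX ray_dist //.
by rewrite ler_pM2r // invr_gt0 exprn_gt0.
Unshelve. all: by end_near. Qed.

Lemma ray_removable f (K : R) : meromorphic_at f alpha%:C ->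
  (\forall t \near (0 : R)^'+, cabs (f (ray t)) <= K) ->
  removable_singularity f alpha%:C.
Proof.
move=> mf up; have [|g hg gE] := @meromorphic_ray_bound f 0 K mf.
  by apply: filterS up => t; rewrite expr0 divr1.
by exists g; split => //; apply: filterS gE => w ->; rewrite expr0 divr1.
Qed.

Lemma pole_of_order_ray_le f d e (K : R) : pole_of_order f alpha%:C e ->
  (\forall t \near (0 : R)^'+, cabs (f (ray t)) <= K / t ^+ d) -> (e <= d)%N.
Proof.
move=> [e0 [g [hg g0 gE]]] up; rewrite leqNgt; apply/negP => de.
case/negP: g0; apply/eqP; apply: (@ray_bound_zero g `|K|) => //.
have h := near_ray' gE; near=> t.
have t0 : 0 < t by [].
have t1 : t < 1 by [].
have : cabs (f (ray t)) <= K / t ^+ d by near: t.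
have -> : f (ray t) = g (ray t) / (ray t - alpha%:C) ^+ e by near: t.
rewrite ComplexField.Normc.normcM ComplexField.Normc.normcV cabsX ray_dist //.
rewrite ler_pdivrMr ?exprn_gt0 // => le; apply: le_trans le _.
rewrite -(subnK (ltnW de)) exprD -mulrA [_^-1 * _]mulrC -mulrA divff ?mulr1; last first.
  by rewrite expf_neq0 // gt_eqF.
apply: le_trans (_ : `|K| * t ^+ (e - d) <= _).
  by rewrite ler_wpM2r ?ler_norm ?exprn_ge0 // ltW.
rewrite ler_wpM2l //.
have : (0 < e - d)%N by rewrite subn_gt0.
by case: (e - d)%N => // m _; rewrite exprS ler_piMr ?exprn_ile1 // ltW.
Unshelve. all: by end_near. Qed.

End RayOrder.

(** * Perron-Frobenius theory of Metzler matrices *)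

Section DetContinuity.
Variables (R : realType) (T : Type) (F : set_system T).
Context {FF : Filter F}.

Lemma cvg_det n (E : T -> 'M[R]_n) (E0 : 'M[R]_n) :
  (forall i j, (fun t => E t i j) @ F --> E0 i j) ->
  (fun t => \det (E t)) @ F --> \det E0.
Proof.
move=> EE0; rewrite /determinant.
apply: (@cvg_big _ _ +%R 0 xpredT add_continuous) => s _.
apply: cvgM; first exact: cvg_cst.
exact: (@cvg_big R _ *%R 1 xpredT (@mul_continuous R) T F _ _ _ FF (fun i _ => EE0 i _)).
Qed.

Lemma cvg_adj n (E : T -> 'M[R]_n) (E0 : 'M[R]_n) :
  (forall i j, (fun t => E t i j) @ F --> E0 i j) ->
  forall i j, (fun t => (\adj (E t)) i j) @ F --> (\adj E0) i j.
Proof.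
move=> EE0 i j; rewrite /adjugate mxE.
under eq_fun do rewrite mxE.
rewrite /cofactor; apply: cvgM; first exact: cvg_cst.
apply: cvg_det => k l; rewrite !mxE; under eq_fun do rewrite !mxE.
exact: EE0.
Qed.

End DetContinuity.

Lemma horner_char_poly (K : comNzRingType) n (B : 'M[K]_n) (a : K) :
  (char_poly B).[a] = \det (a%:M - B).
Proof.
rewrite /char_poly -horner_evalE -det_map_mx; congr (\det _).
apply/matrixP => i j; rewrite !mxE rmorphB rmorphMn /=.
by rewrite /horner_eval hornerX hornerC.
Qed.

Section PerronFrobenius.
Variables (R : realType) (n : nat) (M : 'M[R]_n).
Hypothesis Moff : forall i j, i != j -> 0 <= M i j.
Implicit Types (l : R) (u x y : 'I_n -> R).

(** A strict positive supersolution.  It encodes, without eigenvalues, that [l] is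
    larger than the spectral abscissa of [M]: see [spectral_abscissa_dominates] and
    [dominates_spectral_abscissa]. *)
Definition dominates l :=
  exists2 u, (forall i, 0 < u i) & forall i, \sum_j M i j * u j < l * u i.

Lemma dominates_diag l i : dominates l -> M i i < l.
Proof.
case=> u u0 /(_ i); rewrite (bigD1 i) //= => lt.
rewrite -(ltr_pM2r (u0 i)); apply: le_lt_trans lt.
rewrite lerDl sumr_ge0 // => j ji.
by rewrite mulr_ge0 ?Moff 1?eq_sym // ltW.
Qed.

Lemma dominates_up l l' : dominates l -> l <= l' -> dominates l'.
Proof.
case=> u u0 lt ll'; exists u => // i; apply: lt_le_trans (lt i) _.
by rewrite ler_wpM2r // ltW.
Qed.

Lemma dominates_down l : dominates l -> exists2 e, 0 < e & dominates (l - e).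
Proof.
case=> u u0 lt.
pose e := \big[Num.min/1]_i ((l * u i - \sum_j M i j * u j) / u i / 2).
have e0 : 0 < e.
  rewrite /e; elim/big_ind: _ => [|a b a0 b0|i _]; first exact: ltr01.
    by rewrite lt_min a0 b0.
  by rewrite !divr_gt0 // subr_gt0.
exists e => //; exists u => // i.
have : e <= (l * u i - \sum_j M i j * u j) / u i / 2 by exact: bigmin_le.
rewrite -(ler_pM2r (u0 i)).
have := lt i; have := u0 i; set s := \sum_j _ => ui lti.
have -> : (l * u i - s) / u i / 2 * u i = (l * u i - s) / 2.
  by field; rewrite gt_eqF.
rewrite mulrBl; lra.
Qed.

Lemma dominates_large : exists l, dominates l.
Proof.
exists (\sum_i `|\sum_j M i j| + 1); exists (fun=> 1) => // i.
rewrite (eq_bigr (fun j => M i j)); last by move=> j _; rewrite mulr1.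
rewrite mulr1; set S := \sum_k `|_|.
suff h : `|\sum_j M i j| <= S.
  by apply: le_lt_trans (ler_norm _) _; apply: le_lt_trans h _; rewrite ltrDl.
by rewrite /S [leRHS](bigD1 i) //= lerDl sumr_ge0.
Qed.

(** Minimum principle: compare [x] with the positive supersolution, at an index
    where the ratio of the two is smallest. *)
Lemma dominates_min l x : dominates l ->
  (forall i, \sum_j M i j * x j <= l * x i) -> forall i, 0 <= x i.
Proof.
case=> u u0 lt Mx i0; rewrite leNgt; apply/negP => xi0.
have [k _ kmin] := @arg_minP _ _ _ i0 xpredT (fun i => x i / u i) isT.
set r := x k / u k.
have r0 : r < 0.
  apply: le_lt_trans (kmin i0 isT) _.
  by rewrite ltr_pdivrMr // mul0r.
have xE : x k = r * u k by rewrite /r divfK // gt_eqF.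
have ge j : r * u j <= x j by rewrite -ler_pdivlMr ?kmin.
have h1 : r * \sum_j M k j * u j <= \sum_j M k j * x j.
  rewrite (bigD1 k) //= [leRHS](bigD1 k) //= mulrDr xE mulrCA lerD2l.
  rewrite mulr_sumr ler_sum // => j jk.
  by rewrite mulrCA ler_wpM2l // Moff // eq_sym.
have := Mx k; rewrite leNgt => /negP; apply.
apply: lt_le_trans h1.
by rewrite xE mulrCA ltr_nM2l.
Qed.

Lemma dominates_det l : dominates l -> \det (l%:M - M) != 0.
Proof.
move=> gl; rewrite -det_tr; apply/det0P => -[v v0 vM].
have Mv i : \sum_j M i j * v 0 j = l * v 0 i.
  move/rowP: vM => /(_ i); rewrite !mxE => /eqP.
  rewrite (eq_bigr (fun j => l * (v 0 j * (i == j)%:R) - M i j * v 0 j)); last first.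
    by move=> j _; rewrite !mxE -[l *+ _]mulr_natr; ring.
  rewrite sumrB -mulr_sumr (bigD1 i) //= eqxx mulr1 big1 ?addr0; last first.
    by move=> j /negbTE ij; rewrite eq_sym ij mulr0.
  by rewrite subr_eq0 => /eqP ->.
have ge i : 0 <= v 0 i by apply: (dominates_min gl) => k; rewrite Mv.
have le i : 0 <= - v 0 i.
  apply: (dominates_min (x := fun i => - v 0 i) gl) => k.
  by rewrite mulrN -Mv -sumrN ler_sum // => j _; rewrite mulrN.
case/negP: v0; apply/eqP/rowP => i; rewrite mxE; apply/eqP.
by rewrite eq_le ge andbT -oppr_ge0 le.
Qed.

(** By [dominates_det] the characteristic polynomial has no zero in [[l, +oo[], and
    being monic it is positive near infinity. *)
Lemma dominates_det_gt0 l : dominates l -> 0 < \det (l%:M - M).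
Proof.
move=> gl; rewrite -horner_char_poly -sgr_gt0.
rewrite (@sgp_pinftyP R l) ?bound_itvE //; last first.
  move=> b; rewrite in_itv /= ?andbT => lb; rewrite rootE horner_char_poly dominates_det //.
  exact: dominates_up lb.
by rewrite /sgp_pinfty (monicP (char_poly_monic M)) sgr1 ltr01.
Qed.

Lemma dominates_adj_ge0 l : dominates l -> forall i j, 0 <= (\adj (l%:M - M)) i j.
Proof.
move=> gl i j; move: i.
apply: (dominates_min gl) => i.
have /matrixP/(_ i j) := mul_mx_adj (l%:M - M).
rewrite !mxE => e.
have : 0 <= \sum_k (l%:M - M) i k * (\adj (l%:M - M)) k j.
  by rewrite e; case: (i == j); rewrite ?mulr0n // mulr1n ltW // dominates_det_gt0.
have eE k : (l%:M - M) i k = l *+ (i == k) - M i k by rewrite !mxE.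
under eq_bigr => k _ do rewrite eE mulrBl.
rewrite sumrB subr_ge0 => /le_trans; apply.
rewrite (bigD1 i) //= [X in _ + X]big1 ?addr0 ?eqxx ?mulr1n; first by rewrite mxE.
move=> k ki.
by rewrite eq_sym (negbTE ki) mul0r.
Qed.

End PerronFrobenius.

Lemma right_eigenvector (K : fieldType) n (B : 'M[K]_n) (a : K) :
  reflect (exists2 v : 'I_n -> K, (exists i, v i != 0) &
             forall i, \sum_j B i j * v j = a * v i)
          (eigenvalue B a).
Proof.
have mulE (v : 'I_n -> K) i :
    \sum_j v j * (a%:M - B) i j = a * v i - \sum_j B i j * v j.
  have eE k : (a%:M - B) i k = a *+ (i == k) - B i k by rewrite !mxE.
  under eq_bigr => k _ do rewrite eE mulrBr [_ * B _ _]mulrC.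
  rewrite sumrB (bigD1 i) //= [X in _ + X - _]big1 ?addr0 ?eqxx ?mulr1n 1?mulrC //.
  by move=> k ki; rewrite eq_sym (negbTE ki) mulr0.
rewrite eigenvalue_root_char rootE horner_char_poly -det_tr.
apply: (iffP det0P) => [[v v0 vB]|[v [i vi0] Bv]].
  exists (v 0).
    apply/existsP; apply: contraNT v0; rewrite negb_exists => /forallP v0.
    by apply/eqP/rowP => i; rewrite mxE; apply/eqP; have := v0 i; rewrite negbK.
  move=> i; apply/esym/eqP; rewrite -subr_eq0 -mulE.
  move/rowP: vB => /(_ i); rewrite !mxE => vB; rewrite -[X in _ == X]vB.
  by apply/eqP/eq_bigr => j _; rewrite [in RHS]mxE.
exists (\row_j v j).
  by apply: contra vi0 => /eqP/rowP/(_ i); rewrite !mxE => ->.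
apply/rowP => j; rewrite mxE [RHS]mxE.
under eq_bigr => k _ do rewrite mxE [X in _ * X]mxE.
by rewrite mulE Bv subrr.
Qed.

Section Abscissa.
Variables (R : realType) (n : nat) (M : 'M[R]_n).
Hypothesis Moff : forall i j, i != j -> 0 <= M i j.

Local Notation Mc := (map_mx (real_complex R) M).

(** Taking moduli in the eigenvector equation gives a nonnegative subsolution for
    [complex.Re a], which [dominates_min] only allows to be [0]. *)
Lemma eigenvalue_Re_lt (a : R[i]) l :
  eigenvalue Mc a -> dominates M l -> complex.Re a < l.
Proof.
move=> /right_eigenvector[v [i0 vi0] Mv] gl; rewrite ltNge; apply/negP => la.
have {la}gl := dominates_up gl la.
pose y i := complex.Re `|v i|.
have yE i : `|v i| = (y i)%:C.
  by rewrite /y RRe_real.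
have y0 i : 0 <= y i by rewrite -ler0c -yE.
have sub i : complex.Re a * y i <= \sum_j M i j * y j.
  rewrite (bigD1 i) //= addrC -lerBlDr -mulrBl.
  have e : (a - (M i i)%:C) * v i = \sum_(j | j != i) (M i j)%:C * v j.
    rewrite mulrBl -Mv (bigD1 i) //= mxE [X in X - _]addrC addrK.
    by apply: eq_bigr => j _; rewrite mxE.
  have h : `|(a - (M i i)%:C)| * `|v i| <= \sum_(j | j != i) (M i j)%:C * `|v j|.
    rewrite -normrM e; apply: le_trans (ler_norm_sum _ _ _) _.
    apply: ler_sum => j ji; rewrite normrM ler_wpM2r // ger0_norm //.
    by rewrite lecR Moff // eq_sym.
  rewrite -lecR rmorphM rmorph_sum /= -yE.
  have -> : \sum_(j | j != i) (M i j * y j)%:C = \sum_(j | j != i) (M i j)%:C * `|v j|.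
    by apply: eq_bigr => j _; rewrite rmorphM /= -yE.
  apply: le_trans h; rewrite ler_wpM2r //.
  have -> : complex.Re a - M i i = complex.Re (a - (M i i)%:C) by case: (a).
  by apply: le_trans (normc_ge_Re _); rewrite lecR ler_norm.
have ge i : 0 <= - y i.
  apply: (dominates_min Moff (x := fun i => - y i) gl) => k.
  rewrite mulrN; under eq_bigr => j _ do rewrite mulrN.
  by rewrite sumrN lerN2.
have : y i0 = 0 by apply/eqP; rewrite eq_le y0 andbT -oppr_ge0 ge.
by move=> y00; move: vi0; rewrite -normr_eq0 yE y00 eqxx.
Qed.

Hypothesis n0 : (0 < n)%N.

Let S := inf [set l | dominates M l].

Let has_infS : has_inf [set l | dominates M l].
Proof.
split; first exact: dominates_large.
by exists (M (Ordinal n0) (Ordinal n0)) => l /= /(dominates_diag Moff (Ordinal n0))/ltW.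
Qed.

Let gtS l : S < l -> dominates M l.
Proof.
move=> Sl; have [l' gl' lt] := inf_adherent (eps := l - S) (ltac:(by rewrite subr_gt0)) has_infS.
by apply: dominates_up gl' _; move: lt; rewrite addrC subrK => /ltW.
Qed.

Let notS : ~ dominates M S.
Proof.
move=> /dominates_down[e e0 gS].
have := ge_inf (proj2 has_infS) gS; rewrite -/S; lra.
Qed.

(** At the infimum of the dominating values the inverse, if it existed, would be
    nonnegative by continuity, and its row sums would form a supersolution. *)
Let detS : \det (S%:M - M) = 0.
Proof.
apply/eqP/negP => /negP d0; apply: notS.
pose e := fun t : R => (S + t)%:M - M.
have dominates_cvg i j : (fun t => e t i j) @ 0^'+ --> (S%:M - M) i j.
  have eE k : e k i j = (S + k) *+ (i == j) - M i j by rewrite /e !mxE.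
  under eq_fun do rewrite eE.
  have <- : S *+ (i == j) - M i j = (S%:M - M) i j by rewrite !mxE.
  apply: cvgB; last exact: cvg_cst.
  case: (i == j); rewrite ?mulr1n ?mulr0n; last exact: cvg_cst.
  rewrite -[in X in _ --> X](addr0 S); apply: cvgD; first exact: cvg_cst.
  exact: cvg_at_right_filter.
have cdet : (fun t => \det (e t)) @ 0^'+ --> \det (S%:M - M) by exact: cvg_det.
have d_gt0 : 0 < \det (S%:M - M).
  rewrite lt_neqAle eq_sym d0 /=.
  apply: (cvgr_to_ge cdet); near=> t.
  by rewrite ltW // dominates_det_gt0 //; apply: gtS; rewrite ltrDl.
have adj0 i j : 0 <= (\adj (S%:M - M)) i j.
  have ca : (fun t => (\adj (e t)) i j) @ 0^'+ --> (\adj (S%:M - M)) i j by exact: cvg_adj.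
  apply: (cvgr_to_ge ca); near=> t.
  by rewrite dominates_adj_ge0 //; apply: gtS; rewrite ltrDl.
pose u i := \sum_k (\adj (S%:M - M)) i k.
have u_ge0 i : 0 <= u i by rewrite sumr_ge0.
have uE i : S * u i - \sum_j M i j * u j = \det (S%:M - M).
  have : \sum_k ((S%:M - M) *m \adj (S%:M - M)) i k = \det (S%:M - M).
    rewrite mul_mx_adj (bigD1 i) //= big1 ?addr0 ?mxE ?eqxx //.
    by move=> k ki; rewrite mxE eq_sym (negbTE ki).
  move=> <-.
  under [RHS]eq_bigr => k _ do rewrite mxE.
  rewrite exchange_big /=.
  have eE k : (S%:M - M) i k = S *+ (i == k) - M i k by rewrite !mxE.
  under [RHS]eq_bigr => k _ do rewrite -mulr_sumr -/(u k) eE mulrBl.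
  rewrite sumrB; congr (_ - _).
  rewrite (bigD1 i) //= eqxx mulr1n big1 ?addr0 // => k ki.
  by rewrite eq_sym (negbTE ki) mul0r.
exists u => [i|i]; last by rewrite -subr_gt0 uE.
rewrite lt_neqAle u_ge0 andbT; apply/eqP => ui0.
have := uE i; rewrite -ui0 mulr0 sub0r => h.
have : 0 <= \sum_j M i j * u j.
  apply: sumr_ge0 => j _; have [<-|ij] := eqVneq i j; first by rewrite -ui0 mulr0.
  by rewrite mulr_ge0 ?Moff.
by move: d_gt0; rewrite -h => /[swap]; rewrite leNgt oppr_gt0 => /negP.
Unshelve. all: by end_near. Qed.

(** The infimum [S] of the dominating values is an eigenvalue by [detS], and no
    eigenvalue has a larger real part by [eigenvalue_Re_lt]. *)
Lemma spectral_abscissaE : spectral_abscissa Mc = S.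
Proof.
have [[a ea aE] maxa] := spectral_abscissa_max Mc n0.
rewrite -aE.
apply/eqP; rewrite eq_le; apply/andP; split.
  rewrite leNgt; apply/negP => lt.
  by have := eigenvalue_Re_lt ea (gtS lt); rewrite ltxx.
have e : eigenvalue Mc S%:C.
  rewrite eigenvalue_root_char rootE horner_char_poly.
  have -> : S%:C%:M - Mc = map_mx (real_complex R) (S%:M - M).
    by apply/matrixP => i j; rewrite !mxE rmorphB rmorphMn.
  by rewrite det_map_mx detS.
by rewrite aE; exact: maxa e.
Qed.

Lemma spectral_abscissa_dominates l : spectral_abscissa Mc < l -> dominates M l.
Proof. by rewrite spectral_abscissaE; exact: gtS. Qed.

Lemma spectral_abscissa_det : \det ((spectral_abscissa Mc)%:M - M) = 0.
Proof. by rewrite spectral_abscissaE. Qed.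

Lemma dominates_spectral_abscissa l : dominates M l -> spectral_abscissa Mc < l.
Proof.
by have [[a ea <-] _] := spectral_abscissa_max Mc n0; exact: eigenvalue_Re_lt.
Qed.

End Abscissa.

Definition irreducible_mx (K : nzRingType) n (B : 'M[K]_n) :=
  forall i j, connect [rel i j | (i != j) && (B i j != 0)] i j.

Section Irreducible.
Variables (R : realType) (n : nat) (M : 'M[R]_n).
Hypothesis Moff : forall i j, i != j -> 0 <= M i j.
Hypothesis Mirr : irreducible_mx M.

(** If [x i = 0], the [i]-th inequality makes [x] vanish at all successors of [i]; so
    positivity at [k] spreads backwards along paths. *)
Lemma supersolution_gt0 (c : R) (x : 'I_n -> R) k : 0 < x k ->
  (forall i, 0 <= x i) -> (forall i, \sum_j M i j * x j <= c * x i) ->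
  forall i, 0 < x i.
Proof.
move=> xk x0 Mx i; have /connectP[p pp kE] := Mirr i k; move: pp kE xk.
elim: p i => [|j p IH] i /=; first by move=> _ ->.
case/andP=> /andP[ij Mij] pp kE xk.
have xj : 0 < x j by exact: IH.
rewrite lt_neqAle x0 andbT; apply/eqP => xi0.
have := Mx i; rewrite -xi0 mulr0 leNgt => /negP; apply.
rewrite (bigD1 j) //= ltr_pwDl //.
  by rewrite mulr_gt0 // lt_neqAle eq_sym Mij Moff.
apply: sumr_ge0 => m _; have [<-|im] := eqVneq i m; first by rewrite -xi0 mulr0.
by rewrite mulr_ge0 ?Moff.
Qed.

Lemma resolvent_mulE (a : R) (x : 'I_n -> R) i :
  \sum_k (a%:M - M) i k * x k = a * x i - \sum_k M i k * x k.
Proof.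
have eE k : (a%:M - M) i k = a *+ (i == k) - M i k by rewrite !mxE.
under eq_bigr => k _ do rewrite eE mulrBl.
rewrite sumrB; congr (_ - _).
rewrite (bigD1 i) //= eqxx mulr1n big1 ?addr0 // => k ki.
by rewrite eq_sym (negbTE ki) mul0r.
Qed.

Lemma resolvent_adjE (a : R) i j :
  a * (\adj (a%:M - M)) i j - \sum_k M i k * (\adj (a%:M - M)) k j
    = \det (a%:M - M) *+ (i == j).
Proof.
rewrite -(resolvent_mulE a (fun k => (\adj (a%:M - M)) k j)).
by have /matrixP/(_ i j) := mul_mx_adj (a%:M - M); rewrite !mxE.
Qed.

Lemma dominates_adj_gt0 l : dominates M l -> forall i j, 0 < (\adj (l%:M - M)) i j.
Proof.
move=> gl i j.
have d0 := dominates_det_gt0 Moff gl.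
have ge := dominates_adj_ge0 Moff gl.
have [k Gk] : exists k, 0 < (\adj (l%:M - M)) k j.
  apply/existsP; apply: contraT; rewrite negb_exists => /forallP G0.
  have {}G0 k : (\adj (l%:M - M)) k j = 0.
    by apply/eqP; rewrite eq_le ge andbT leNgt G0.
  have := resolvent_adjE l j j; rewrite G0 mulr0 eqxx mulr1n big1 => [|k _].
    by rewrite subr0 => e; move: d0; rewrite -e ltxx.
  by rewrite G0 mulr0.
apply: (supersolution_gt0 (c := l) (x := fun i => (\adj (l%:M - M)) i j) Gk) => // m.
by rewrite -subr_ge0 resolvent_adjE; case: eqP; rewrite ?mulr1n ?mulr0n // ltW.
Qed.

Hypothesis Mdom : forall l, 0 < l -> dominates M l.

(** If [M y] were not [0], applying the positive matrix [\adj (1%:M - M)], which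
    commutes with [M], would give a positive [z] with [M z] positive, hence at least
    [e z] for some [e > 0], and [e] could not dominate [M].  So [M y = 0], and [y]
    is a supersolution. *)
Lemma subinvariant_gt0 (y : 'I_n -> R) k : 0 < y k ->
  (forall i, 0 <= y i) -> (forall i, 0 <= \sum_j M i j * y j) ->
  forall i, 0 < y i.
Proof.
move=> yk y0 My0.
have G0 := dominates_adj_gt0 (Mdom ltr01).
set G := \adj (1%:M - M) in G0.
have MG : M *m G = G *m M.
  have : (1%:M - M) *m G = G *m (1%:M - M) by rewrite mul_mx_adj mul_adj_mx.
  by rewrite mulmxBl mulmxBr mul1mx mulmx1 => /addrI/oppr_inj.
pose z i := \sum_j G i j * y j.
have Mz i : \sum_j M i j * z j = \sum_j G i j * \sum_k M j k * y k.
  transitivity (\sum_k (M *m G) i k * y k).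
    under [RHS]eq_bigr => j _ do rewrite mxE mulr_suml.
    rewrite exchange_big /=; apply: eq_bigr => j _.
    by rewrite mulr_sumr; apply: eq_bigr => m _; rewrite mulrA.
  rewrite MG.
  under eq_bigr => j _ do rewrite mxE mulr_suml.
  rewrite exchange_big /=; apply: eq_bigr => j _.
  by rewrite mulr_sumr; apply: eq_bigr => m _; rewrite mulrA.
have [/existsP[m bm]|] := boolP [exists m, 0 < \sum_j M m j * y j].
  exfalso.
  have z0 i : 0 < z i.
    rewrite /z (bigD1 k) //= ltr_pwDl ?mulr_gt0 // sumr_ge0 // => j _.
    by rewrite mulr_ge0 // ltW.
  have Mz0 i : 0 < \sum_j M i j * z j.
    rewrite Mz (bigD1 m) //= ltr_pwDl ?mulr_gt0 // sumr_ge0 // => j _.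
    by rewrite mulr_ge0 // ltW.
  pose e := \big[Num.min/1]_i ((\sum_j M i j * z j) / z i).
  have e0 : 0 < e.
    rewrite /e; elim/big_ind: _ => [|a b a0 b0|i _]; first exact: ltr01.
      by rewrite lt_min a0 b0.
    by rewrite divr_gt0.
  have : 0 <= - z k.
    apply: (dominates_min Moff (x := fun i => - z i) (Mdom e0)) => i.
    under eq_bigr => j _ do rewrite mulrN.
    rewrite sumrN mulrN lerN2 -ler_pdivlMr //.
    exact: bigmin_le.
  by rewrite oppr_ge0 leNgt z0.
rewrite negb_exists => /forallP b0.
apply: (supersolution_gt0 (c := 0) yk) => // i.
by rewrite mul0r leNgt.
Qed.

(** A null vector of the principal minor at [i], extended by [0], would give a
    subinvariant vector of moduli that vanishes at [i]. *)
Lemma principal_minor_neq0 i : \det (row' i (col' i M)) != 0.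
Proof.
rewrite -det_tr; apply/det0P => -[v v0 vM].
pose y j := if unlift i j is Some k then `|v 0 k| else 0.
have yi : y i = 0 by rewrite /y unlift_none.
have yl k : y (lift i k) = `|v 0 k| by rewrite /y liftK.
have y0 j : 0 <= y j by rewrite /y; case: unliftP.
have [k vk] : exists k, v 0 k != 0.
  apply/existsP; apply: contraNT v0; rewrite negb_exists => /forallP v0.
  by apply/eqP/rowP => k; rewrite mxE; apply/eqP; have := v0 k; rewrite negbK.
have yk : 0 < y (lift i k) by rewrite yl normr_gt0.
suff : 0 < y i by rewrite yi ltxx.
apply: (subinvariant_gt0 yk) => // j.
case: (unliftP i j) => [m ->|->]; last first.
  apply: sumr_ge0 => j' _; have [<-|ij] := eqVneq i j'; first by rewrite yi mulr0.
  by rewrite mulr_ge0 ?Moff.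
have sumE (F : 'I_n -> R) : F i = 0 -> \sum_j' F j' = \sum_k F (lift i k).
  move=> Fi; rewrite (bigD1 i) //= Fi add0r (reindex_omap (lift i) (unlift i)) /=.
    by apply: eq_bigl => a; rewrite eq_sym neq_lift liftK eqxx.
  by move=> a; case: (unliftP i a) => [b ->|->]; rewrite ?liftK ?eqxx.
rewrite sumE; last by rewrite yi mulr0.
move/rowP: vM => /(_ m); rewrite mxE [RHS]mxE => vM.
rewrite (bigD1 m) //= yl.
under eq_bigr => a _ do rewrite yl.
have : M (lift i m) (lift i m) * v 0 m =
  - \sum_(a | a != m) M (lift i m) (lift i a) * v 0 a.
  apply/eqP; rewrite -addr_eq0 -[X in _ == X]vM [X in _ == X](bigD1 m) //=.
  rewrite !mxE mulrC; apply/eqP; congr (_ + _).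
  by apply: eq_bigr => a _; rewrite !mxE mulrC.
move=> e; rewrite -lerBlDl sub0r.
apply: le_trans (_ : `|M (lift i m) (lift i m) * v 0 m| <= _).
  by rewrite normrM -mulNr ler_wpM2r // -normrN ler_norm.
rewrite e normrN; apply: le_trans (ler_norm_sum _ _ _) _.
apply: ler_sum => a am; rewrite normrM ger0_norm // Moff //.
by rewrite (inj_eq lift_inj) eq_sym.
Qed.

End Irreducible.

Section IrreducibleMetzler.
Variables (R : realType) (n : nat) (M : 'M[R]_n).
Hypothesis Moff : forall i j, i != j -> 0 <= M i j.
Hypothesis Mirr : irreducible_mx M.
Hypothesis n0 : (0 < n)%N.

Local Notation zeta := (spectral_abscissa (map_mx (real_complex R) M)).

(** Nonnegativity follows by letting [l] decrease to [0] in [dominates_adj_ge0].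
    The diagonal entries are nonzero by [principal_minor_neq0], and each column is a
    supersolution, so it is positive throughout. *)
Lemma irreducible_adj_gt0 : zeta <= 0 -> forall i j, 0 < (\adj (- M)) i j.
Proof.
move=> z0.
have Mdom l : 0 < l -> dominates M l.
  by move=> l0; apply: (spectral_abscissa_dominates Moff n0); exact: le_lt_trans l0.
pose e := fun t : R => t%:M - M.
have ecvg i j : (fun t => e t i j) @ 0^'+ --> (- M) i j.
  have eE k : e k i j = k *+ (i == j) - M i j by rewrite /e !mxE.
  under eq_fun do rewrite eE.
  have -> : (- M) i j = 0 *+ (i == j) - M i j by rewrite !mxE mul0rn sub0r.
  apply: cvgB; last exact: cvg_cst.
  case: (i == j); rewrite ?mulr1n ?mulr0n; last exact: cvg_cst.
  exact: cvg_at_right_filter.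
have d0 : 0 <= \det (- M).
  have cdet : (fun t => \det (e t)) @ 0^'+ --> \det (- M) by exact: cvg_det.
  apply: (cvgr_to_ge cdet); near=> t.
  by rewrite ltW // dominates_det_gt0 //; apply: Mdom.
have adj0 i j : 0 <= (\adj (- M)) i j.
  have ca : (fun t => (\adj (e t)) i j) @ 0^'+ --> (\adj (- M)) i j by exact: cvg_adj.
  apply: (cvgr_to_ge ca); near=> t.
  by rewrite dominates_adj_ge0 //; apply: Mdom.
move=> i j.
have adjj : 0 < (\adj (- M)) j j.
  rewrite lt_neqAle adj0 andbT eq_sym mxE /cofactor mulf_neq0 ?signr_eq0 //.
  have -> : row' j (col' j (- M)) = - row' j (col' j M).
    by apply/matrixP => a b; rewrite !mxE.
  by rewrite -scaleN1r detZ mulf_neq0 ?expf_neq0 ?oppr_eq0 ?oner_eq0 // principal_minor_neq0.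
apply: (supersolution_gt0 Moff Mirr (c := 0) (x := fun i => (\adj (- M)) i j) adjj) => // k.
have := resolvent_adjE M 0 k j; rewrite mul0r -[(0%:M - M)](_ : - M = _); last first.
  by rewrite raddf0 sub0r.
by move=> h; rewrite mul0r -oppr_ge0 -sub0r h; case: eqP; rewrite ?mulr1n ?mulr0n.
Unshelve. all: by end_near. Qed.

Lemma irreducible_det_gt0 : zeta < 0 -> 0 < \det (- M).
Proof.
move=> /(spectral_abscissa_dominates Moff n0)/(dominates_det_gt0 Moff).
by rewrite raddf0 sub0r.
Qed.

End IrreducibleMetzler.

(** * Rates of growth at 0 *)

Section Growth.
Variable R : realType.
Implicit Types (f g : R -> R) (d e : nat).

(** Neither bound involves an absolute value, so products of upper bounds ask for
    nonnegative factors. *)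
Definition growth_le f d := exists K, \forall t \near (0 : R)^'+, f t <= K / t ^+ d.
Definition growth_ge f d :=
  exists2 k, 0 < k & \forall t \near (0 : R)^'+, k / t ^+ d <= f t.
Definition near_nonneg f := \forall t \near (0 : R)^'+, 0 <= f t.

Lemma growth_le_weaken f d e : (d <= e)%N -> growth_le f d -> growth_le f e.
Proof.
move=> de [K le]; exists `|K|; near=> t.
have t0 : 0 < t by [].
have t1 : t < 1 by [].
have h : f t <= K / t ^+ d by near: t.
apply: le_trans h _; apply: le_trans (_ : `|K| / t ^+ d <= _).
  by rewrite ler_wpM2r ?ler_norm // invr_ge0 exprn_ge0 // ltW.
rewrite ler_wpM2l // lef_pV2 ?posrE ?exprn_gt0 //.
by rewrite -(subnK de) exprD ler_piMl ?exprn_ge0 ?exprn_ile1 // ltW.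
Unshelve. all: by end_near. Qed.

Lemma growth_leD f g d : growth_le f d -> growth_le g d -> growth_le (fun t => f t + g t) d.
Proof.
move=> [K hK] [L hL]; exists (K + L); near=> t.
rewrite mulrDl; apply: lerD; [near: t; exact: hK|near: t; exact: hL].
Unshelve. all: by end_near. Qed.

Lemma growth_le0 d : growth_le (fun=> 0) d.
Proof. by exists 0; near=> t; rewrite mul0r. Unshelve. all: by end_near. Qed.

Lemma growth_le_sum (I : Type) (r : seq I) (P : pred I) (F : I -> R -> R) d :
  (forall i, P i -> growth_le (F i) d) -> growth_le (fun t => \sum_(i <- r | P i) F i t) d.
Proof.
move=> H; elim: r => [|i r IH].
  have -> : (fun t => \sum_(i <- [::] | P i) F i t) = (fun=> 0).
    by apply/funext => t; rewrite big_nil.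
  exact: growth_le0.
have -> : (fun t => \sum_(j <- i :: r | P j) F j t) =
    (fun t => (if P i then F i t else 0) + \sum_(j <- r | P j) F j t).
  by apply/funext => t; rewrite big_cons; case: ifP; rewrite ?add0r.
apply: growth_leD; last exact: IH.
by case Pi: (P i); [exact: H|exact: growth_le0].
Qed.

Lemma growth_leM f g d e : near_nonneg f -> near_nonneg g ->
  growth_le f d -> growth_le g e -> growth_le (fun t => f t * g t) (d + e).
Proof.
move=> f0 g0 [K hK] [L hL]; exists (K * L); near=> t.
have h1 : 0 <= f t by near: t.
have h2 : 0 <= g t by near: t.
have h3 : f t <= K / t ^+ d by near: t.
have h4 : g t <= L / t ^+ e by near: t.
by rewrite exprD invfM mulrACA ler_pM.
Unshelve. all: by end_near. Qed.

Lemma growth_le_prod (I : Type) (r : seq I) (F : I -> R -> R) (d : I -> nat) :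
  (forall i, near_nonneg (F i)) -> (forall i, growth_le (F i) (d i)) ->
  growth_le (fun t => \prod_(i <- r) F i t) (\sum_(i <- r) d i).
Proof.
move=> F0 H; elim: r => [|i r IH].
  exists 1; near=> t; rewrite !big_nil expr0 divr1 //.
rewrite big_cons.
have -> : (fun t => \prod_(j <- i :: r) F j t) = (fun t => F i t * \prod_(j <- r) F j t).
  by apply/funext => t; rewrite big_cons.
apply: growth_leM => //.
elim: r {IH} => [|j r IH]; first by near=> t; rewrite big_nil.
near=> t; rewrite big_cons mulr_ge0 //; near: t; [exact: F0|exact: IH].
Unshelve. all: by end_near. Qed.

Lemma growth_le_eq f g d : (\forall t \near (0 : R)^'+, f t = g t) ->
  growth_le f d -> growth_le g d.
Proof.
move=> fg [K hK]; exists K; near=> t.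
have <- : f t = g t by near: t.
by near: t.
Unshelve. all: by end_near. Qed.

Lemma growth_ge_le f g d : (\forall t \near (0 : R)^'+, f t <= g t) ->
  growth_ge f d -> growth_ge g d.
Proof.
move=> fg [k k0 hk]; exists k => //; near=> t.
have h : f t <= g t by near: t.
by apply: le_trans h; near: t.
Unshelve. all: by end_near. Qed.

Lemma growth_geM f g d e : growth_ge f d -> growth_ge g e ->
  growth_ge (fun t => f t * g t) (d + e).
Proof.
move=> [k k0 hk] [l l0 hl]; exists (k * l); first exact: mulr_gt0.
near=> t; have t0 : 0 < t by [].
have h3 : k / t ^+ d <= f t by near: t.
have h4 : l / t ^+ e <= g t by near: t.
by rewrite exprD invfM mulrACA ler_pM // ltW // divr_gt0 // exprn_gt0.
Unshelve. all: by end_near. Qed.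

Lemma growth_geZ f d (c : R) : 0 < c -> growth_ge f d -> growth_ge (fun t => c * f t) d.
Proof.
move=> c0 [k k0 hk]; exists (c * k); first exact: mulr_gt0.
near=> t; rewrite -mulrA ler_wpM2l ?(ltW c0) //; near: t; exact: hk.
Unshelve. all: by end_near. Qed.

Lemma growth_ge_nonneg f d : growth_ge f d -> near_nonneg f.
Proof.
move=> [k k0 hk]; near=> t; have t0 : 0 < t by [].
apply: (@le_trans _ _ (k / t ^+ d)); last by near: t.
by rewrite ltW // divr_gt0 // exprn_gt0.
Unshelve. all: by end_near. Qed.

Lemma cvg_growth f d (l : R) : 0 < l -> (fun t => f t * t ^+ d) @ (0 : R)^'+ --> l ->
  growth_le f d /\ growth_ge f d.
Proof.
move=> l0 cl; split.
  exists (l + 1); near=> t; have t0 : 0 < t by [].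
  rewrite ler_pdivlMr ?exprn_gt0 //; near: t.
  by apply: (cvgr_le _ cl); rewrite ltrDl.
exists (l / 2); first by rewrite divr_gt0.
near=> t; have t0 : 0 < t by [].
rewrite ler_pdivrMr ?exprn_gt0 //; near: t.
by apply: (cvgr_ge _ cl); rewrite ltr_pdivrMr // ltr_pMr // ltr1n.
Unshelve. all: by end_near. Qed.

End Growth.

(** * Back-substitution along the classes of a graph *)

Section BlockAlgebra.
Variables (R : realType) (N : nat) (E : rel 'I_N).
Implicit Types (i j k m : 'I_N).
Local Notation acc := (connect E).

Definition mutual i j := connect E i j && connect E j i.

(** The induction measure: it decreases strictly whenever a path leaves a class. *)
Definition reach i := #|connect E i|.

Lemma mutual_refl i : mutual i i.
Proof. by rewrite /mutual connect0. Qed.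

Lemma mutual_left i j k : mutual i j -> mutual i k = mutual j k.
Proof.
case/andP=> ij ji; rewrite /mutual.
apply/andP/andP => -[h1 h2]; split.
- exact: connect_trans ji h1.
- exact: connect_trans h2 ij.
- exact: connect_trans ij h1.
- exact: connect_trans h2 ji.
Qed.

Lemma reach_lt i k : acc i k -> ~~ acc k i -> (reach k < reach i)%N.
Proof.
move=> ik ki; apply: proper_card; apply/properP; split.
  by apply/fintype.subsetP => l; exact: connect_trans.
by exists i => //; rewrite -topredE /= connect0.
Qed.

Lemma reach_leaving i m k : mutual i m -> acc m k -> ~~ mutual m k ->
  [/\ acc i k, ~~ acc k i & (reach k < reach i)%N].
Proof.
case/andP=> im mi mk nmk.
have ik : acc i k := connect_trans im mk.
have ki : ~~ acc k i.
  apply: contra nmk => ki; rewrite /mutual mk; exact: connect_trans ki im.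
by split => //; exact: reach_lt.
Qed.

Variables (a p : 'I_N -> 'I_N -> R).
Hypothesis a_acc : forall i j, ~~ acc i j -> a i j = 0.
(* Restricted to a class, [p] is the inverse of the diagonal block of [- a]. *)
Hypothesis p_inv : forall i k, mutual i k ->
  \sum_(m | mutual i m) p i m * - a m k = (i == k)%:R.

(** Block back-substitution: the rows of one class are inverted, and what remains
    only involves strictly later classes. *)
Lemma block_solve (x y : 'I_N -> R) : (forall m, \sum_k a m k * x k = - y m) ->
  forall i, x i = \sum_(m | mutual i m) p i m *
    (y m + \sum_(k | ~~ mutual m k) a m k * x k).
Proof.
move=> ax i.
have e m : mutual i m -> y m + \sum_(k | ~~ mutual m k) a m k * x k =
    \sum_(k | mutual i k) - a m k * x k.
  move=> im; have -> : y m = - \sum_k a m k * x k by rewrite ax opprK.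
  rewrite (bigID (mutual m)) /= opprD subrK -sumrN.
  by apply: eq_big => [k|k _]; rewrite ?(mutual_left _ im) ?mulNr.
rewrite (eq_bigr _ (fun m im => congr1 (fun z => p i m * z) (e m im))).
under eq_bigr => m _ do rewrite mulr_sumr.
rewrite exchange_big /= (bigD1 i) ?mutual_refl //= [X in _ + X]big1 => [|k /andP[ik ki]].
  rewrite addr0; under eq_bigr => m _ do rewrite mulrA.
  by rewrite -mulr_suml p_inv ?mutual_refl // eqxx mul1r.
under eq_bigr => m _ do rewrite mulrA.
by rewrite -mulr_suml p_inv // eq_sym (negbTE ki) mul0r.
Qed.

Lemma block_zero (x y : 'I_N -> R) i : (forall m, \sum_k a m k * x k = - y m) ->
  (forall m, acc i m -> y m = 0) -> x i = 0.
Proof.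
move=> ax; have [n] := ubnP (reach i); elim: n i => // n IH i /ltnSE lei y0.
rewrite (block_solve ax) big1 // => m im.
have /andP[aim _] := im.
rewrite y0 // add0r big1 ?mulr0 // => k nmk.
have [mk|/a_acc ->] := boolP (acc m k); last by rewrite mul0r.
have [ik _ lt] := reach_leaving im mk nmk.
rewrite (IH k) ?mulr0 //; first exact: leq_trans lt lei.
by move=> l kl; apply: y0; exact: connect_trans kl.
Qed.

Lemma block_ge0 (x y : 'I_N -> R) : (forall m, \sum_k a m k * x k = - y m) ->
  (forall i m, mutual i m -> 0 <= p i m) -> (forall i j, i != j -> 0 <= a i j) ->
  (forall m, 0 <= y m) -> forall i, 0 <= x i.
Proof.
move=> ax p0 a0 y0 i.
have [n] := ubnP (reach i); elim: n i => // n IH i /ltnSE lei.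
rewrite (block_solve ax) sumr_ge0 // => m im.
rewrite mulr_ge0 ?p0 // addr_ge0 // sumr_ge0 // => k nmk.
have [mk|/a_acc ->] := boolP (acc m k); last by rewrite mul0r.
have [_ _ lt] := reach_leaving im mk nmk.
rewrite mulr_ge0 ?IH //; last exact: leq_trans lt lei.
by apply: a0; apply: contraNneq nmk => ->; exact: mutual_refl.
Qed.

Lemma block_unitmx : \matrix_(i, j) a i j \in unitmx.
Proof.
rewrite unitmxE unitfE -det_tr; apply/det0P => -[v v0 va].
case/negP: v0; apply/eqP/rowP => i; rewrite mxE.
apply: (@block_zero (v 0) (fun=> 0)) => // m.
move/rowP: va => /(_ m); rewrite !mxE oppr0 => va; rewrite -[RHS]va.
by apply: eq_bigr => k _; rewrite !mxE mulrC.
Qed.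

End BlockAlgebra.

Section BlockGrowth.
Variables (R : realType) (N : nat) (E : rel 'I_N).
Implicit Types (i j k m : 'I_N).
Local Notation acc := (connect E).
Local Notation mutual := (mutual E).
Variables (a p : 'I_N -> 'I_N -> R -> R) (b : 'I_N -> nat).
Hypothesis a_acc : forall i j, ~~ acc i j -> \forall t \near (0 : R)^'+, a i j t = 0.
Hypothesis a_off : forall i j, i != j -> near_nonneg (a i j).
Hypothesis a_le : forall i j, i != j -> growth_le (a i j) 0.
Hypothesis a_diag : forall i, growth_le (fun t => - a i i t) 0.
Hypothesis a_edge : forall i j, E i j -> i != j /\ growth_ge (a i j) 0.
Hypothesis p_inv : forall i k, mutual i k -> \forall t \near (0 : R)^'+,
  \sum_(m | mutual i m) p i m t * - a m k t = (i == k)%:R.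
Hypothesis p_le : forall i j, mutual i j -> growth_le (p i j) (b i).
Hypothesis p_ge : forall i j, mutual i j -> growth_ge (p i j) (b i).

Let all_a_acc : \forall t \near (0 : R)^'+, forall i j, ~~ acc i j -> a i j t = 0.
Proof.
apply: filter_forall => i; apply: filter_forall => j.
by apply: filter_imply; exact: a_acc.
Qed.

Let all_a_off : \forall t \near (0 : R)^'+, forall i j, i != j -> 0 <= a i j t.
Proof.
apply: filter_forall => i; apply: filter_forall => j.
by apply: filter_imply; exact: a_off.
Qed.

Let all_p_inv : \forall t \near (0 : R)^'+, forall i k, mutual i k ->
  \sum_(m | mutual i m) p i m t * - a m k t = (i == k)%:R.
Proof.
apply: filter_forall => i; apply: filter_forall => j.
by apply: filter_imply; exact: p_inv.
Qed.

Let all_p_ge0 : \forall t \near (0 : R)^'+, forall i j, mutual i j -> 0 <= p i j t.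
Proof.
apply: filter_forall => i; apply: filter_forall => j.
by apply: filter_imply => /p_ge; exact: growth_ge_nonneg.
Qed.

Lemma near_block_unitmx : \forall t \near (0 : R)^'+, \matrix_(i, j) a i j t \in unitmx.
Proof.
near=> t; apply: (@block_unitmx _ _ E _ (fun i j => p i j t)); first by near: t.
by near: t.
Unshelve. all: by end_near. Qed.

(* [x] is the [j]-th column of the inverse of [- a]. *)
Variables (j : 'I_N) (x : 'I_N -> R -> R).
Hypothesis ax : \forall t \near (0 : R)^'+, forall m,
  \sum_k a m k t * x k t = - (m == j)%:R.

Let xE : \forall t \near (0 : R)^'+, forall i,
  x i t = \sum_(m | mutual i m) p i m t *
    ((m == j)%:R + \sum_(k | ~~ mutual m k) a m k t * x k t).
Proof.
near=> t => i.
apply: (@block_solve _ _ E (fun i j => a i j t) (fun i j => p i j t) _ (fun k => x k t)).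
  by near: t.
by near: t.
Unshelve. all: by end_near. Qed.

Let x_ge0 : \forall t \near (0 : R)^'+, forall i, 0 <= x i t.
Proof.
near=> t.
apply: (@block_ge0 _ _ E (fun i j => a i j t) (fun i j => p i j t) _ _
  (fun k => x k t) (fun m => (m == j)%:R)); try by near: t.
by move=> m.
Unshelve. all: by end_near. Qed.

Lemma solution_nonneg i : near_nonneg (x i).
Proof. by near=> t; near: t; apply: filterS x_ge0 => t; exact. Unshelve. all: by end_near. Qed.

Lemma solution_zero i : ~~ acc i j -> \forall t \near (0 : R)^'+, x i t = 0.
Proof.
move=> ij; near=> t.
apply: (@block_zero _ _ E (fun i j => a i j t) (fun i j => p i j t) _ _
  (fun k => x k t) (fun m => (m == j)%:R) i); try by near: t.
by move=> m im; case: eqP => // mj; move: ij; rewrite -mj im.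
Unshelve. all: by end_near. Qed.

(** Back-substitution adds nonnegative terms, and its term [m = j] is [p i j]. *)
Lemma solution_class i : mutual i j -> growth_ge (x i) (b i).
Proof.
move=> ij; apply: growth_ge_le (p_ge ij); near=> t.
have xEt : forall i, x i t = \sum_(m | mutual i m) p i m t *
    ((m == j)%:R + \sum_(k | ~~ mutual m k) a m k t * x k t) by near: t.
rewrite [leRHS]xEt.
have x0 k : 0 <= x k t by move: k; near: t.
have a0 k l : k != l -> 0 <= a k l t by move: k l; near: t.
have p0 k l : mutual k l -> 0 <= p k l t by move: k l; near: t.
have s0 m : 0 <= \sum_(k | ~~ mutual m k) a m k t * x k t.
  apply: sumr_ge0 => k nmk; rewrite mulr_ge0 // a0 //.
  by apply: contraNneq nmk => ->; exact: mutual_refl.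
rewrite (bigD1 j) //= eqxx mulrDr mulr1 -addrA lerDl addr_ge0 ?mulr_ge0 ?p0 //.
by apply: sumr_ge0 => m /andP[im _]; rewrite mulr_ge0 ?p0 // addr_ge0.
Unshelve. all: by end_near. Qed.

(** Harnack's inequality: in the [i]-th equation the nonnegative terms other than
    [a i k * x k] may be dropped, and the diagonal coefficient is bounded. *)
Lemma solution_edge i k d : E i k -> growth_ge (x k) d -> growth_ge (x i) d.
Proof.
move=> /a_edge[ik [e e0 he]] hk; have [K hK] := a_diag i.
have K1 : 0 < `|K| + 1 by rewrite ltr_wpDl.
apply: growth_ge_le (growth_geZ (divr_gt0 e0 K1) hk); near=> t.
have x0 l : 0 <= x l t by move: l; near: t.
have a0 l m : l != m -> 0 <= a l m t by move: l m; near: t.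
have h1 : e <= a i k t by rewrite -[e]divr1 -(expr0 t); near: t.
have h2 : - a i i t <= K by rewrite -[K]divr1 -(expr0 t); near: t.
have h3 : forall m, \sum_l a m l t * x l t = - (m == j)%:R by near: t.
rewrite mulrAC ler_pdivrMr //.
apply: (@le_trans _ _ (a i k t * x k t)); first by rewrite ler_wpM2r.
apply: (@le_trans _ _ (- a i i t * x i t)); last first.
  rewrite [leRHS]mulrC ler_wpM2r //; apply: le_trans h2 _.
  by apply: le_trans (ler_norm K) _; rewrite lerDl.
have : a i i t * x i t + a i k t * x k t <= 0.
  apply: (@le_trans _ _ (\sum_l a i l t * x l t)); last first.
    by rewrite h3 oppr_le0.
  rewrite (bigD1 i) //= (bigD1 k) 1?eq_sym //= lerD2l lerDl sumr_ge0 //.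
  by move=> l /andP[li lk]; rewrite mulr_ge0 // a0 // eq_sym.
by rewrite mulNr; lra.
Unshelve. all: by end_near. Qed.

Lemma solution_access i k d : acc i k -> growth_ge (x k) d -> growth_ge (x i) d.
Proof.
move=> /connectP[q qp ->]; elim: q i qp => //= l q IH i /andP[il ql] h.
exact: solution_edge il (IH _ ql h).
Qed.

(** The edge is the first one of the path whose target has no access back to [i]. *)
Lemma leaving_edge i k : acc i k -> ~~ acc k i ->
  exists m l, [/\ mutual i m, E m l, ~~ mutual m l & acc l k].
Proof.
move=> /connectP[q qp kE]; elim: q i qp kE => [|l q IH] i /=.
  by move=> _ ->; rewrite connect0.
case/andP=> il ql kE nki.
have lk : acc l k by apply/connectP; exists q.
have [li|nli] := boolP (acc l i).
  have nkl : ~~ acc k l by apply: contra nki => kl; exact: connect_trans kl li.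
  have [m [u [lm mu nmu uk]]] := IH l ql kE nkl.
  exists m, u; split => //; rewrite (@mutual_left _ _ i l) //.
  by apply/andP; split => //; exact: connect1.
exists i, l; split => //; first exact: mutual_refl.
by rewrite negb_and nli orbT.
Qed.

(** The path from [i] to [k] leaves the class of [i] by an edge [m -> l]; of the
    back-substitution for [x i] keep the term [p i m * a m l * x l]. *)
Lemma solution_leaving i k d : acc i k -> ~~ acc k i -> growth_ge (x k) d ->
  growth_ge (x i) (b i + d).
Proof.
move=> ik ki hk; have [m [l [im ml nml lk]]] := leaving_edge ik ki.
have hl := solution_access lk hk.
have [ml' aml] := a_edge ml.
apply: growth_ge_le (growth_geM (p_ge im) (growth_geM aml hl)); near=> t.
have xEt : forall i, x i t = \sum_(m | mutual i m) p i m t *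
    ((m == j)%:R + \sum_(k | ~~ mutual m k) a m k t * x k t) by near: t.
rewrite [leRHS]xEt.
have x0 u : 0 <= x u t by move: u; near: t.
have a0 u u' : u != u' -> 0 <= a u u' t by move: u u'; near: t.
have p0 u u' : mutual u u' -> 0 <= p u u' t by move: u u'; near: t.
have ax0 u u' : ~~ mutual u u' -> 0 <= a u u' t * x u' t.
  move=> noo; rewrite mulr_ge0 // a0 //.
  by apply: contraNneq noo => ->; exact: mutual_refl.
have s0 u : 0 <= \sum_(k | ~~ mutual u k) a u k t * x k t.
  by apply: sumr_ge0 => u' /ax0.
have h1 : a m l t * x l t <= \sum_(k | ~~ mutual m k) a m k t * x k t.
  by rewrite (bigD1 l) //= lerDl sumr_ge0 // => u /andP[/ax0].
rewrite [leRHS](bigD1 m) //=; apply: ler_wpDr.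
  by apply: sumr_ge0 => u /andP[iu _]; rewrite mulr_ge0 ?p0 ?addr_ge0.
by rewrite ler_wpM2l ?p0 //; apply: le_trans h1 _; rewrite lerDr.
Unshelve. all: by end_near. Qed.

(** To be used with [D i d] stating that the chains from the class of [i] to that of
    [j] have length at most [d]; the two closure properties are all the induction on
    [reach] asks for. *)
Lemma solution_le (D : 'I_N -> nat -> Prop) :
  (forall i d, D i d -> mutual i j -> (b i <= d)%N) ->
  (forall i k d, D i d -> acc i k -> ~~ acc k i -> acc k j ->
     (b i <= d)%N /\ D k (d - b i)%N) ->
  forall i d, D i d -> growth_le (x i) d.
Proof.
move=> D0 DS i; have [n] := ubnP (reach E i); elim: n i => // n IH i /ltnSE lei d Dd.
have e : \forall t \near (0 : R)^'+, \sum_(m | mutual i m) p i m t *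
    ((m == j)%:R + \sum_(k | ~~ mutual m k) a m k t * x k t) = x i t.
  by near=> t; apply/esym; near: t; apply: filterS xE => t; exact.
apply: growth_le_eq e _.
apply: growth_le_sum => m im.
have -> : (fun t => p i m t * ((m == j)%:R + \sum_(k | ~~ mutual m k) a m k t * x k t)) =
    (fun t => p i m t * (m == j)%:R + \sum_(k | ~~ mutual m k) p i m t * (a m k t * x k t)).
  by apply/funext => t; rewrite mulrDr mulr_sumr.
apply: growth_leD.
  have [mj|_] := eqVneq m j; last first.
    have -> : (fun t => p i m t * false%:R) = (fun=> 0) by apply/funext => t; rewrite mulr0.
    exact: growth_le0.
  have -> : (fun t => p i m t * true%:R) = p i m by apply/funext => t; rewrite mulr1.
  by apply: growth_le_weaken (p_le im); apply: (D0 i) => //; rewrite -mj.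
apply: growth_le_sum => k nmk.
have zero : (\forall t \near (0 : R)^'+, a m k t * x k t = 0) ->
    growth_le (fun t => p i m t * (a m k t * x k t)) d.
  move=> h; apply: growth_le_eq _ (growth_le0 R d).
  by apply: filterS h => t ->; rewrite mulr0.
have [mk|/a_acc h] := boolP (acc m k); last first.
  by apply: zero; apply: filterS h => t ->; rewrite mul0r.
have [kj|/solution_zero h] := boolP (acc k j); last first.
  by apply: zero; apply: filterS h => t ->; rewrite mulr0.
have [ik ki lt] := reach_leaving im mk nmk.
have [bd Dk] := DS _ _ _ Dd ik ki kj.
have xk := IH k (leq_trans lt lei) _ Dk.
have mk' : m != k by apply: contraNneq nmk => ->; exact: mutual_refl.
rewrite -(subnKC bd) -(add0n (d - b i)%N).
have x0 := solution_nonneg k.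
apply: growth_leM; [exact: growth_ge_nonneg (p_ge im)| |exact: p_le|].
  by near=> t; rewrite mulr_ge0 //; near: t; [exact: a_off|exact: x0].
by apply: growth_leM; [exact: a_off|exact: x0|exact: a_le|exact: xk].
Unshelve. all: by end_near. Qed.

End BlockGrowth.

(** * The inverse of an irreducible diagonal block *)

Section IrreducibleFamily.
Variables (R : realType) (n : nat) (M : R -> 'M[R]_n) (al : R).
Hypothesis n0 : (0 < n)%N.
Hypothesis Moff : \forall s \near al, forall i j, i != j -> 0 <= M s i j.
Hypothesis Mcont : forall i j, (fun s => M s i j) @ al --> M al i j.
Hypothesis Mirr : irreducible_mx (M al).

Let z s := spectral_abscissa (map_mx (real_complex R) (M s)).

Let add_cvg (T : Type) (F : set_system T) (u : T -> R) : Filter F -> u @ F --> (0 : R) ->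
  (fun h => al + u h) @ F --> al.
Proof.
move=> FF F0; have h : (fun h => al + u h) @ F --> al + 0.
  by apply: cvgD => //; exact: cvg_cst.
by rewrite addr0 in h.
Qed.

Let shift_cvg (F : set_system R) : Filter F -> F --> (0 : R) ->
  forall i j, (fun h => M (al + h) i j) @ F --> M al i j.
Proof.
by move=> FF F0 i j; apply: (cvg_comp _ _ _ (@Mcont i j)); exact: add_cvg.
Qed.

Let negmx_cvg (F : set_system R) : Filter F -> F --> (0 : R) ->
  forall i j, (fun h => (- M (al + h)) i j) @ F --> (- M al) i j.
Proof.
move=> FF F0 i j; have -> : (- M al) i j = - M al i j by rewrite mxE.
have -> : (fun h => (- M (al + h)) i j) = (fun h => - M (al + h) i j).
  by apply/funext => h; rewrite mxE.
by apply: cvgN; exact: shift_cvg.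
Qed.

(** Let [K s = \adj ((z s)%:M - M s)].  As [z s] is an eigenvalue of [M s],
    [K s *m - M s = - z s *: K s], and multiplication by [\adj (- M s)] gives
    [\det (- M s) *: K s = - z s *: (K s *m \adj (- M s))].  Divide by [s - al] and
    let [s] tend to [al]: both adjugates tend to the positive [\adj (- M al)].
    The filter [F] leaves open from which side: the determinant is differentiable,
    while the abscissa may have a derivative on one side only. *)
Lemma det_derivative_spectral (F : set_system R) (l f' : R) : ProperFilter F ->
  F --> (0 : R)^' -> z al = 0 ->
  (fun h => (z (al + h) - z al) / h) @ F --> l ->
  (fun h => \det (- M (al + h)) / h) @ (0 : R)^' --> f' ->
  exists2 c, 0 < c & f' = - l * c.
Proof.
move=> PF F0' z0 zl dl.
have F0 : F --> (0 : R) by apply: cvg_trans F0' _; exact: cvg_within.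
have Moff0 := nbhs_singleton Moff.
have adj0 : forall i j, 0 < (\adj (- M al)) i j.
  by apply: (irreducible_adj_gt0 Moff0 Mirr n0); rewrite -/(z al) z0.
have FM : \forall h \near F, forall i j, i != j -> 0 <= M (al + h) i j.
  have : (fun h : R => al + h) @ F --> al by exact: add_cvg.
  by move=> /(_ _ Moff).
have Fne : \forall h \near F, h != 0.
  have h0 : \forall h \near (0 : R)^', h != 0 by exact: nbhs_dnbhs_neq.
  exact: (F0' _ h0).
have zlim : (fun h => z (al + h)) @ F --> (0 : R).
  have h : (fun h => (z (al + h) - z al) / h * h) @ F --> l * 0 by exact: cvgM.
  rewrite mulr0 in h; apply: cvg_trans h; apply: near_eq_cvg; near=> h.
  by rewrite z0 subr0 divfK //; near: h.
pose K h := \adj ((z (al + h))%:M - M (al + h)).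
pose i0 := Ordinal n0.
have Kl i j : (fun h => K h i j) @ F --> (\adj (- M al)) i j.
  apply: cvg_adj => k m.
  have -> : (fun h => ((z (al + h))%:M - M (al + h)) k m) =
      (fun h => z (al + h) *+ (k == m) - M (al + h) k m).
    by apply/funext => h; rewrite !mxE.
  have -> : (- M al) k m = 0 *+ (k == m) - M al k m by rewrite mxE mul0rn sub0r.
  apply: cvgB; last exact: shift_cvg.
  by case: (k == m); rewrite ?mulr1n ?mulr0n //; exact: cvg_cst.
have adjl i j : (fun h => (\adj (- M (al + h))) i j) @ F --> (\adj (- M al)) i j.
  by apply: cvg_adj; exact: negmx_cvg.
pose Q := \sum_k (\adj (- M al)) i0 k * (\adj (- M al)) k i0.
have Q0 : 0 < Q.
  rewrite /Q (bigD1 i0) //= ltr_pwDl ?mulr_gt0 // sumr_ge0 // => k _.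
  by rewrite mulr_ge0 // ltW.
have eq1 : \forall h \near F, \det (- M (al + h)) / h * K h i0 i0 =
    - ((z (al + h) - z al) / h) * \sum_k K h i0 k * (\adj (- M (al + h))) k i0.
  near=> h.
  have off : forall i j, i != j -> 0 <= M (al + h) i j by near: h.
  have d0 := spectral_abscissa_det off n0; rewrite -/(z (al + h)) in d0.
  have KM : K h *m - M (al + h) = - z (al + h) *: K h.
    have := mul_adj_mx ((z (al + h))%:M - M (al + h)); rewrite d0 -/(K h) mulmxBr.
    rewrite mul_mx_scalar raddf0 => /eqP; rewrite subr_eq0 => /eqP e.
    by rewrite mulmxN -e scaleNr.
  have e : \det (- M (al + h)) *: K h = - z (al + h) *: (K h *m \adj (- M (al + h))).
    by rewrite scalemxAl -KM -mulmxA mul_mx_adj mul_mx_scalar.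
  have := congr1 (fun X : 'M[R]_n => X i0 i0) e; rewrite !mxE => {}e.
  by rewrite mulrAC e z0 subr0 mulrAC mulNr.
have lim1 : (fun h => \det (- M (al + h)) / h * K h i0 i0) @ F --> f' * (\adj (- M al)) i0 i0.
  by apply: cvgM => //; apply: cvg_trans dl; exact: cvg_app.
have lim2 : (fun h => - ((z (al + h) - z al) / h) *
    \sum_k K h i0 k * (\adj (- M (al + h))) k i0) @ F --> - l * Q.
  apply: cvgM; first exact: cvgN.
  exact: (@cvg_big R _ +%R 0 xpredT add_continuous _ F _ _ _ _
    (fun k _ => cvgM (Kl i0 k) (adjl k i0))).
have lim1' : (fun h => \det (- M (al + h)) / h * K h i0 i0) @ F --> - l * Q.
  apply: cvg_trans lim2; apply: near_eq_cvg; near=> h.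
  by apply/esym; near: h.
have e : f' * (\adj (- M al)) i0 i0 = - l * Q by exact: cvg_unique lim1 lim1'.
exists (Q / (\adj (- M al)) i0 i0); first exact: divr_gt0.
by rewrite mulrA -e mulfK // gt_eqF.
Unshelve. all: by end_near. Qed.

Definition block_inverse s i j := (\adj (- M s)) i j / \det (- M s).

Lemma block_inverse_mul s i j : \det (- M s) != 0 ->
  \sum_m block_inverse s i m * - M s m j = (i == j)%:R.
Proof.
move=> d0; have /matrixP/(_ i j) := mul_adj_mx (- M s).
rewrite !mxE => e; have -> : (i == j)%:R = \det (- M s) *+ (i == j) / \det (- M s).
  by case: (i == j); rewrite ?mulr1n ?mulr0n ?divff ?mul0r.
rewrite -e mulr_suml; apply: eq_bigr => m _.
by rewrite /block_inverse mulrAC; congr (_ * _ / _); rewrite mxE.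
Qed.

Variable sg : R.

Let ray_cvg0 : (fun t => sg * t) @ (0 : R)^'+ --> (0 : R).
Proof.
have h : (fun t => sg * t) @ (0 : R)^'+ --> sg * 0.
  by apply: cvgM; [exact: cvg_cst|exact: cvg_at_right_filter].
by rewrite mulr0 in h.
Qed.

Let ray_negmx i j : (fun t => (- M (al + sg * t)) i j) @ (0 : R)^'+ --> (- M al) i j.
Proof.
have -> : (- M al) i j = - M al i j by rewrite mxE.
have -> : (fun t => (- M (al + sg * t)) i j) = (fun t => - M (al + sg * t) i j).
  by apply/funext => h; rewrite mxE.
by apply: cvgN; apply: (cvg_comp _ _ _ (@Mcont i j)); exact: add_cvg.
Qed.

(** The adjugate has a positive limit, and the determinant is of the order of [t]. *)
Lemma block_inverse_basic (kappa : R) : z al = 0 -> 0 < kappa ->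
  (fun t => \det (- M (al + sg * t)) / t) @ (0 : R)^'+ --> kappa ->
  (\forall t \near (0 : R)^'+, \det (- M (al + sg * t)) != 0) /\
  forall i j, growth_le (fun t => block_inverse (al + sg * t) i j) 1 /\
              growth_ge (fun t => block_inverse (al + sg * t) i j) 1.
Proof.
move=> z0 k0 dk.
have dne : \forall t \near (0 : R)^'+, \det (- M (al + sg * t)) != 0.
  have h : \forall t \near (0 : R)^'+, 0 < \det (- M (al + sg * t)) / t.
    exact: (cvgr_gt _ dk).
  near=> t; have : 0 < \det (- M (al + sg * t)) / t by near: t.
  by apply: contraTneq => ->; rewrite mul0r ltxx.
split => // i j.
have adj0 : 0 < (\adj (- M al)) i j.
  by apply: (irreducible_adj_gt0 (nbhs_singleton Moff) Mirr n0); rewrite -/(z al) z0.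
apply: (cvg_growth (divr_gt0 adj0 k0)).
have lim : (fun t => (\adj (- M (al + sg * t))) i j / (\det (- M (al + sg * t)) / t))
    @ (0 : R)^'+ --> (\adj (- M al)) i j / kappa.
  apply: cvgM; first exact: cvg_adj.
  by apply: cvgV => //; rewrite gt_eqF.
apply: cvg_trans lim; apply: near_eq_cvg; near=> t.
by rewrite /block_inverse expr1 invfM invrK mulrA.
Unshelve. all: by end_near. Qed.

Lemma block_inverse_nonbasic : z al < 0 ->
  (\forall t \near (0 : R)^'+, \det (- M (al + sg * t)) != 0) /\
  forall i j, growth_le (fun t => block_inverse (al + sg * t) i j) 0 /\
              growth_ge (fun t => block_inverse (al + sg * t) i j) 0.
Proof.
move=> z0.
have d0 := irreducible_det_gt0 (nbhs_singleton Moff) n0 z0.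
have dl : (fun t => \det (- M (al + sg * t))) @ (0 : R)^'+ --> \det (- M al) by exact: cvg_det.
split.
  have h : \forall t \near (0 : R)^'+, 0 < \det (- M (al + sg * t)) by exact: (cvgr_gt _ dl).
  by apply: filterS h => t /gt_eqF ->.
move=> i j.
have adj0 : 0 < (\adj (- M al)) i j.
  by apply: (irreducible_adj_gt0 (nbhs_singleton Moff) Mirr n0); exact: ltW.
apply: (cvg_growth (divr_gt0 adj0 d0)).
have lim : (fun t => (\adj (- M (al + sg * t))) i j / \det (- M (al + sg * t)))
    @ (0 : R)^'+ --> (\adj (- M al)) i j / \det (- M al).
  apply: cvgM; first exact: cvg_adj.
  by apply: cvgV => //; rewrite gt_eqF.
apply: cvg_trans lim; apply: near_eq_cvg; near=> t.
by rewrite /block_inverse expr0 mulr1.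
Unshelve. all: by end_near. Qed.

End IrreducibleFamily.

(** * Restriction to the real axis *)

Section RealRestriction.
Variable R : realType.
Local Notation C := R[i]^o.
Variable al : R.

Lemma near_real (P : C -> Prop) : (\forall w \near (al%:C : C), P w) ->
  \forall s \near al, P s%:C.
Proof.
move=> /near_cabsP[d d0 dP]; apply/nbhs_ballP; exists d => // s.
rewrite /ball /= => sd; apply: dP.
by rewrite -(rmorphB (real_complex R)) cabsR distrC.
Qed.

Lemma real_continuous (g : C -> C) : {for al%:C, continuous g} ->
  (fun s : R => complex.Re (g s%:C)) @ al --> complex.Re (g al%:C).
Proof.
move=> /continuous_cabsP cg; apply/cvgrPdist_lt => e /cg[d d0 dP].
have : \forall w \near (al%:C : C), cabs (g w - g al%:C) < e.
  by apply/near_cabsP; exists d.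
move=> /near_real; apply: filterS => s lt.
by rewrite distrC; apply: le_lt_trans (Re_le _ _) lt.
Qed.

Lemma real_derivative (g : C -> C) (phi : R -> R) : derivable g al%:C 1 ->
  (\forall s \near al, g (s : R)%:C = (phi s)%:C) ->
  exists f' : R, (fun h => (phi (al + h) - phi al) / h) @ (0 : R)^' --> f'.
Proof.
move=> /derivable_cdiff[l lP] gphi; exists (complex.Re l).
apply/cvgrPdist_le => e /lP[d d0 dP].
have g0 := nbhs_singleton gphi.
have /nbhs_ballP[r r0 rP] := gphi.
rewrite near_withinE; apply/nbhs_ballP; exists (Num.min d r).
  by rewrite /= lt_min d0.
move=> h; rewrite /ball /= sub0r normrN lt_min => /andP[hd hr] h0.
have gh : g (al + h)%:C = (phi (al + h))%:C.
  by apply: rP; rewrite /ball /= opprD addNKr normrN.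
have eB (u v : R) : (u - v)%:C = u%:C - v%:C by exact: (rmorphB (real_complex R)).
have hE : (al + h)%:C - al%:C = h%:C by rewrite -eB addrC addKr.
have := dP (al + h)%:C; rewrite hE cabsR gh g0 -eB => /(_ hd) le.
have := le_trans (cabs_Re _) le; rewrite ReB.
have -> : complex.Re (l * h%:C) = complex.Re l * h by case: (l) => u v /=; rewrite mulr0 subr0.
move=> le1; rewrite -(ler_pM2r (_ : 0 < `|h|)) ?normr_gt0 //.
by rewrite -normrM mulrBl divfK // distrC.
Qed.

End RealRestriction.

(** * Classes and chains *)

Section Classes.
Variables (R : realType) (N : nat) (B : 'M[R[i]]_N).
Implicit Types (i j k : 'I_N) (gamma delta : {set 'I_N}) (c : seq {set 'I_N}).

Definition class_of i : {set 'I_N} := finset (mutual (edge B) i).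

Lemma in_class_of i j : (j \in class_of i) = mutual (edge B) i j.
Proof. by rewrite inE. Qed.

Lemma class_of_refl i : i \in class_of i.
Proof. by rewrite in_class_of mutual_refl. Qed.

Lemma class_of_mutual i j : mutual (edge B) i j -> class_of i = class_of j.
Proof. by move=> ij; apply/setP => k; rewrite !in_class_of; exact: mutual_left. Qed.

Lemma class_of_in i : class_of i \in vertex_classes B.
Proof.
apply/imsetP; exists i; first by rewrite inE.
by apply/setP => k; rewrite !inE.
Qed.

Lemma vertex_classesP gamma : gamma \in vertex_classes B ->
  (exists i, i \in gamma) /\ forall i, i \in gamma -> gamma = class_of i.
Proof.
case/imsetP=> x _ gE.
have {}gE : gamma = class_of x by rewrite gE; apply/setP => k; rewrite !inE.
split; first by exists x; rewrite gE class_of_refl.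
by move=> i; rewrite gE in_class_of; exact: class_of_mutual.
Qed.

Lemma class_leP gamma delta i j : gamma \in vertex_classes B ->
  delta \in vertex_classes B -> i \in gamma -> j \in delta ->
  class_le B gamma delta = access B i j.
Proof.
move=> /vertex_classesP[_ gE] /vertex_classesP[_ dE] ig jd.
apply/exists_inP/idP => [[k kg /exists_inP[l ld kl]]|ij]; last first.
  by exists i => //; apply/exists_inP; exists j.
move: kg ld; rewrite (gE _ ig) (dE _ jd) !in_class_of => /andP[ik _] /andP[_ lj].
exact: connect_trans ik (connect_trans kl lj).
Qed.

Lemma class_ltP gamma delta i j : gamma \in vertex_classes B ->
  delta \in vertex_classes B -> i \in gamma -> j \in delta ->
  class_lt B gamma delta = access B i j && ~~ access B j i.
Proof.
move=> gB dB ig jd; rewrite /class_lt /= (class_leP gB dB ig jd).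
case: (boolP (access B i j)) => //= ij; congr (~~ _).
have [_ gE] := vertex_classesP gB; have [_ dE] := vertex_classesP dB.
apply/eqP/idP => [e|ji].
  by move: jd; rewrite -e (gE _ ig) in_class_of => /andP[].
by rewrite (gE _ ig) (dE _ jd); apply: class_of_mutual; apply/andP.
Qed.

Lemma class_chain_cons gamma c : class_chain B (gamma :: c) ->
  gamma \in vertex_classes B /\
  (c = [::] \/ [/\ c != [::], class_chain B c & class_lt B gamma (head finset.set0 c)]).
Proof.
case/and3P=> _ /= /andP[gB call]; case: c call => [|delta c] call /=; first by split; [|left].
by case/andP=> lt pc; split => //; right; split => //; apply/and3P.
Qed.

Lemma class_chain1 i : class_chain B [:: class_of i].
Proof. by rewrite /class_chain /= class_of_in. Qed.

Lemma class_chain_head c : class_chain B c -> exists k, k \in head finset.set0 c.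
Proof.
by case: c => [//|g c] /class_chain_cons[/vertex_classesP[]].
Qed.

Lemma class_chain_last c : class_chain B c -> last finset.set0 c \in vertex_classes B.
Proof.
case: c => // g c /and3P[_ /allP call _]; apply: call.
by rewrite /= mem_last.
Qed.

(** Accessibility sets shrink strictly along a chain. *)
Lemma class_chain_size c i : class_chain B c -> i \in head finset.set0 c ->
  (size c <= reach (edge B) i)%N.
Proof.
elim: c i => [//|g c IH] i /class_chain_cons[gB [->|[c0 cc lt]]] /= ig.
  by apply/card_gt0P; exists i; rewrite -topredE /= connect0.
have [k kh] := class_chain_head cc.
have hB : head finset.set0 c \in vertex_classes B.
  by case: (c) c0 cc => // d c' _ /class_chain_cons[].
move: lt; rewrite (class_ltP gB hB ig kh) => /andP[ik ki].
exact: leq_ltn_trans (IH k cc kh) (reach_lt ik ki).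
Qed.

Lemma chain_length_le c : class_chain B c -> (chain_length B c <= N)%N.
Proof.
move=> cc; apply: leq_trans (count_size _ _) _.
case: c cc => // g c cc; have [/vertex_classesP[[i ig] _] _] := class_chain_cons cc.
apply: leq_trans (class_chain_size cc ig) _.
by apply: leq_trans (max_card _) _; rewrite card_ord.
Qed.

Lemma longest_chain_exists (P : seq {set 'I_N} -> Prop) :
  (exists2 c, class_chain B c & P c) -> exists d, longest_chain_length B P d.
Proof.
move=> [c0 cc0 Pc0].
pose Q := [pred n | `[< exists c, [/\ class_chain B c, P c & chain_length B c = n] >]].
have Q0 : exists n, Q n.
  by exists (chain_length B c0); apply/asboolP; exists c0.
have QN n : Q n -> (n <= N)%N.
  by move=> /asboolP[c [cc _ <-]]; exact: chain_length_le.
case: (ex_maxnP Q0 QN) => d /asboolP Qd dmax; exists d; split => // c cc Pc.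
by apply: dmax; apply/asboolP; exists c.
Qed.

(** One class if the access is mutual, two classes otherwise. *)
Lemma chain_between i j : access B i j ->
  exists c, [/\ class_chain B c, i \in head finset.set0 c & j \in last finset.set0 c].
Proof.
move=> ij; have [ji|nji] := boolP (access B j i).
  exists [:: class_of i]; split; [exact: class_chain1|exact: class_of_refl|].
  by rewrite in_class_of; apply/andP.
exists [:: class_of i; class_of j]; split; [|exact: class_of_refl|exact: class_of_refl].
have lt : class_lt B (class_of i) (class_of j).
  by rewrite (class_ltP (class_of_in i) (class_of_in j) (class_of_refl i) (class_of_refl j)) ij.
apply/and3P; split => //=; first by rewrite !class_of_in.
by rewrite andbT; exact: lt.
Qed.

Lemma class_chain_extend i k c : class_chain B c -> k \in head finset.set0 c ->
  access B i k -> ~~ access B k i -> class_chain B (class_of i :: c).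
Proof.
case: c => // g c cc kg ik nki; have [gB _] := class_chain_cons cc.
case/and3P: cc => _ /= /andP[_ call] pc.
have lt : class_lt B (class_of i) g.
  by rewrite (class_ltP (class_of_in i) gB (class_of_refl i) kg) ik.
apply/and3P; split => //=; first by rewrite class_of_in gB.
by apply/andP; split; [exact: lt|exact: pc].
Qed.

End Classes.

Section ChainGrowth.
Variables (R : realType) (N : nat) (B : 'M[R[i]]_N).
Variables (j : 'I_N) (x : 'I_N -> R -> R).
Local Notation b i := (nat_of_bool (basic B (class_of B i))).
Hypothesis x_class : forall i, mutual (edge B) i j -> growth_ge (x i) (b i).
Hypothesis x_leaving : forall i k d, access B i k -> ~~ access B k i ->
  growth_ge (x k) d -> growth_ge (x i) (b i + d).
Hypothesis x_le : forall D : 'I_N -> nat -> Prop,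
  (forall i d, D i d -> mutual (edge B) i j -> (b i <= d)%N) ->
  (forall i k d, D i d -> access B i k -> ~~ access B k i -> access B k j ->
     (b i <= d)%N /\ D k (d - b i)%N) ->
  forall i d, D i d -> growth_le (x i) d.

(** Each class passed on the way contributes its own exponent. *)
Lemma growth_ge_chain c i : class_chain B c -> i \in head finset.set0 c ->
  j \in last finset.set0 c -> growth_ge (x i) (chain_length B c).
Proof.
elim: c i => // g c IH i /class_chain_cons[gB [->|[c0 cc lt]]] /= ig jl.
  have [_ gE] := vertex_classesP gB.
  rewrite /chain_length /= addn0 (gE _ ig); apply: x_class.
  by rewrite -in_class_of -(gE _ ig).
have [k kh] := class_chain_head cc.
have hB : head finset.set0 c \in vertex_classes B.
  by case: (c) c0 cc => // d c' _ /class_chain_cons[].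
move: lt; rewrite (class_ltP gB hB ig kh) => /andP[ik ki].
have [_ gE] := vertex_classesP gB.
rewrite /chain_length /= -/(chain_length B c) {1}(gE _ ig).
apply: (x_leaving ik ki); apply: IH => //.
by move: jl; case: (c) c0.
Qed.

(** A chain that starts at [k] can be prefixed by the class of [i], so the chains from
    [k] obey the bound lowered by the exponent of that class. *)
Lemma growth_le_chain d i :
  (forall c, class_chain B c -> i \in head finset.set0 c -> j \in last finset.set0 c ->
     (chain_length B c <= d)%N) -> growth_le (x i) d.
Proof.
pose D i d := forall c, class_chain B c -> i \in head finset.set0 c ->
  j \in last finset.set0 c -> (chain_length B c <= d)%N.
move: i d; apply: (x_le (D := D)) => [i d Dd ij|i k d Dd ik nki kj].
  have := Dd _ (class_chain1 B i); rewrite /chain_length /= addn0; apply.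
    exact: class_of_refl.
  by rewrite in_class_of.
have ext c : class_chain B c -> k \in head finset.set0 c -> j \in last finset.set0 c ->
    (b i + chain_length B c <= d)%N.
  move=> cc kh jl; apply: (Dd (class_of B i :: c)) => //=.
  - exact: class_chain_extend cc kh ik nki.
  - exact: class_of_refl.
  - by move: cc jl; case: (c).
split.
  have [c [cc kh jl]] := chain_between kj.
  exact: leq_trans (leq_addr _ _) (ext c cc kh jl).
by move=> c cc kh jl; rewrite leq_subRL ?ext //; exact: leq_trans (leq_addr _ _) (ext c cc kh jl).
Qed.

End ChainGrowth.

(** * Growth of the inverse along a ray *)

Section Family.
Variables (R : realType) (Omega : set R[i]^o) (N : nat) (A : R[i] -> 'M[R[i]]_N) (al : R).
Hypothesis N_gt0 : (0 < N)%N.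
Hypothesis Omega_open : open Omega.
Hypothesis A_holo : mx_holomorphic_on Omega A.
Hypothesis Omega_al : Omega al%:C.
Hypothesis A_metzler : forall s : R, Omega s%:C -> metzler (A s%:C).
Hypothesis A_abscissa : spectral_abscissa (A al%:C) = 0.
Hypothesis A_block : forall gamma delta : {set 'I_N},
  gamma \in vertex_classes (A al%:C) -> delta \in vertex_classes (A al%:C) ->
  ~~ class_le (A al%:C) gamma delta ->
  forall z, Omega z -> submatrix (A z) gamma delta = 0.

Local Notation C := R[i]^o.
Local Notation B := (A al%:C).
Local Notation E := (edge B).
Local Notation cl := (class_of B).
Local Notation acc := (connect E).
Implicit Types (i j k m : 'I_N).

Let Ar s : 'M[R]_N := map_mx (@complex.Re R) (A s%:C).

Let Omega_near : \forall w \near (al%:C : C), Omega w.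
Proof. exact: open_nbhs_nbhs. Qed.

Let Omega_near_real : \forall s \near al, Omega (s : R)%:C.
Proof. exact: near_real. Qed.

Let ArE s : Omega s%:C -> A s%:C = map_mx (real_complex R) (Ar s).
Proof.
move=> Os; apply/matrixP => i j; rewrite !mxE.
by have [Rl _] := A_metzler Os; rewrite -[LHS]RRe_real.
Qed.

Let BE : B = map_mx (real_complex R) (Ar al).
Proof. exact: ArE. Qed.

Let Ar_off s i j : Omega s%:C -> i != j -> 0 <= Ar s i j.
Proof.
move=> Os ij; have [_ /(_ i j ij)] := A_metzler Os.
by rewrite (ArE Os) mxE ler0c.
Qed.

Let E_Ar i j : E i j = (i != j) && (Ar al i j != 0).
Proof.
rewrite /edge /= BE; congr (_ && ~~ _); rewrite mxE.
by apply/eqP/eqP => [/complexI|->].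
Qed.

(** The block triangular form of [A al%:C] persists on [Omega], so that the classes at
    [al] serve for back-substitution at all nearby points. *)
Let A_acc i j z : Omega z -> ~~ acc i j -> A z i j = 0.
Proof.
move=> Oz ij.
have h : ~~ class_le B (cl i) (cl j).
  have [iB jB] := (class_of_in B i, class_of_in B j).
  by rewrite (class_leP iB jB (class_of_refl B i) (class_of_refl B j)).
have := A_block (class_of_in B i) (class_of_in B j) h Oz.
move/matrixP => /(_ (enum_rank_in (class_of_refl B i) i) (enum_rank_in (class_of_refl B j) j)).
by rewrite !mxE !enum_rankK_in ?class_of_refl.
Qed.

Let A_continuous i j : {for al%:C, continuous (fun z : C => A z i j : C)}.
Proof. exact/derivable_continuous/A_holo. Qed.

Let Ar_continuous i j : (fun s => Ar s i j) @ al --> Ar al i j.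
Proof.
have := real_continuous (@A_continuous i j).
have -> : (fun s : R => complex.Re (A s%:C i j)) = (fun s => Ar s i j).
  by apply/funext => s; rewrite mxE.
by rewrite [Ar al i j]mxE.
Qed.

Definition class_block i s : 'M[R]_#|cl i| :=
  mxsub (@enum_val _ (mem (cl i))) (@enum_val _ (mem (cl i))) (Ar s).
Local Notation blk := class_block.
Local Notation zeta i s := (spectral_abscissa (map_mx (real_complex R) (blk i s))).

Let submatrixE i s : Omega s%:C ->
  submatrix (A s%:C) (cl i) (cl i) = map_mx (real_complex R) (blk i s).
Proof. by move=> Os; rewrite (ArE Os); apply/matrixP => x y; rewrite !mxE. Qed.

Let blk_gt0 i : (0 < #|cl i|)%N.
Proof. by apply/card_gt0P; exists i; exact: class_of_refl. Qed.

Let blk_off i s x y : Omega s%:C -> x != y -> 0 <= blk i s x y.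
Proof. by move=> Os xy; rewrite mxE Ar_off // (inj_eq enum_val_inj). Qed.

Let blk_off_near i : \forall s \near al, forall x y, x != y -> 0 <= blk i s x y.
Proof. by apply: filterS Omega_near_real => s Os x y; exact: blk_off. Qed.

Let blk_continuous i x y : (fun s => blk i s x y) @ al --> blk i al x y.
Proof.
have -> : (fun s => blk i s x y) = (fun s => Ar s (enum_val x) (enum_val y)).
  by apply/funext => s; rewrite mxE.
by rewrite [blk i al x y]mxE; exact: Ar_continuous.
Qed.

(** A path between two vertices of a class stays inside the class. *)
Let blk_irreducible i : irreducible_mx (blk i al).
Proof.
move=> x y; have := enum_valP x; have := enum_valP y.
set u := enum_val x; set v := enum_val y => vi ui.
have /connectP[q qp vE] : acc u v.
  move: ui vi; rewrite !in_class_of => /andP[_ h1] /andP[h2 _].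
  exact: connect_trans h1 h2.
rewrite -[x](enum_valK_in (class_of_refl B i)) -[y](enum_valK_in (class_of_refl B i)) -/u -/v.
move: vE; elim: q (u) qp ui => [|w q IH] u' /=.
  by move=> _ _ <-; exact: connect0.
case/andP=> uw qp ui vE.
have wi : w \in cl i.
  move: ui vi; rewrite !in_class_of => /andP[iu _] /andP[_ vi'].
  have wv : acc w v by apply/connectP; exists q.
  by apply/andP; split; [exact: connect_trans iu (connect1 uw)|exact: connect_trans wv vi'].
apply: connect_trans (IH w qp wi vE); apply: connect1 => /=.
move: uw; rewrite E_Ar => /andP[uw Auw].
rewrite mxE !enum_rankK_in // Auw andbT.
by apply: contraNneq uw => /(congr1 (@enum_val _ (mem (cl i)))); rewrite !enum_rankK_in // => ->.
Qed.

Let Ar_dominates l : 0 < l -> dominates (Ar al) l.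
Proof.
move=> l0; apply: (spectral_abscissa_dominates _ N_gt0); last by rewrite -BE A_abscissa.
by move=> i j; exact: Ar_off.
Qed.

(** A positive supersolution for [Ar al] restricts to the class: the discarded entries
    are off the diagonal, hence nonnegative. *)
Let zeta_le0 i : zeta i al <= 0.
Proof.
have off x y : x != y -> 0 <= blk i al x y by exact: blk_off.
rewrite leNgt; apply/negP => z0.
have [u u0 ult] := Ar_dominates z0.
have : dominates (blk i al) (zeta i al).
  exists (fun x => u (enum_val x)) => [x|x]; first exact: u0.
  apply: le_lt_trans (ult _).
  under eq_bigr => y _ do rewrite mxE.
  rewrite -(big_enum_val (A := mem (cl i)) (fun k => Ar al (enum_val x) k * u k)) /=.
  rewrite [leRHS](bigID (mem (cl i))) /= lerDl sumr_ge0 // => k ki.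
  rewrite mulr_ge0 ?(ltW (u0 k)) // Ar_off //.
  by apply: contraNneq ki => <-; exact: enum_valP.
by move=> /(dominates_spectral_abscissa off (blk_gt0 i)); rewrite ltxx.
Qed.

Let basicE i : basic B (cl i) = (zeta i al == 0).
Proof. by rewrite /basic A_abscissa submatrixE. Qed.

Let rk i m : 'I_#|cl i| := enum_rank_in (class_of_refl B i) m.

(** Entry at the vertices [i] and [m] of the inverse of the block containing [i]. *)
Let inv_entry s i m := block_inverse (blk i) s (rk i i) (rk i m).

Let inv_entry_mul s i k : \det (- blk i s) != 0 -> mutual E i k ->
  \sum_(m | mutual E i m) inv_entry s i m * - Ar s m k = (i == k)%:R.
Proof.
move=> d0 ik.
have ki : k \in cl i by rewrite in_class_of.
rewrite (eq_bigl (mem (cl i))); last by move=> m; rewrite /= in_class_of.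
rewrite (big_enum_val (A := mem (cl i))) /=.
have -> : (i == k) = (rk i i == rk i k).
  apply/eqP/eqP => [->//|/(congr1 (@enum_val _ (mem (cl i))))].
  by rewrite !enum_rankK_in // class_of_refl.
rewrite -(block_inverse_mul _ _ d0); apply: eq_bigr => x _.
by rewrite /inv_entry /rk enum_valK_in [in RHS]mxE enum_rankK_in.
Qed.

(** Otherwise every diagonal block of [B] would be invertible, and so would [B]. *)
Lemma exists_basic : exists i, basic B (cl i).
Proof.
apply/existsP; apply: contraT; rewrite negb_exists => /forallP nb.
have off i x y : x != y -> 0 <= blk i al x y by exact: blk_off.
have d0 i : \det (- blk i al) != 0.
  rewrite gt_eqF // (irreducible_det_gt0 (off i) (blk_gt0 i)) //.
  by rewrite lt_neqAle zeta_le0 andbT -basicE.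
have : \matrix_(i, j) Ar al i j \in unitmx.
  apply: (@block_unitmx _ _ E (fun i j => Ar al i j) (inv_entry al)).
    by move=> i j ij; rewrite mxE A_acc.
  by move=> i k; exact: inv_entry_mul.
have -> : \matrix_(i, j) Ar al i j = Ar al by apply/matrixP => i j; rewrite mxE.
rewrite unitmxE unitfE; have := spectral_abscissa_det (fun i j => Ar_off Omega_al) N_gt0.
rewrite -BE A_abscissa raddf0 sub0r -scaleN1r detZ => /eqP.
by rewrite mulf_eq0 expf_eq0 oppr_eq0 oner_eq0 andbF /= => ->.
Qed.

Hypothesis A_derivative :
   let zeta (gamma : {set 'I_N}) (s : R) :=
     spectral_abscissa (submatrix (A s%:C) gamma gamma) in
   (forall gamma, gamma \in vertex_classes B -> basic B gamma ->
      exists2 l, 0 < l &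
        has_left_derivative (zeta gamma) al l \/
        has_right_derivative (zeta gamma) al l) \/
   (forall gamma, gamma \in vertex_classes B -> basic B gamma ->
      exists2 l, l < 0 &
        has_left_derivative (zeta gamma) al l \/
        has_right_derivative (zeta gamma) al l).

(** The one-sided derivative of the abscissa determines the two-sided derivative of the
    determinant, which exists because [A] is holomorphic. *)
Let blk_derivative i (l : R) : zeta i al = 0 ->
  let z s := spectral_abscissa (submatrix (A s%:C) (cl i) (cl i)) in
  has_left_derivative z al l \/ has_right_derivative z al l ->
  exists2 c, 0 < c &
    (fun h => \det (- blk i (al + h)) / h) @ (0 : R)^' --> - l * c.
Proof.
move=> z0 z zl.
have [f' df] : exists f' : R,
    (fun h => (\det (- blk i (al + h)) - \det (- blk i al)) / h) @ (0 : R)^' --> f'.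
  apply: (@real_derivative R al (fun w : C => \det (- submatrix (A w) (cl i) (cl i)) : C)
    (fun s => \det (- blk i s))).
    apply: holo_det => x y.
    have -> : (fun w : C => (- submatrix (A w) (cl i) (cl i)) x y : C) =
        (fun w => - A w (enum_val x) (enum_val y)).
      by apply/funext => w; rewrite !mxE.
    by apply: holoN; exact: A_holo.
  apply: filterS Omega_near_real => s Os.
  by rewrite submatrixE // -map_mxN det_map_mx.
have d0 : \det (- blk i al) = 0.
  have := spectral_abscissa_det (fun x y => @blk_off i al x y Omega_al) (blk_gt0 i).
  by rewrite z0 raddf0 sub0r.
have {}df : (fun h => \det (- blk i (al + h)) / h) @ (0 : R)^' --> f'.
  by move: df; rewrite d0; under eq_fun do rewrite subr0.
have key (F : set_system R) : ProperFilter F -> F --> (0 : R)^' ->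
    (fun h => (z (al + h) - z al) / h) @ F --> l ->
    exists2 c, 0 < c & (fun h => \det (- blk i (al + h)) / h) @ (0 : R)^' --> - l * c.
  move=> PF F0' zl'.
  have zl2 : (fun h => (zeta i (al + h) - zeta i al) / h) @ F --> l.
    apply: cvg_trans zl'; apply: near_eq_cvg.
    have F0 : F --> (0 : R) by apply: cvg_trans F0' _; exact: cvg_within.
    have h1 : (fun h => al + h) @ F --> al + 0 by apply: cvgD => //; exact: cvg_cst.
    rewrite addr0 in h1.
    have h2 : \forall h \near F, Omega (al + h)%:C by exact: (h1 _ Omega_near_real).
    by apply: filterS h2 => h Oh; rewrite /z !submatrixE.
  have [c c0 fE] := det_derivative_spectral (blk_gt0 i) (blk_off_near i)
    (@blk_continuous i) (@blk_irreducible i) PF F0' z0 zl2 df.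
  by exists c => //; rewrite -fE.
case: zl => zl.
  apply: (key (0^'-)) => // P P0.
  have {}P0 : \forall h \near (0 : R), h != 0 -> P h by exact: P0.
  have : \forall h \near (0 : R), h < 0 -> P h.
    by apply: filterS P0 => h Ph h0; apply: Ph; rewrite lt_eqF.
  exact.
apply: (key (0^'+)) => // P P0.
have {}P0 : \forall h \near (0 : R), h != 0 -> P h by exact: P0.
have : \forall h \near (0 : R), 0 < h -> P h.
  by apply: filterS P0 => h Ph h0; apply: Ph; rewrite gt_eqF.
exact.
Qed.

Local Notation b i := (nat_of_bool (basic B (cl i))).

(** The side is the one where the abscissas of the basic blocks become negative: there
    [\det (- blk i s)] is positive, of the first order for a basic block.  The common
    sign of the derivatives makes the side the same for all basic blocks. *)
Let good_side : exists2 sg : R, `|sg| = 1 & forall i,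
  (\forall t \near (0 : R)^'+, \det (- blk i (al + sg * t)) != 0) /\
  forall x y, growth_le (fun t => block_inverse (blk i) (al + sg * t) x y) (b i) /\
              growth_ge (fun t => block_inverse (blk i) (al + sg * t) x y) (b i).
Proof.
have nonbasic i (sg : R) : ~~ basic B (cl i) ->
    (\forall t \near (0 : R)^'+, \det (- blk i (al + sg * t)) != 0) /\
    forall x y, growth_le (fun t => block_inverse (blk i) (al + sg * t) x y) 0 /\
                growth_ge (fun t => block_inverse (blk i) (al + sg * t) x y) 0.
  rewrite basicE => z0.
  have z1 : zeta i al < 0 by rewrite lt_neqAle z0 zeta_le0.
  exact: (block_inverse_nonbasic (blk_gt0 i) (blk_off_near i) (@blk_continuous i)
    (@blk_irreducible i)).
have basic_side i (sg l : R) : `|sg| = 1 -> sg * l < 0 -> basic B (cl i) ->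
    let z s := spectral_abscissa (submatrix (A s%:C) (cl i) (cl i)) in
    has_left_derivative z al l \/ has_right_derivative z al l ->
    (\forall t \near (0 : R)^'+, \det (- blk i (al + sg * t)) != 0) /\
    forall x y, growth_le (fun t => block_inverse (blk i) (al + sg * t) x y) 1 /\
                growth_ge (fun t => block_inverse (blk i) (al + sg * t) x y) 1.
  move=> sg1 sgl; rewrite basicE => /eqP z0 z zl.
  have [c c0 dl] := blk_derivative z0 zl.
  have sg0 : sg != 0 by rewrite -normr_gt0 sg1.
  have k0 : 0 < sg * (- l * c) by rewrite mulNr mulrN mulrA -mulNr mulr_gt0 // oppr_gt0.
  apply: (block_inverse_basic (blk_gt0 i) (blk_off_near i) (@blk_continuous i)
    (@blk_irreducible i) z0 k0).
  have dl' : (fun t => \det (- blk i (al + sg * t)) / (sg * t)) @ (0 : R)^'+ --> - l * c.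
    move/cvgrPdist_lt : dl => dl; apply/cvgrPdist_lt => e /dl.
    move=> /nbhs_ballP[r r0 rP]; near=> t.
    have t0 : 0 < t by [].
    apply: (rP (sg * t)); last by rewrite mulf_neq0 // gt_eqF.
    by rewrite /ball /= sub0r normrN normrM sg1 mul1r gtr0_norm.
  have lim : (fun t => sg * (\det (- blk i (al + sg * t)) / (sg * t))) @ (0 : R)^'+
      --> sg * (- l * c) by apply: cvgM => //; exact: cvg_cst.
  apply: cvg_trans lim; apply: near_eq_cvg; near=> t.
  by rewrite invfM mulrCA (mulrA sg) divff // mul1r.
have case_side (sg : R) (P : R -> Prop) : `|sg| = 1 -> (forall l, P l -> sg * l < 0) ->
    (forall gamma, gamma \in vertex_classes B -> basic B gamma ->
      exists2 l, P l &
        let z s := spectral_abscissa (submatrix (A s%:C) gamma gamma) in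
        has_left_derivative z al l \/ has_right_derivative z al l) ->
    exists2 sg : R, `|sg| = 1 & forall i,
    (\forall t \near (0 : R)^'+, \det (- blk i (al + sg * t)) != 0) /\
    forall x y, growth_le (fun t => block_inverse (blk i) (al + sg * t) x y) (b i) /\
              growth_ge (fun t => block_inverse (blk i) (al + sg * t) x y) (b i).
  move=> sg1 Psg H; exists sg => // i.
  case bi: (basic B (cl i)); last by apply: nonbasic; rewrite bi.
  have [l Pl zl] := H _ (class_of_in B i) bi.
  exact: (basic_side i sg l sg1 (Psg l Pl) bi zl).
case: A_derivative => H.
  apply: (case_side (-1) (fun l => 0 < l)); first by rewrite normrN1.
    by move=> l l0; rewrite mulN1r oppr_lt0.
  exact: H.
apply: (case_side 1 (fun l => l < 0)); first by rewrite normr1.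
  by move=> l l0; rewrite mul1r.
exact: H.
Unshelve. all: by end_near. Qed.

Section Side.
Variable sg : R.
Hypothesis sg1 : `|sg| = 1.
Hypothesis inv_growth : forall i,
  (\forall t \near (0 : R)^'+, \det (- blk i (al + sg * t)) != 0) /\
  forall x y, growth_le (fun t => block_inverse (blk i) (al + sg * t) x y) (b i) /\
              growth_ge (fun t => block_inverse (blk i) (al + sg * t) x y) (b i).

Let a i j t := Ar (al + sg * t) i j.
Let p i m t := inv_entry (al + sg * t) i m.
Let X i j t := - invmx (Ar (al + sg * t)) i j.

Let Omega_ray : \forall t \near (0 : R)^'+, Omega (ray al sg t).
Proof. exact: near_ray. Qed.

Let a_cvg i j : (fun t => a i j t) @ (0 : R)^'+ --> Ar al i j.
Proof.
apply: (cvg_comp _ _ _ (@Ar_continuous i j)).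
have h : (fun t => al + sg * t) @ (0 : R)^'+ --> al + sg * 0.
  apply: cvgD; first exact: cvg_cst.
  by apply: cvgM; [exact: cvg_cst|exact: cvg_at_right_filter].
by rewrite mulr0 addr0 in h.
Qed.

Let a_acc i j : ~~ acc i j -> \forall t \near (0 : R)^'+, a i j t = 0.
Proof.
move=> ij; apply: filterS Omega_ray => t Ot.
by rewrite /a mxE A_acc.
Qed.

Let a_off i j : i != j -> near_nonneg (a i j).
Proof. by move=> ij; apply: filterS Omega_ray => t Ot; exact: Ar_off. Qed.

Let growth_le_cvg (f : R -> R) (l : R) : f @ (0 : R)^'+ --> l -> growth_le f 0.
Proof.
move=> fl; exists (l + 1); near=> t; rewrite expr0 divr1; near: t.
by apply: (cvgr_le _ fl); rewrite ltrDl.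
Unshelve. all: by end_near. Qed.

Let a_le i j : i != j -> growth_le (a i j) 0.
Proof. by move=> _; exact: growth_le_cvg. Qed.

Let a_diag i : growth_le (fun t => - a i i t) 0.
Proof. by apply: growth_le_cvg; apply: cvgN; exact: a_cvg. Qed.

Let a_edge i j : E i j -> i != j /\ growth_ge (a i j) 0.
Proof.
rewrite E_Ar => /andP[ij aij]; split => //.
have a0 : 0 < Ar al i j by rewrite lt_neqAle eq_sym aij Ar_off.
have [] := @cvg_growth R (a i j) 0 _ a0; last by [].
by under eq_fun do rewrite expr0 mulr1; exact: a_cvg.
Qed.

Let p_inv i k : mutual E i k -> \forall t \near (0 : R)^'+,
  \sum_(m | mutual E i m) p i m t * - a m k t = (i == k)%:R.
Proof.
move=> ik; have [d0 _] := inv_growth i; apply: filterS d0 => t d0.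
exact: inv_entry_mul.
Qed.

Let p_le i j : mutual E i j -> growth_le (p i j) (b i).
Proof. by move=> _; have [_ /(_ (rk i i) (rk i j))[]] := inv_growth i. Qed.

Let p_ge i j : mutual E i j -> growth_ge (p i j) (b i).
Proof. by move=> _; have [_ /(_ (rk i i) (rk i j))[]] := inv_growth i. Qed.

Let Ar_unit : \forall t \near (0 : R)^'+, Ar (al + sg * t) \in unitmx.
Proof.
have := near_block_unitmx a_acc p_inv; apply: filterS => t.
by have -> : \matrix_(i, j) a i j t = Ar (al + sg * t) by apply/matrixP => i j; rewrite mxE.
Qed.

Let aX j : \forall t \near (0 : R)^'+, forall m,
  \sum_k a m k t * X k j t = - (m == j)%:R.
Proof.
apply: filterS Ar_unit => t /mulmxV /matrixP aV m.
under eq_bigr => k _ do rewrite mulrN.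
by rewrite sumrN; have := aV m j; rewrite !mxE => ->.
Qed.

Lemma ray_inverse : \forall t \near (0 : R)^'+, forall i j,
  invmx (A (ray al sg t)) i j = - (X i j t)%:C.
Proof.
apply: filterS Omega_ray => t Ot i j; rewrite (ArE Ot) -map_invmx mxE /X.
by rewrite -(rmorphN (real_complex R)) opprK.
Qed.

Lemma ray_inverse_nonneg i j : near_nonneg (X i j).
Proof. exact: (solution_nonneg a_acc a_off p_inv p_ge (aX j)). Qed.

Lemma ray_inverse_ge i j c : class_chain B c -> i \in head finset.set0 c ->
  j \in last finset.set0 c -> growth_ge (X i j) (chain_length B c).
Proof.
apply: (@growth_ge_chain R N B j (fun i => X i j)).
  move=> k; exact: (@solution_class R N E a p (fun i => b i) a_acc a_off p_inv p_ge j
    (fun i => X i j) (aX j) k).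
move=> k l d; exact: (@solution_leaving R N E a p (fun i => b i) a_acc a_off a_diag a_edge
  p_inv p_ge j (fun i => X i j) (aX j) k l d).
Qed.

Lemma ray_inverse_le i j d :
  (forall c, class_chain B c -> i \in head finset.set0 c -> j \in last finset.set0 c ->
     (chain_length B c <= d)%N) -> growth_le (X i j) d.
Proof.
apply: (@growth_le_chain R N B j (fun i => X i j)) => D.
exact: (@solution_le R N E a p (fun i => b i) a_acc a_off a_le p_inv p_le p_ge j
  (fun i => X i j) (aX j) D).
Qed.

(** [A] is invertible on the ray with an inverse of polynomial growth, so [\det A]
    has a zero of finite order [m], and the inverse is the adjugate over [\det A]. *)
Lemma inverse_meromorphic : exists m : nat, forall i j, exists2 g : C -> C,
  holomorphic_at g al%:C &
  \forall w \near (al%:C : C)^', invmx (A w) i j = g w / (w - al%:C) ^+ m.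
Proof.
have dA : \forall w \near (al%:C : C), forall i j, derivable (fun z : C => A z i j : C) w 1.
  by apply: filterS Omega_near => w Ow i j; exact: A_holo.
have hdet : holomorphic_at (fun z : C => \det (A z) : C) al%:C.
  by apply: filterS dA => w dw; exact: holo_det.
(* Leibniz' formula bounds the determinant of the inverse above, hence [\det A] below;
   [N] bounds the length of every chain. *)
have [K dX] : growth_le (fun t => \sum_(s : 'S_N) \prod_i X i (s i) t) (\sum_(i < N) N).
  apply: growth_le_sum => s _.
  apply: growth_le_prod => i; first exact: ray_inverse_nonneg.
  by apply: ray_inverse_le => c cc _ _; exact: chain_length_le.
pose n := (\sum_(i < N) N)%N.
have K1 : 0 < `|K| + 1 by rewrite ltr_wpDl.
have low : \forall t \near (0 : R)^'+, (`|K| + 1)^-1 * t ^+ n <= cabs (\det (A (ray al sg t))).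
  have X0 : \forall t \near (0 : R)^'+, forall i j, 0 <= X i j t.
    by apply: filter_forall => i; apply: filter_forall => j; exact: ray_inverse_nonneg.
  near=> t; have t0 : 0 < t by [].
  have tn : 0 < t ^+ n by rewrite exprn_gt0.
  have Ot : Omega (ray al sg t) by near: t.
  have u : Ar (al + sg * t) \in unitmx by near: t.
  have le : \sum_(s : 'S_N) \prod_i X i (s i) t <= K / t ^+ n by near: t.
  have Xt i j : 0 <= X i j t by move: i j; near: t.
  rewrite (ArE Ot) det_map_mx cabsR.
  set a0 := Ar (al + sg * t) in u *.
  have di : `|\det (invmx a0)| <= K / t ^+ n.
    apply: le_trans le; apply: le_trans (ler_norm_sum _ _ _) _.
    apply: ler_sum => s _; rewrite normrM normrX normrN1 expr1n mul1r normr_prod.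
    by apply: ler_prod => i _; rewrite normr_ge0 /= -normrN ger0_norm // Xt.
  have d0 : \det a0 != 0 by rewrite -unitfE -unitmxE.
  have dd : `|\det a0| * `|\det (invmx a0)| = 1.
    by rewrite -normrM -det_mulmx mulmxV // det1 normr1.
  have : 1 <= `|\det a0| * ((`|K| + 1) / t ^+ n).
    rewrite -dd ler_wpM2l //; apply: le_trans di _.
    rewrite ler_wpM2r ?invr_ge0 ?(ltW tn) //.
    by apply: le_trans (ler_norm K) _; rewrite lerDl.
  by rewrite mulrA ler_pdivlMr // mul1r -ler_pdivrMr // mulrC.
have K2 : 0 < (`|K| + 1)^-1 by rewrite invr_gt0.
have [m [u [hu u0 uE]]] := @ray_order R al sg sg1 n _ _ K2 hdet low.
exists m => i j.
have une : \forall w \near (al%:C : C), u w != 0.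
  have /continuous_cabsP/(_ (cabs (u al%:C)) _)[|d d0 dP] := holomorphic_at_continuous hu.
    by rewrite cabs_gt0.
  apply/near_cabsP; exists d => // w /dP; apply: contraTneq => ->.
  by rewrite sub0r cabsN ltxx.
exists (fun w => (\adj (A w)) i j * (u w)^-1).
  near=> w.
  have uw : u w != 0 by near: w.
  have dw : forall i j, derivable (fun z : C => A z i j : C) w 1 by near: w.
  have duw : derivable u w 1 by near: w.
  have h1 := @holo_adj R N A w i j dw.
  have h2 := holoV uw duw.
  exact: (holoM h1 h2).
have une' : \forall w \near (al%:C : C)^', u w != 0 by exact: nbhs_dnbhs.
have uE' : \forall w \near (al%:C : C)^', \det (A w) = (w - al%:C) ^+ m * u w by exact: nbhs_dnbhs.
have wne : \forall w \near (al%:C : C)^', w != al%:C by exact: nbhs_dnbhs_neq.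
near=> w.
have uw : u w != 0 by near: w.
have ew : \det (A w) = (w - al%:C) ^+ m * u w by near: w.
have w0 : w - al%:C != 0 by rewrite subr_eq0; near: w.
have unit_w : A w \in unitmx by rewrite unitmxE unitfE ew mulf_neq0 // expf_neq0.
by rewrite /invmx unit_w mxE ew invfM mulrC mulrA mulrAC.
Unshelve. all: by end_near. Qed.

End Side.

Lemma inverse_growth : exists sg : R, exists X : 'I_N -> 'I_N -> R -> R, [/\ `|sg| = 1,
  \forall t \near (0 : R)^'+, forall i j, invmx (A (ray al sg t)) i j = - (X i j t)%:C,
  (forall i j, near_nonneg (X i j)),
  (forall i j c, class_chain B c -> i \in head finset.set0 c ->
     j \in last finset.set0 c -> growth_ge (X i j) (chain_length B c)) /\
  (forall i j d, (forall c, class_chain B c -> i \in head finset.set0 c ->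
     j \in last finset.set0 c -> (chain_length B c <= d)%N) -> growth_le (X i j) d) &
  exists m : nat, forall i j, exists2 g : C -> C, holomorphic_at g al%:C &
    \forall w \near (al%:C : C)^', invmx (A w) i j = g w / (w - al%:C) ^+ m].
Proof.
have [sg sg1 H] := good_side.
exists sg, (fun i j t => - invmx (Ar (al + sg * t)) i j); split => //.
- exact: ray_inverse.
- exact: ray_inverse_nonneg.
- by split; [exact: ray_inverse_ge|exact: ray_inverse_le].
- exact: (@inverse_meromorphic sg).
Qed.

End Family.

(** * From growth to poles *)

Section BilinearForm.
Variables (R : realType) (N : nat) (v w : 'cV[R]_N) (X : 'I_N -> 'I_N -> R -> R).
Hypothesis v_ge0 : forall i, 0 <= v i 0.
Hypothesis w_ge0 : forall i, 0 <= w i 0.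
Hypothesis X_ge0 : forall i j, near_nonneg (X i j).
Implicit Types (i j : 'I_N).

Definition real_bilinear t := \sum_j \sum_i v i 0 * X i j t * w j 0.

Lemma real_bilinear_nonneg : near_nonneg real_bilinear.
Proof.
have X0 : \forall t \near (0 : R)^'+, forall i j, 0 <= X i j t.
  by apply: filter_forall => i; apply: filter_forall => j; exact: X_ge0.
apply: filterS X0 => t Xt.
by apply: sumr_ge0 => j _; apply: sumr_ge0 => i _; rewrite !mulr_ge0.
Qed.

Lemma real_bilinear_le d : (forall i j, 0 < v i 0 -> 0 < w j 0 -> growth_le (X i j) d) ->
  growth_le real_bilinear d.
Proof.
move=> H; apply: growth_le_sum => j _; apply: growth_le_sum => i _.
have zero : (fun t => v i 0 * X i j t * w j 0) = (fun=> 0) ->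
    growth_le (fun t => v i 0 * X i j t * w j 0) d.
  by move=> ->; exact: growth_le0.
have [vi|vi] := eqVneq (v i 0) 0.
  by apply: zero; apply/funext => t; rewrite vi !mul0r.
have [wj|wj] := eqVneq (w j 0) 0.
  by apply: zero; apply/funext => t; rewrite wj mulr0.
have vp : 0 < v i 0 by rewrite lt_neqAle eq_sym vi v_ge0.
have wp : 0 < w j 0 by rewrite lt_neqAle eq_sym wj w_ge0.
have [K hK] := H i j vp wp.
exists (v i 0 * w j 0 * K); near=> t.
rewrite mulrAC -[leRHS]mulrA ler_wpM2l ?mulr_ge0 //; near: t; exact: hK.
Unshelve. all: by end_near. Qed.

Lemma real_bilinear_ge i j d : 0 < v i 0 -> 0 < w j 0 -> growth_ge (X i j) d ->
  growth_ge real_bilinear d.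
Proof.
move=> vi wj h; apply: growth_ge_le (growth_geZ (mulr_gt0 vi wj) h).
have X0 : \forall t \near (0 : R)^'+, forall i j, 0 <= X i j t.
  by apply: filter_forall => k; apply: filter_forall => l; exact: X_ge0.
apply: filterS X0 => t Xt; rewrite /real_bilinear (bigD1 j) //= (bigD1 i) //=.
rewrite mulrAC -addrA lerDl addr_ge0 //.
  by apply: sumr_ge0 => k _; rewrite !mulr_ge0.
by apply: sumr_ge0 => l _; apply: sumr_ge0 => k _; rewrite !mulr_ge0.
Qed.

End BilinearForm.

Lemma bilinear_inverseE (R : realType) n (v w : 'cV[R]_n) (A : R[i] -> 'M[R[i]]_n) z :
  bilinear_inverse v w A z =
  \sum_j \sum_i (v i 0)%:C * invmx (A z) i j * (w j 0)%:C.
Proof.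
rewrite /bilinear_inverse mxE; apply: eq_bigr => j _.
rewrite !mxE mulr_suml; apply: eq_bigr => i _.
by rewrite !mxE.
Qed.

Lemma bigmax_set_gt0 (R : realType) n (gamma : {set 'I_n}) (v : 'cV[R]_n) :
  reflect (exists2 i, i \in gamma & 0 < v i 0) (0 < \big[Num.max/0]_(i in gamma) v i 0).
Proof.
apply: (iffP (bigmax_gtP _ _ _ _)) => [[|[i ig vi]]|[i ig vi]].
- by rewrite ltxx.
- by exists i.
- by right; exists i.
Qed.

Theorem theorem3p1 (R : realType) (Omega : set R[i]^o) (N : nat)
    (A : R[i] -> 'M[R[i]]_N) (v w : 'cV[R]_N) (alpha : R)
    (N_gt0 : (0 < N)%N)
    (Omega_open : open Omega)
    (Omega_connected : connected Omega)
    (A_holomorphic : mx_holomorphic_on Omega A)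
    (A_nonsingular : exists2 z, Omega z & A z \in unitmx)
    (v_ge0 : forall i, 0 <= v i 0)
    (w_ge0 : forall i, 0 <= w i 0)
    (Omega_alpha : Omega alpha%:C)
    (A_metzler : forall s : R, Omega s%:C -> metzler (A s%:C))
    (A_abscissa : spectral_abscissa (A alpha%:C) = 0)
    (A_block : forall gamma delta : {set 'I_N},
       gamma \in vertex_classes (A alpha%:C) -> delta \in vertex_classes (A alpha%:C) ->
       ~~ class_le (A alpha%:C) gamma delta ->
       forall z, Omega z -> submatrix (A z) gamma delta = 0)
    (A_derivative :
       let zeta (gamma : {set 'I_N}) (s : R) :=
         spectral_abscissa (submatrix (A s%:C) gamma gamma) in
       (forall gamma, gamma \in vertex_classes (A alpha%:C) -> basic (A alpha%:C) gamma ->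
          exists2 l, 0 < l &
            has_left_derivative (zeta gamma) alpha l \/
            has_right_derivative (zeta gamma) alpha l) \/
       (forall gamma, gamma \in vertex_classes (A alpha%:C) -> basic (A alpha%:C) gamma ->
          exists2 l, l < 0 &
            has_left_derivative (zeta gamma) alpha l \/
            has_right_derivative (zeta gamma) alpha l)) :
  [/\ exists2 d, longest_chain_length (A alpha%:C) (fun=> True) d &
        mx_pole_of_order (fun z => invmx (A z)) alpha%:C d,
      (exists c, positive_chain_between (A alpha%:C) v w c) ->
        exists2 d,
          longest_chain_length (A alpha%:C)
            (positive_chain_between (A alpha%:C) v w) d &
          pole_of_order (bilinear_inverse v w A) alpha%:C d &
      (~ exists c, positive_chain_between (A alpha%:C) v w c) ->
        removable_singularity (bilinear_inverse v w A) alpha%:C].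

Proof.
have [sg [X [sg1 Xinv X0 [Xge Xle] [m Xmero]]]] := inverse_growth N_gt0 Omega_open
  A_holomorphic Omega_alpha A_metzler A_abscissa A_block A_derivative.
have [i0 bi0] := exists_basic N_gt0 Omega_alpha A_metzler A_abscissa A_block.
set B := A alpha%:C in Xge Xle bi0 *.
(* The entries of the inverse are nonpositive on the ray, so the moduli are the [X i j]. *)
have entry i j : \forall t \near (0 : R)^'+,
    cabs (invmx (A (ray alpha sg t)) i j) = X i j t.
  have h := X0 i j; near=> t.
  have e : forall i j, invmx (A (ray alpha sg t)) i j = - (X i j t)%:C by near: t.
  have Xt : 0 <= X i j t by near: t.
  by rewrite e cabsN cabsR ger0_norm.
have up (f : R[i]^o -> R[i]^o) (g : R -> R) d : growth_le g d ->
    (\forall t \near (0 : R)^'+, cabs (f (ray alpha sg t)) = g t) ->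
    exists K, \forall t \near (0 : R)^'+, cabs (f (ray alpha sg t)) <= K / t ^+ d.
  by move=> [K hK] fg; exists K; apply: filterS2 fg hK => t ->.
have pole (f : R[i]^o -> R[i]^o) (g : R -> R) d : (0 < d)%N ->
    meromorphic_at f alpha%:C -> growth_le g d -> growth_ge g d ->
    (\forall t \near (0 : R)^'+, cabs (f (ray alpha sg t)) = g t) ->
    pole_of_order f alpha%:C d.
  move=> d0 mf gle [k k0 hk] fg; have [K hK] := up f g d gle fg.
  apply: (ray_pole_of_order sg1 d0 k0 mf hK).
  by apply: filterS2 fg hk => t ->.
have bil : \forall t \near (0 : R)^'+,
    cabs (bilinear_inverse v w A (ray alpha sg t)) = real_bilinear v w X t.
  have h := real_bilinear_nonneg v_ge0 w_ge0 X0; near=> t.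
  have e : forall i j, invmx (A (ray alpha sg t)) i j = - (X i j t)%:C by near: t.
  have S0 : 0 <= real_bilinear v w X t by near: t.
  rewrite bilinear_inverseE.
  have -> : \sum_j \sum_i (v i 0)%:C * invmx (A (ray alpha sg t)) i j * (w j 0)%:C =
      - (real_bilinear v w X t)%:C.
    rewrite /real_bilinear rmorph_sum -sumrN; apply: eq_bigr => j _.
    rewrite rmorph_sum -sumrN; apply: eq_bigr => i _.
    by rewrite e !rmorphM mulrN mulNr.
  by rewrite cabsN cabsR ger0_norm.
(* All entries of the inverse have a numerator over the same power of [u - alpha%:C]. *)
have bmero : meromorphic_at (bilinear_inverse v w A) alpha%:C.
  pose is_numerator i j (h : R[i]^o -> R[i]^o) := holomorphic_at h alpha%:C /\
    \forall u \near (alpha%:C : R[i]^o)^', invmx (A u) i j = h u / (u - alpha%:C) ^+ m.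
  have ex_num i j : exists h, is_numerator i j h by have [h ? ?] := Xmero i j; exists h.
  have ex_row i : exists gi, forall j, is_numerator i j (gi j).
    by have [gi giP] := choice (ex_num i); exists gi.
  have [g gP] := choice ex_row.
  have hol i j : holomorphic_at (g i j) alpha%:C by case: (gP i j).
  have inv_eq i j : \forall u \near (alpha%:C : R[i]^o)^',
      invmx (A u) i j = g i j u / (u - alpha%:C) ^+ m by case: (gP i j).
  pose f (u : R[i]^o) : R[i]^o := \sum_j \sum_i (v i 0)%:C * g i j u * (w j 0)%:C.
  exists m, f; split.
    have hg := filter_forall (nbhs_filter _) (fun i => filter_forall (nbhs_filter _) (hol i)).
    suff : \forall u \near (alpha%:C : R[i]^o), derivable f u 1 by [].
    near=> u; have dg : forall i j, derivable (g i j) u 1 by near: u.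
    have term i j := holoM (holoM (holo_cst (v i 0)%:C u) (dg i j)) (holo_cst (w j 0)%:C u).
    have row j := holo_sum (r := index_enum 'I_N) (term ^~ j).
    exact: (holo_sum (r := index_enum 'I_N) row).
  have gE : \forall u \near (alpha%:C : R[i]^o)^', forall i j,
      invmx (A u) i j = g i j u / (u - alpha%:C) ^+ m.
    apply: filter_forall => i; apply: filter_forall => j.
    exact: inv_eq.
  apply: filterS gE => u gE; rewrite bilinear_inverseE mulr_suml.
  apply: eq_bigr => j _; rewrite mulr_suml; apply: eq_bigr => i _.
  by rewrite gE mulrA mulrAC.
have vertices c : class_chain B c -> (exists2 i, i \in head finset.set0 c & 0 < v i 0) ->
    (exists2 j, j \in last finset.set0 c & 0 < w j 0) -> (0 < chain_length B c)%N ->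
    positive_chain_between B v w c.
  by move=> cc hv hw c0; split => //; apply/bigmax_set_gt0.
split.
- have [d dlong] : exists d, longest_chain_length B (fun=> True) d.
    by apply: longest_chain_exists; exists [:: class_of B i0] => //; exact: class_chain1.
  exists d => //; have [[c [cc _ cd]] dmax] := dlong.
  have d0 : (0 < d)%N.
    by apply: leq_trans (dmax _ (class_chain1 B i0) I); rewrite /chain_length /= bi0.
  have Xd i j : growth_le (X i j) d by apply: Xle => c' cc' _ _; exact: dmax.
  have mero i j : meromorphic_at (fun u => invmx (A u) i j) alpha%:C.
    by have [g hg gE] := Xmero i j; exists m, g.
  have [i ic] := class_chain_head cc.
  have [[j jc] _] := vertex_classesP (class_chain_last cc).
  split => //.
    exists i, j; apply: (pole _ (X i j)) => //.
    by rewrite -cd; exact: Xge.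
  move=> k l e pe; have [K hK] := up (fun u => invmx (A u) k l) _ _ (Xd k l) (entry k l).
  exact: (pole_of_order_ray_le sg1 pe hK).
- move=> [c0 pc0].
  have [d dlong] : exists d, longest_chain_length B (positive_chain_between B v w) d.
    by apply: longest_chain_exists; exists c0 => //; case: pc0.
  exists d => //; have [[c [cc pc cd]] dmax] := dlong.
  have [_ c_gt0 /bigmax_set_gt0[i ic vi] /bigmax_set_gt0[j jc wj]] := pc.
  apply: (pole _ (real_bilinear v w X)) => //; first by rewrite -cd.
    apply: real_bilinear_le => // k l vk wl; apply: Xle => c' cc' kc' lc'.
    (* A chain of length [0] satisfies any bound; the others compete for the maximum. *)
    have [->//|c'0] := posnP (chain_length B c').
    by apply: dmax => //; apply: vertices => //; [exists k|exists l].
  by apply: (real_bilinear_ge v_ge0 w_ge0 X0 vi wj); rewrite -cd; exact: Xge.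
move=> nopc.
(* Every chain between the supports of [v] and [w] now has length [0]. *)
have Sle : growth_le (real_bilinear v w X) 0.
  apply: real_bilinear_le => // k l vk wl; apply: Xle => c cc kc lc.
  rewrite leqNgt; apply/negP => c0; apply: nopc; exists c.
  by apply: vertices => //; [exists k|exists l].
have [K hK] := up (bilinear_inverse v w A) _ _ Sle bil.
apply: (ray_removable sg1 bmero (K := K)); apply: filterS hK => t.
by rewrite expr0 divr1.
Unshelve. all: by end_near. Qed.
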